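(* Let $\pi$ be a finite-dimensional irreducible unitary representation of $G$ of dimension $d_\pi$ and let $j\in\{1,\ldots,d_\pi\}$. Assume that $\phi\in C^1(X,G)$ and suppose either that $F_1$ is uniquely ergodic and $\pi\circ\phi$ is diagonal, or that $T_\phi$ is uniquely ergodic. Then the strong limit $$D_{\phi,\pi}=\mathop{\mathrm{s\text{-}lim}}_{N\to\infty}\frac1N\big[A,(U_{\phi,\pi,j})^N\big](U_{\phi,\pi,j})^{-N}$$ exists and is equal to the operator of multiplication by the constant matrix $i\,(d\pi)_{e_G}(M_{\phi,\star})$, and (a) $\lim_{N\to\infty}\big\langle\varphi,(U_{\phi,\pi,j})^N\psi\big\rangle=0$ for each $\varphi\in\ker(D_{\phi,\pi})^\perp$ and $\psi\in\mathcal H^{(\pi)}_j$, (b) $U_{\phi,\pi,j}\big|_{\ker(D_{\phi,\pi})^\perp}$ has purely continuous spectrum.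
   Context: Setting. $X$ is a smooth compact second countable Hausdorff manifold with Borel probability measure $\mu_X$, and $\{F_t\}_{t\in\mathbb R}$ is a $C^1$ flow on $X$ preserving $\mu_X$, with continuous vector field $Y$; $\mathcal L_Yf(x)=\frac{d}{dt}|_{t=0}f(F_t(x))$. $G$ is a compact Lie group with normalised Haar measure $\mu_G$, identity $e_G$ and Lie algebra $\mathfrak g$; $\mathrm{Ad}_gZ=gZg^{-1}$. $T_\phi(x,g)=(F_1(x),g\phi(x))$ on $X\times G$, and $U_\phi\psi=\psi\circ T_\phi$ is the Koopman operator, unitary in $\mathcal H:=L^2(X\times G,\mu_X\otimes\mu_G)$. ''$F_1$ (resp. $T_\phi$) uniquely ergodic'' means that $\mu_X$ (resp. $\mu_X\otimes\mu_G$) is the only invariant Borel probability measure. $M_\phi:=\mathcal L_Y\phi\cdot\phi^{-1}:X\to\mathfrak g$ (right translation to $T_{e_G}G\simeq\mathfrak g$). In the case $F_1$ uniquely ergodic and $\pi\circ\phi$ diagonal, $M_{\phi,\star}:=\int_Xd\mu_X(x)\,M_\phi(x)$; in the case $T_\phi$ uniquely ergodic, $M_{\phi,\star}:=\int_{X\times G}d(\mu_X\otimes\mu_G)(x,g)\,\mathrm{Ad}_gM_\phi(x)$. $\pi:G\to\mathrm U(d_\pi)$ takes values in unitary matrices, with matrix elements $\pi_{jk}$; $\pi\circ\phi$ diagonal means $\pi_{k\ell}\circ\phi=0$ for $k\ne\ell$. $\mathcal H^{(\pi)}_j:=\bigoplus_{k=1}^{d_\pi}L^2(X,\mu_X)\otimes\{\pi_{jk}\}\subset\mathcal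 H$ is a reducing subspace for $U_\phi$, and $U_{\phi,\pi,j}:=U_\phi|_{\mathcal H^{(\pi)}_j}$. $(d\pi)_{e_G}$ is the differential of $\pi$ at $e_G$, from $\mathfrak g$ to the Lie algebra $\mathfrak g_\pi$ of $\pi(G)$. A $d_\pi\times d_\pi$ matrix $M$ acts in $\mathcal H^{(\pi)}_j$ by $M\sum_k\varphi_k\otimes\pi_{jk}:=\sum_{k,\ell}M_{k\ell}\varphi_\ell\otimes\pi_{jk}$. $H$ is the self-adjoint operator in $L^2(X,\mu_X)$ given by $H\varphi=\lim_{t\to0}it^{-1}(\varphi\circ F_t-\varphi)$ (equal to $i\mathcal L_Y\varphi$ on $C^1(X)$, on which it is essentially self-adjoint). $A$ is the self-adjoint operator in $\mathcal H^{(\pi)}_j$ given by $A\sum_k\varphi_k\otimes\pi_{jk}=\sum_kH\varphi_k\otimes\pi_{jk}$, with domain $\bigoplus_k\mathcal D(H)\otimes\{\pi_{jk}\}$. For $S=(U_{\phi,\pi,j})^N$, the form $\varphi\mapsto\langle A\varphi,S\varphi\rangle-\langle\varphi,SA\varphi\rangle$ on $\mathcal D(A)$ extends continuously, and $[A,S]$ denotes the associated bounded operator. ''Purely continuous spectrum'' means no eigenvalues. *)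

(* Defs.v *)
From HB Require Import structures.
From mathcomp Require Import all_boot all_order all_algebra complex spectral.
From mathcomp Require Import all_classical all_reals all_analysis.
Import numFieldNormedType.Exports.
Import Order.TTheory GRing.Theory Num.Theory.

Set Implicit Arguments.
Unset Strict Implicit.
Unset Printing Implicit Defensive.

Local Open Scope classical_set_scope.
Local Open Scope ring_scope.

Section Smooth.
Variable R : realType.

(* [U] is meant to be open and [V] finite-dimensional, in which case
   continuity of [x |-> 'd f x] is continuity of [x |-> 'd f x v] for all
   [v].  A map is smooth when it is C^k for every [k]. *)
Fixpoint Ck (k : nat) (V W : normedModType R) (U : set V) (f : V -> W)
    {struct k} : Prop :=
  match k with
  | 0 => forall x, U x -> {for x, continuous f}
  | k'.+1 => (forall x, U x -> differentiable f x) /\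
             (forall v, Ck k' U (fun x => 'd f x v))
  end.

(* [chart_inv] is only relevant on the image of [chart_dom]. *)
Record chart (E : normedModType R) (X : Type) := Chart {
  chart_dom : set X;
  chart_fun : X -> E;
  chart_inv : E -> X }.

Definition is_chart (E : normedModType R) (X : topologicalType)
    (c : chart E X) : Prop :=
  [/\ open (chart_dom c),
      open (chart_fun c @` chart_dom c),
      {within chart_dom c, continuous (chart_fun c)},
      {within chart_fun c @` chart_dom c, continuous (chart_inv c)} &
      forall x, chart_dom c x -> chart_inv c (chart_fun c x) = x].

(* An atlas is presented as a choice of a chart [c x] around each point [x].
   The chart [c x] also serves to identify the tangent space at [x] with the
   model space [E]. *)
Definition smooth_atlas (E : normedModType R) (X : topologicalType)
    (c : X -> chart E X) : Prop :=
  [/\ forall x, is_chart (c x),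
      forall x, chart_dom (c x) x &
      forall x y k, Ck k
        (chart_fun (c x) @` (chart_dom (c x) `&` chart_dom (c y)))
        (chart_fun (c y) \o chart_inv (c x))].

Definition compact_manifold (n : nat) (X : topologicalType)
    (c : X -> chart 'rV[R]_n X) : Prop :=
  [/\ compact [set: X], hausdorff_space X, @second_countable X &
      smooth_atlas c].

Definition line_atlas (t : R) : chart R^o R := Chart setT id id.

Definition prod_atlas (E E' : normedModType R) (X X' : Type)
    (c : X -> chart E X) (c' : X' -> chart E' X') (p : X * X') :
    chart (E * E')%type (X * X')%type :=
  Chart (chart_dom (c p.1) `*` chart_dom (c' p.2))
        (fun q => (chart_fun (c p.1) q.1, chart_fun (c' p.2) q.2))
        (fun v => (chart_inv (c p.1) v.1, chart_inv (c' p.2) v.2)).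

Definition Ck_map (k : nat) (E E' : normedModType R) (X X' : topologicalType)
    (c : X -> chart E X) (c' : X' -> chart E' X') (f : X -> X') : Prop :=
  continuous f /\
  forall x y, Ck k
    (chart_fun (c x) @` (chart_dom (c x) `&` f @^-1` chart_dom (c' y)))
    (chart_fun (c' y) \o f \o chart_inv (c x)).

Definition tangent_map (E E' : normedModType R) (X X' : Type)
    (c : X -> chart E X) (c' : X' -> chart E' X') (f : X -> X') (x : X)
    (v : E) : E' :=
  'd (chart_fun (c' (f x)) \o f \o chart_inv (c x)) (chart_fun (c x) x) v.

Definition velocity (E : normedModType R) (X : Type) (c : X -> chart E X)
    (gamma : R -> X) (t : R) : E :=
  derive1 (chart_fun (c (gamma t)) \o gamma) t.

End Smooth.

(* [X] with its Borel sigma-algebra.  For second countable [X] and [G], the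
   product sigma-algebra on [borel X * borel G] is the Borel one of [X * G]. *)
Notation borel X := (g_sigma_algebraType (@open X)).

Definition preserves d (T : measurableType d) (R : realType)
    (mu : set T -> \bar R) (f : T -> T) : Prop :=
  forall A, measurable A -> mu (f @^-1` A) = mu A.

Definition uniquely_ergodic d (T : measurableType d) (R : realType)
    (mu : set T -> \bar R) (f : T -> T) : Prop :=
  preserves mu f /\
  forall nu : probability T R, preserves nu f ->
    forall A, measurable A -> nu A = mu A.

Record C1_flow (R : realType) (n : nat) (X : topologicalType)
    (c : X -> chart 'rV[R]_n X) (F : R -> X -> X) : Prop := C1Flow {
  flow0 : forall x, F 0 x = x;
  flowD : forall s t x, F (s + t) x = F s (F t x);
  (* jointly in (t, x), so that the generating vector field is continuous *)
  flow_C1 : Ck_map 1 (prod_atlas (@line_atlas R) c) c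
              (fun p : R * X => F p.1 p.2) }.

#[short(type="ptopologicalGroupType")]
HB.structure Definition PTopologicalGroup :=
  {G of PointedTopological G & Group G}.

Section LieGroup.
Variables (R : realType) (m : nat) (G : ptopologicalGroupType).
Variable c : G -> chart 'rV[R]_m G.

Definition compact_lie_group : Prop :=
  [/\ compact_manifold c,
      forall k, Ck_map k (prod_atlas c c) c (fun p : G * G => (p.1 * p.2)%g) &
      forall k, Ck_map k c c (fun g : G => (g^-1)%g)].

(* A left-invariant probability measure, which on a compact group is the
   normalised Haar measure. *)
Definition haar (mu : probability (borel G) R) : Prop :=
  forall g : G, preserves mu (fun h : G => (g * h)%g).

(* The Lie algebra T_e G is 'rV[R]_m, through the chart at the identity. *)
Definition Ad (g : G) (Z : 'rV[R]_m) : 'rV[R]_m :=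
  tangent_map c c (fun h => (g * h * g^-1)%g) 1%g Z.

Definition right_translate (g h : G) (v : 'rV[R]_m) : 'rV[R]_m :=
  tangent_map c c (fun k => (k * h)%g) g v.

Variables (d : nat) (Pi : G -> 'M[R[i]]_d).

Definition unitary_rep : Prop :=
  [/\ forall g, Pi g \is unitarymx,
      Pi 1%g = 1%:M,
      forall g h, Pi (g * h)%g = Pi g *m Pi h &
      forall k l, continuous (fun g => Pi g k l : R[i]^o)].

(* [Pi g] acts on column vectors, hence the transpose: the rows of [V] span
   an arbitrary subspace of C^d. *)
Definition irreducible_rep : Prop :=
  (0 < d)%N /\
  forall V : 'M[R[i]]_d, (forall g, stablemx V (Pi g)^T) ->
    \rank V = 0%N \/ \rank V = d.

Definition drep (Z : 'rV[R]_m) : 'M[R[i]]_d :=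
  \matrix_(k, l)
    Complex
      ('d (fun v => complex.Re (Pi (chart_inv (c 1%g) v) k l) : R^o)
          (chart_fun (c 1%g) 1%g) Z)
      ('d (fun v => complex.Im (Pi (chart_inv (c 1%g) v) k l) : R^o)
          (chart_fun (c 1%g) 1%g) Z).

End LieGroup.

Section SkewProduct.
Variables (R : realType) (X : ptopologicalType) (G : ptopologicalGroupType).
Variables (F : R -> X -> X) (phi : X -> G).

Definition skew_map (p : borel X * borel G) : borel X * borel G :=
  (F 1 p.1, ((p.2 : G) * phi p.1)%g).

Definition skew_inv (p : borel X * borel G) : borel X * borel G :=
  (F (- 1) p.1, ((p.2 : G) * (phi (F (- 1) p.1))^-1)%g).

Lemma skewK (n : nat) (c : X -> chart 'rV[R]_n X) :
  C1_flow c F -> cancel skew_map skew_inv.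
Proof.
move=> cF [x g]; rewrite /skew_map /skew_inv /=.
by rewrite -(flowD cF) addNr (flow0 cF) mulgK.
Qed.

Lemma skew_invK (n : nat) (c : X -> chart 'rV[R]_n X) :
  C1_flow c F -> cancel skew_inv skew_map.
Proof.
move=> cF [x g]; rewrite /skew_map /skew_inv /=.
by rewrite -(flowD cF) addrN (flow0 cF) mulgVK.
Qed.

Variables (m : nat) (c : G -> chart 'rV[R]_m G).

Definition lie_derivative (x : X) : 'rV[R]_m :=
  velocity c (fun t => phi (F t x)) 0.

Definition Mphi (x : X) : 'rV[R]_m :=
  right_translate c (phi x) (phi x)^-1%g (lie_derivative x).

Definition Mstar_diag (muX : probability (borel X) R) : 'rV[R]_m :=
  \row_i \int[muX]_x Mphi x 0 i.

Definition Mstar_skew (muX : probability (borel X) R)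
    (muG : probability (borel G) R) : 'rV[R]_m :=
  \row_i \int[(muX \x muG)%E]_p Ad c p.2 (Mphi p.1) 0 i.

End SkewProduct.

(* Elements of L^2(mu) are represented by square-integrable functions and
   equality in L^2(mu) by equality mu-almost everywhere; an operator is a map
   on functions, used only on square-integrable ones. *)
Section L2.
Context d (T : measurableType d) (R : realType).
Variable mu : {measure set T -> \bar R}.
Local Notation C := R[i].
Implicit Types (K : set (T -> C)) (B V : (T -> C) -> (T -> C)).

Definition L2 : set (T -> C) :=
  [set f : T -> C | [/\ measurable_fun setT (fun x => complex.Re (f x)),
               measurable_fun setT (fun x => complex.Im (f x)) &
               finite_norm mu 2%:E (fun x => Normc.normc (f x))]].

Definition L2norm (f : T -> C) : R :=
  fine 'N[mu]_2%:E[EFin \o (fun x => Normc.normc (f x))]%E.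

(* antilinear in the first argument *)
Definition inner (f g : T -> C) : C :=
  Complex (\int[mu]_x complex.Re ((f x)^*%C * g x))
          (\int[mu]_x complex.Im ((f x)^*%C * g x)).

Definition bounded_operator K B : Prop :=
  [/\ forall f, K f -> K (B f),
      forall (a : C) f g, K f -> K g ->
        B (fun x => a * f x + g x) = (fun x => a * B f x + B g x) %[ae mu] &
      exists r : R, forall f, K f -> L2norm (B f) <= r * L2norm f].

(* [A] is the graph of an operator in [K]; [B] is the bounded operator whose
   form extends <A f, V f> - <f, V A f>, defined for f in the domain of [A]. *)
Definition is_commutator K (A : (T -> C) -> (T -> C) -> Prop) V B : Prop :=
  bounded_operator K B /\
  forall f Af, A f Af -> inner Af (V f) - inner f (V Af) = inner f (B f).

Definition strong_limit K (B : nat -> (T -> C) -> (T -> C))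
    (D : (T -> C) -> (T -> C)) : Prop :=
  bounded_operator K D /\
  forall f, K f -> L2norm (fun x => B N f x - D f x) @[N --> \oo] --> (0 : R).

Definition ker_orth K (D : (T -> C) -> (T -> C)) : set (T -> C) :=
  [set f | K f /\ forall g, K g -> D g = cst 0 %[ae mu] -> inner g f = 0].

Definition no_eigenvalue K V : Prop :=
  forall (z : C) f, K f -> V f = (fun x => z * f x) %[ae mu] ->
    f = cst 0 %[ae mu].

End L2.

Definition koopman (T C : Type) (f : T -> T) (psi : T -> C) : T -> C :=
  psi \o f.

(* Graph of H = s-lim_(t -> 0) i t^-1 (f o F_t - f), whose domain consists of
   all [f] for which the limit exists. *)
Definition flow_generator (R : realType) (X : ptopologicalType)
    (muX : probability (borel X) R) (F : R -> X -> X) (f Hf : X -> R[i]) :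
    Prop :=
  [/\ L2 muX f, L2 muX Hf &
      L2norm muX (fun x => Complex 0 t^-1 * (f (F t x) - f x) - Hf x)
        @[t --> 0^'] --> (0 : R)].

Section Isotypic.
Variables (R : realType) (X : ptopologicalType) (G : ptopologicalGroupType).
Variables (muX : probability (borel X) R) (muG : probability (borel G) R).
Variables (d : nat) (Pi : G -> 'M[R[i]]_d) (j : 'I_d).
Local Notation P := (borel X * borel G)%type.
Local Notation mu := (muX \x muG)%E.
Implicit Types f h : 'I_d -> X -> R[i].

(* sum_k f_k (x) pi_jk *)
Definition tensor f (p : P) : R[i] := \sum_(k < d) f k p.1 * Pi p.2 j k.

Definition Hpi : set (P -> R[i]) :=
  [set psi | L2 mu psi /\
     exists2 f, (forall k, L2 muX (f k)) & psi = tensor f %[ae mu]].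

Definition A_graph (F : R -> X -> X) (psi Apsi : P -> R[i]) : Prop :=
  [/\ L2 mu psi, L2 mu Apsi & exists f h,
     [/\ forall k, flow_generator muX F (f k) (h k),
         psi = tensor f %[ae mu] & Apsi = tensor h %[ae mu]]].

Definition is_matrix_multiplication (M : 'M[R[i]]_d)
    (D : (P -> R[i]) -> (P -> R[i])) : Prop :=
  forall psi f, L2 mu psi -> (forall k, L2 muX (f k)) ->
    psi = tensor f %[ae mu] ->
    D psi = tensor (fun k x => \sum_(l < d) M k l * f l x) %[ae mu].

End Isotypic.

(* Main.v *)
Require Import Defs.
From HB Require Import structures.
From mathcomp Require Import all_boot all_order all_algebra complex spectral.
From mathcomp Require Import all_classical all_reals all_analysis.
From mathcomp Require Import measurable_realfun ring lra.
Import numFieldNormedType.Exports.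
Import Order.TTheory GRing.Theory Num.Theory.

Set Implicit Arguments.
Unset Strict Implicit.
Unset Printing Implicit Defensive.

Local Open Scope classical_set_scope.
Local Open Scope ring_scope.
Local Open Scope sesquilinear_scope.

(** Through its matrix coefficients the component [Hpi] is a space of functions
on [X] with values in C^d: by Schur orthogonality, [inner_tensor], the map
[f |-> tensor f] is an isometry up to the factor d. In these terms the N-th
power of the Koopman operator is the weighted composition operator
[f |-> Q N (f \o F N)], where [Q N = cocycle N] is the product of the unitary
matrices [Pi (phi (F k x))] for k < N, and [A] is the generator of the flow in
each coordinate. By the Leibniz rule and the symmetry of the generator,
[generator_commutator], the commutator of [A] with the N-th power is
multiplication by [i Q' N] followed by the same composition, [Q' N] being the
derivative of [Q N] along the flow. Hence the operators of the statement are
multiplications by the matrices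
  [(i / N) Q' N (Q N)^*] = [(i / N) sum_(k < N) Q k (ld \o F k) (Q k)^*],
where [ld = drep Mphi] is the logarithmic derivative of [Pi \o phi]
([cocycle_derivative_sum]).

These averages converge almost everywhere. If [Pi \o phi] is diagonal, all the
matrices commute and the sums are Birkhoff sums of [ld] under [F 1]
([diagonal_limit]). If the skew product is uniquely ergodic, conjugation by
[Pi g] turns them into Birkhoff sums of [drep (Ad_g Mphi)] under the skew
product; the mean commutes with the representation, because Haar measure is
left invariant, so that the conjugation can be undone ([skew_limit]). Only
bounded functions occur, and for these the pointwise ergodic theorem follows
quickly from the maximal inequality ([birkhoff_cvg]). Dominated convergence
then gives the strong limit ([average_strong_limit]), multiplication by
[i drep Mstar]; this matrix is hermitian and commutes with [Pi (phi x)].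

For the mixing property, the orthogonal complement of the kernel of a hermitian
matrix is its range ([ker_orth_range]), so an element of it is [D eta]. Up to
an error that tends to zero, the inner product of [D eta] with the N-th image
of [psi] is 1/N times a commutator evaluated on [eta] and [psi]; if both are in
the domain of [A], this is O(1/N) ([pairing_cvg_smooth]). General [eta] and
[psi] are approximated by functions built from bumps, which are in the domain
([L2_approximable]). An eigenfunction in the complement would have correlations
of constant modulus, which contradicts mixing ([ker_orth_no_eigenvalue]).

The commutators involve the differential of [Pi] at the identity, so a
continuous finite-dimensional representation has to be shown differentiable:
multiplied by an invertible matrix, it is the average of the translates of a
bump function ([rep_smooth]). The fields [Mphi] and [Ad_g Mphi] are the initial
velocities of the curves [base_curve] and [conj_curve] through the identity of
[G], which gives their measurability, their bounds, and their images under
[drep]. *)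

(** * Complex numbers through their real and imaginary parts *)

Lemma cvg_sub_cst (R : realType) (T : Type) (G : set_system T) {FG : Filter G} (u : T -> R) (l : R) :
  u x - l @[x --> G] --> (0 : R) -> u x @[x --> G] --> l.
Proof.
move=> /cvgrPdist_lt h; apply/cvgrPdist_lt => e /h; apply: filterS => x.
by rewrite sub0r normrN distrC.
Qed.

Section ComplexFacts.
Variable R : realType.
Implicit Types z w : R[i].

Definition sqn z : R := complex.Re z ^+ 2 + complex.Im z ^+ 2.

Lemma complexP z w : complex.Re z = complex.Re w -> complex.Im z = complex.Im w -> z = w.
Proof. by case: z w => [a b] [c e] /= -> ->. Qed.

Lemma cReD z w : complex.Re (z + w) = complex.Re z + complex.Re w.
Proof. by case: z w => [a b] [c e]. Qed.
Lemma cImD z w : complex.Im (z + w) = complex.Im z + complex.Im w.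
Proof. by case: z w => [a b] [c e]. Qed.
Lemma cReN z : complex.Re (- z) = - complex.Re z.
Proof. by case: z. Qed.
Lemma cImN z : complex.Im (- z) = - complex.Im z.
Proof. by case: z. Qed.
Lemma cReM z w : complex.Re (z * w) =
  complex.Re z * complex.Re w - complex.Im z * complex.Im w.
Proof. by case: z w => [a b] [c e]. Qed.
Lemma cImM z w : complex.Im (z * w) =
  complex.Re z * complex.Im w + complex.Im z * complex.Re w.
Proof. by case: z w => [a b] [c e] /=; rewrite addrC. Qed.
Lemma cReJ z : complex.Re z^*%C = complex.Re z.
Proof. by case: z. Qed.
Lemma cImJ z : complex.Im z^*%C = - complex.Im z.
Proof. by case: z. Qed.
Lemma cRe0 : complex.Re (0 : R[i]) = 0. Proof. by []. Qed.
Lemma cIm0 : complex.Im (0 : R[i]) = 0. Proof. by []. Qed.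
Lemma cRe1 : complex.Re (1 : R[i]) = 1. Proof. by []. Qed.
Lemma cIm1 : complex.Im (1 : R[i]) = 0. Proof. by []. Qed.

Definition reimE := (cReD, cImD, cReN, cImN, cReM, cImM, cReJ, cImJ, cRe0, cIm0, cRe1, cIm1).

Lemma Re_sum I (r : seq I) (P : pred I) (f : I -> R[i]) :
  complex.Re (\sum_(i <- r | P i) f i) = \sum_(i <- r | P i) complex.Re (f i).
Proof. exact: (big_morph _ cReD). Qed.
Lemma Im_sum I (r : seq I) (P : pred I) (f : I -> R[i]) :
  complex.Im (\sum_(i <- r | P i) f i) = \sum_(i <- r | P i) complex.Im (f i).
Proof. exact: (big_morph _ cImD). Qed.
Lemma conjc_sum I (r : seq I) (P : pred I) (f : I -> R[i]) :
  (\sum_(i <- r | P i) f i)^*%C = \sum_(i <- r | P i) (f i)^*%C.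
Proof.
apply: (big_morph (fun z => z^*%C)) => [z w|]; last exact: conjc0.
by apply: complexP; rewrite !reimE// opprD.
Qed.
Lemma conjcD z w : (z + w)^*%C = z^*%C + w^*%C.
Proof. by apply: complexP; rewrite !reimE// opprD. Qed.
Lemma conjcN z : (- z)^*%C = - z^*%C.
Proof. by apply: complexP; rewrite !reimE. Qed.
Lemma conjcM z w : (z * w)^*%C = z^*%C * w^*%C.
Proof. by apply: complexP; rewrite !reimE; ring. Qed.

Lemma sqn_ge0 z : 0 <= sqn z.
Proof. by rewrite addr_ge0// sqr_ge0. Qed.
Lemma sqn0 : sqn 0 = 0.
Proof. by rewrite /sqn /= expr0n addr0. Qed.
Lemma sqn_eq0 z : sqn z = 0 -> z = 0.
Proof.
move=> /eqP; rewrite paddr_eq0 ?sqr_ge0// !sqrf_eq0 => /andP[/eqP a /eqP b].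
exact: complexP.
Qed.
Lemma sqnM z w : sqn (z * w) = sqn z * sqn w.
Proof. by rewrite /sqn !reimE; ring. Qed.
Lemma sqnN z : sqn (- z) = sqn z.
Proof. by rewrite /sqn !reimE; ring. Qed.
Lemma sqnJ z : sqn z^*%C = sqn z.
Proof. by rewrite /sqn !reimE; ring. Qed.
Lemma mul_conjc z : z^*%C * z = Complex (sqn z) 0.
Proof. by apply: complexP; rewrite /sqn !reimE/=; ring. Qed.
Lemma sqnD_le z w : sqn (z + w) <= 2 * (sqn z + sqn w).
Proof.
rewrite -subr_ge0.
suff -> : 2 * (sqn z + sqn w) - sqn (z + w) = sqn (z - w) by exact: sqn_ge0.
by rewrite /sqn !reimE; ring.
Qed.

Lemma normcE z : Normc.normc z = Num.sqrt (sqn z).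
Proof. by case: z. Qed.
Lemma sqr_normcE z : Normc.normc z ^+ 2 = sqn z.
Proof. by rewrite normcE sqr_sqrtr// sqn_ge0. Qed.
Lemma normc_ge0 z : 0 <= Normc.normc z.
Proof. by rewrite normcE sqrtr_ge0. Qed.
Lemma normcD z w : Normc.normc (z + w) <= Normc.normc z + Normc.normc w.
Proof. exact: (@le_normcD R z w). Qed.
Lemma normcNE z : Normc.normc (- z) = Normc.normc z.
Proof. by rewrite !normcE sqnN. Qed.
Lemma normcJE z : Normc.normc z^*%C = Normc.normc z.
Proof. by rewrite !normcE sqnJ. Qed.
Lemma normcBC z w : Normc.normc (z - w) = Normc.normc (w - z).
Proof. by rewrite -opprB normcNE. Qed.
Lemma Re_le_normc z : `|complex.Re z| <= Normc.normc z.
Proof. by rewrite normcE -sqrtr_sqr ler_wsqrtr// /sqn lerDl sqr_ge0. Qed.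
Lemma Im_le_normc z : `|complex.Im z| <= Normc.normc z.
Proof. by rewrite normcE -sqrtr_sqr ler_wsqrtr// /sqn lerDr sqr_ge0. Qed.
Lemma normc_le_ReIm z : Normc.normc z <= `|complex.Re z| + `|complex.Im z|.
Proof.
rewrite normcE -[leRHS]ger0_norm ?addr_ge0// -sqrtr_sqr ler_wsqrtr//.
rewrite sqrrD !real_normK ?num_real// /sqn addrAC lerDl.
by rewrite mulrn_wge0// mulr_ge0.
Qed.
Lemma normc_real (a : R) : Normc.normc (Complex a 0) = `|a|.
Proof. by rewrite /= expr0n addr0 sqrtr_sqr. Qed.
Lemma normc_imag (a : R) : Normc.normc (Complex 0 a) = `|a|.
Proof. by rewrite /= expr0n add0r sqrtr_sqr. Qed.
Lemma normc_sum I (r : seq I) (P : pred I) (f : I -> R[i]) :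
  Normc.normc (\sum_(i <- r | P i) f i) <= \sum_(i <- r | P i) Normc.normc (f i).
Proof.
elim/big_ind2: _ => [|x y a b xy ab|//]; first by rewrite Normc.normc0.
by rewrite (le_trans (normcD _ _))// lerD.
Qed.
Lemma normc_expn z n : Normc.normc (z ^+ n) = Normc.normc z ^+ n.
Proof. by elim: n => [|n ih]; rewrite ?expr0 ?Normc.normc1// !exprS Normc.normcM ih. Qed.

Lemma natCE n : n%:R = Complex n%:R 0 :> R[i].
Proof. by rewrite -(rmorph_nat (real_complex R)). Qed.
Lemma natCV n : n%:R^-1 = Complex n%:R^-1 0 :> R[i].
Proof. by rewrite natCE; exact/esym/(fmorphV (real_complex R)). Qed.

(** Limits in [R[i]], whose norm takes values in [R[i]] itself, are reduced to
limits of the real-valued modulus. *)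
Lemma cvgC_normc (T : Type) (G : set_system T) {FG : Filter G} (u : T -> R[i]) (l : R[i]) :
  (u x : R[i]^o) @[x --> G] --> (l : R[i]^o) <-> Normc.normc (u x - l) @[x --> G] --> (0 : R).
Proof.
split=> h.
  apply/cvgrPdist_lt => e e0.
  have e0' : (0 : R[i]) < Complex e 0 by rewrite ltcE /= eqxx.
  move/cvgrPdist_lt : h => /(_ _ e0').
  apply: filterS => x; rewrite normc_def -normcE ltcE /= => /andP[_].
  by rewrite sub0r normrN ger0_norm ?normc_ge0// -normcBC.
apply/cvgrPdist_lt => e; rewrite ltcE /= => /andP[/eqP e1 e0].
move/cvgrPdist_lt : h => /(_ _ e0); apply: filterS => x.
rewrite sub0r normrN ger0_norm ?normc_ge0// normc_def ltcE /= e1 eqxx /=.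
by rewrite normcBC normcE.
Qed.

Lemma normc_cvg0 (T : Type) (G : set_system T) {FG : Filter G} (u : T -> R[i]) :
  Normc.normc (u x) @[x --> G] --> (0 : R) <->
  (complex.Re (u x) @[x --> G] --> (0 : R) /\ complex.Im (u x) @[x --> G] --> (0 : R)).
Proof.
split=> [h|[h1 h2]].
  split; apply/norm_cvg0P; apply: (@squeeze_cvgr _ _ _ _ (fun=> 0) (fun x => Normc.normc (u x))) h.
  - by near=> x; rewrite normr_ge0 Re_le_normc.
  - exact: cvg_cst.
  - by near=> x; rewrite normr_ge0 Im_le_normc.
  - exact: cvg_cst.
apply: (@squeeze_cvgr _ _ _ _ (fun=> 0) (fun x => `|complex.Re (u x)| + `|complex.Im (u x)|)).
- by near=> x; rewrite normc_ge0 normc_le_ReIm.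
- exact: cvg_cst.
- by rewrite -[0 in X in _ --> X]addr0; apply: cvgD; apply/norm_cvg0P.
Unshelve. all: by end_near. Qed.

End ComplexFacts.

(** * Complex-valued square-integrable functions *)

Section L2Theory.
Context d (T : measurableType d) (R : realType).
Variable mu : {measure set T -> \bar R}.
Local Notation C := R[i].
Implicit Types f g h : T -> C.

Definition cmeas f := measurable_fun setT (fun x => complex.Re (f x)) /\
  measurable_fun setT (fun x => complex.Im (f x)).

Definition cintegrable f := mu.-integrable setT (EFin \o (fun x => complex.Re (f x))) /\
  mu.-integrable setT (EFin \o (fun x => complex.Im (f x))).

Definition cint f : C := Complex (\int[mu]_x complex.Re (f x)) (\int[mu]_x complex.Im (f x)).

Lemma cmeas_cst (a : C) : cmeas (fun=> a).
Proof. by split; exact: measurable_cst. Qed.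

Lemma cmeasD f g : cmeas f -> cmeas g -> cmeas (fun x => f x + g x).
Proof.
move=> [f1 f2] [g1 g2]; split.
  by under eq_fun do rewrite cReD; exact: measurable_funD.
by under eq_fun do rewrite cImD; exact: measurable_funD.
Qed.

Lemma cmeasN f : cmeas f -> cmeas (fun x => - f x).
Proof.
move=> [f1 f2]; split.
  by under eq_fun do rewrite cReN; exact: measurableT_comp.
by under eq_fun do rewrite cImN; exact: measurableT_comp.
Qed.

Lemma cmeasB f g : cmeas f -> cmeas g -> cmeas (fun x => f x - g x).
Proof. by move=> ? ?; apply: cmeasD => //; exact: cmeasN. Qed.

Lemma cmeasJ f : cmeas f -> cmeas (fun x => (f x)^*%C).
Proof.
move=> [f1 f2]; split; first by under eq_fun do rewrite cReJ.
by under eq_fun do rewrite cImJ; exact: measurableT_comp.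
Qed.

Lemma cmeasM f g : cmeas f -> cmeas g -> cmeas (fun x => f x * g x).
Proof.
move=> [f1 f2] [g1 g2]; split.
  by under eq_fun do rewrite cReM; apply: measurable_funB; exact: measurable_funM.
by under eq_fun do rewrite cImM; apply: measurable_funD; exact: measurable_funM.
Qed.

Lemma cmeas_sum I (r : seq I) (P : pred I) (f : I -> T -> C) :
  (forall i, P i -> cmeas (f i)) -> cmeas (fun x => \sum_(i <- r | P i) f i x).
Proof.
move=> mf; elim: r => [|i r ih].
  by under eq_fun do rewrite big_nil; exact: cmeas_cst.
case Pi: (P i); under eq_fun do rewrite big_cons Pi; last by [].
by apply: cmeasD => //; exact: mf.
Qed.

Lemma measurable_sqn f : cmeas f -> measurable_fun setT (fun x => sqn (f x)).
Proof.
by move=> [f1 f2]; apply: measurable_funD; exact: measurable_funX.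
Qed.

Lemma L2norm_powE f : 'N[mu]_2%:E[EFin \o (fun x => Normc.normc (f x))]%E =
  ((\int[mu]_x (sqn (f x))%:E) `^ 2^-1)%E.
Proof.
rewrite unlock /=; congr (_ `^ _)%E.
apply: eq_integral => x _; rewrite -sqr_normcE ger0_norm ?normc_ge0//.
by rewrite powR_mulrn// normc_ge0.
Qed.

Lemma L2P f : L2 mu f <-> cmeas f /\ mu.-integrable setT (EFin \o (fun x => sqn (f x))).
Proof.
split=> [[f1 f2 ff]|[[f1 f2] fi]].
  split=> //; apply/integrableP; split.
    by apply/measurable_EFinP; exact: measurable_sqn.
  under eq_integral do rewrite /= ger0_norm ?sqn_ge0//.
  move: ff; rewrite /finite_norm L2norm_powE; set I := (\int[mu]_x _)%E.
  have : (0 <= I)%E by apply: integral_ge0 => x _; rewrite lee_fin sqn_ge0.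
  case: I => [r _ _|_|//]; first by rewrite ltry.
  by rewrite /= invr_eq0 pnatr_eq0 /= ltxx.
split=> //; rewrite /finite_norm L2norm_powE.
move/integrableP : fi => [_].
under eq_integral do rewrite /= ger0_norm ?sqn_ge0//.
by move=> h; apply: poweR_lty.
Qed.

Lemma L2normE f : L2norm mu f = Num.sqrt (\int[mu]_x sqn (f x)).
Proof.
rewrite /L2norm L2norm_powE /Rintegral; set I := (\int[mu]_x _)%E.
have : (0 <= I)%E by apply: integral_ge0 => x _; rewrite lee_fin sqn_ge0.
case: I => [r| |] //= r0; first by rewrite powR12_sqrt.
by rewrite invr_eq0 pnatr_eq0 /= sqrtr0.
Qed.

Lemma L2norm_ge0 f : 0 <= L2norm mu f.
Proof. by rewrite L2normE sqrtr_ge0. Qed.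

Lemma sqr_L2norm f : L2norm mu f ^+ 2 = \int[mu]_x sqn (f x).
Proof.
rewrite L2normE sqr_sqrtr// /Rintegral fine_ge0// integral_ge0// => x _.
by rewrite lee_fin sqn_ge0.
Qed.

Lemma L2_cmeas f : L2 mu f -> cmeas f.
Proof. by move=> /L2P[]. Qed.

Lemma L2_integrable f : L2 mu f -> mu.-integrable setT (EFin \o (fun x => sqn (f x))).
Proof. by move=> /L2P[]. Qed.

Lemma L2_le f (F : T -> R) : cmeas f -> mu.-integrable setT (EFin \o F) ->
  (forall x, sqn (f x) <= F x) -> L2 mu f.
Proof.
move=> mf Fi fF; apply/L2P; split => //.
apply: le_integrable Fi => //.
  by apply/measurable_EFinP; exact: measurable_sqn.
move=> x _ /=; rewrite lee_fin ger0_norm ?sqn_ge0//.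
by rewrite (le_trans (fF x))// ler_norm.
Qed.

Lemma L2D f g : L2 mu f -> L2 mu g -> L2 mu (fun x => f x + g x).
Proof.
move=> Lf Lg; apply: (@L2_le _ (fun x => 2 * (sqn (f x) + sqn (g x)))).
- by apply: cmeasD; exact: L2_cmeas.
- apply: (integrableZl measurableT 2 (f := fun x => (sqn (f x))%:E + (sqn (g x))%:E)%E).
  by apply: integrableD => //; exact: L2_integrable.
- by move=> x; exact: sqnD_le.
Qed.

Lemma L2M (c f : T -> C) (b : R) : cmeas c -> (forall x, Normc.normc (c x) <= b) ->
  L2 mu f -> L2 mu (fun x => c x * f x).
Proof.
move=> mc cb Lf; apply: (@L2_le _ (fun x => b ^+ 2 * sqn (f x))).
- by apply: cmeasM => //; exact: L2_cmeas.
- exact: (integrableZl measurableT (b ^+ 2) (L2_integrable Lf)).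
- move=> x; rewrite sqnM ler_wpM2r ?sqn_ge0// -sqr_normcE.
  by rewrite lerXn2r// ?nnegrE ?normc_ge0// (le_trans _ (cb x))// normc_ge0.
Qed.

Lemma L2Z (a : C) f : L2 mu f -> L2 mu (fun x => a * f x).
Proof. by move=> Lf; apply: (L2M (b := Normc.normc a)) => //; exact: cmeas_cst. Qed.

Lemma L2N f : L2 mu f -> L2 mu (fun x => - f x).
Proof. by move=> /(L2Z (-1)) h; under eq_fun do rewrite -mulN1r. Qed.

Lemma L2B f g : L2 mu f -> L2 mu g -> L2 mu (fun x => f x - g x).
Proof. by move=> ? ?; apply: L2D => //; exact: L2N. Qed.

Lemma L2_0 : L2 mu (fun=> 0).
Proof.
apply: (@L2_le _ (fun=> 0)); first exact: cmeas_cst.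
  exact: integrable0.
by move=> x; rewrite sqn0.
Qed.

Lemma L2_sum I (r : seq I) (P : pred I) (f : I -> T -> C) :
  (forall i, P i -> L2 mu (f i)) -> L2 mu (fun x => \sum_(i <- r | P i) f i x).
Proof.
move=> mf; elim: r => [|i r ih].
  by under eq_fun do rewrite big_nil; exact: L2_0.
case Pi: (P i); under eq_fun do rewrite big_cons Pi; last by [].
by apply: L2D => //; exact: mf.
Qed.

Lemma cintegrableD f g : cintegrable f -> cintegrable g -> cintegrable (fun x => f x + g x).
Proof.
move=> [f1 f2] [g1 g2]; split.
  by apply: eq_integrable (integrableD _ f1 g1) => // x _ /=; rewrite cReD EFinD.
by apply: eq_integrable (integrableD _ f2 g2) => // x _ /=; rewrite cImD EFinD.
Qed.

Lemma cintegrableZ (a : C) f : cintegrable f -> cintegrable (fun x => a * f x).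
Proof.
move=> [f1 f2]; split.
  have := integrableD measurableT (integrableZl measurableT (complex.Re a) f1)
    (integrableZl measurableT (- complex.Im a) f2).
  by apply: eq_integrable => // x _ /=; rewrite cReM -mulNr EFinD.
have := integrableD measurableT (integrableZl measurableT (complex.Re a) f2)
    (integrableZl measurableT (complex.Im a) f1).
by apply: eq_integrable => // x _ /=; rewrite cImM EFinD.
Qed.

Lemma cintegrable_sum I (r : seq I) (P : pred I) (f : I -> T -> C) :
  (forall i, P i -> cintegrable (f i)) -> cintegrable (fun x => \sum_(i <- r | P i) f i x).
Proof.
move=> mf; elim: r => [|i r ih].
  under eq_fun do rewrite big_nil.
  by split; exact: integrable0.
case Pi: (P i); under eq_fun do rewrite big_cons Pi; last by [].
by apply: cintegrableD => //; exact: mf.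
Qed.

Lemma cintD f g : cintegrable f -> cintegrable g ->
  cint (fun x => f x + g x) = cint f + cint g.
Proof.
move=> [f1 f2] [g1 g2]; apply: complexP; rewrite !reimE /=.
  by under eq_Rintegral do rewrite cReD; rewrite RintegralD.
by under eq_Rintegral do rewrite cImD; rewrite RintegralD.
Qed.

Lemma cintZ (a : C) f : cintegrable f -> cint (fun x => a * f x) = a * cint f.
Proof.
move=> [f1 f2]; apply: complexP; rewrite !reimE /=.
  under eq_Rintegral do rewrite cReM -mulNr.
  rewrite RintegralD//; last 2 first.
    exact: (integrableZl measurableT _ f1).
    exact: (integrableZl measurableT _ f2).
  by rewrite !RintegralZl// mulNr.
under eq_Rintegral do rewrite cImM.
rewrite RintegralD//; last 2 first.
  exact: (integrableZl measurableT _ f2).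
  exact: (integrableZl measurableT _ f1).
by rewrite !RintegralZl.
Qed.

Lemma cint_sum I (r : seq I) (P : pred I) (f : I -> T -> C) :
  (forall i, P i -> cintegrable (f i)) ->
  cint (fun x => \sum_(i <- r | P i) f i x) = \sum_(i <- r | P i) cint (f i).
Proof.
move=> mf; elim: r => [|i r ih].
  rewrite big_nil; apply: complexP => /=;
    by under eq_Rintegral do rewrite big_nil; rewrite /Rintegral integral0.
rewrite big_cons; case Pi: (P i); under [in LHS]eq_fun do rewrite big_cons Pi; last by [].
rewrite cintD ?ih//; first exact: mf.
exact: cintegrable_sum.
Qed.

Lemma cintJ f : cintegrable f -> cint (fun x => (f x)^*%C) = (cint f)^*%C.
Proof.
move=> [f1 f2]; apply: complexP; rewrite !reimE /=.
  by apply: eq_Rintegral => x _; rewrite cReJ.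
under eq_Rintegral do rewrite cImJ -mulN1r.
by rewrite RintegralZl// mulN1r.
Qed.

Lemma cintegrable_le f (F : T -> R) : cmeas f -> mu.-integrable setT (EFin \o F) ->
  (forall x, Normc.normc (f x) <= F x) -> cintegrable f.
Proof.
move=> [f1 f2] Fi fF; split; apply: (le_integrable _ _ _ Fi) => //.
- exact/measurable_EFinP.
- move=> x _ /=; rewrite lee_fin.
  by rewrite (le_trans (Re_le_normc _))// (le_trans (fF x))// ler_norm.
- exact/measurable_EFinP.
- move=> x _ /=; rewrite lee_fin.
  by rewrite (le_trans (Im_le_normc _))// (le_trans (fF x))// ler_norm.
Qed.

Lemma L2_cintegrable f g : L2 mu f -> L2 mu g -> cintegrable (fun x => (f x)^*%C * g x).
Proof.
move=> Lf Lg; apply: (@cintegrable_le _ (fun x => sqn (f x) + sqn (g x))).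
- by apply: cmeasM; [apply: cmeasJ|]; exact: L2_cmeas.
- by apply: (integrableD measurableT (f := fun x => (sqn (f x))%:E)
    (g := fun x => (sqn (g x))%:E)); exact: L2_integrable.
- move=> x; rewrite Normc.normcM normcJE -!sqr_normcE.
  have := sqr_ge0 (Normc.normc (f x) - Normc.normc (g x)).
  have := sqr_ge0 (Normc.normc (f x)); have := sqr_ge0 (Normc.normc (g x)); lra.
Qed.

Lemma innerE f g : inner mu f g = cint (fun x => (f x)^*%C * g x).
Proof. by []. Qed.

Lemma innerDr f g h : L2 mu f -> L2 mu g -> L2 mu h ->
  inner mu f (fun x => g x + h x) = inner mu f g + inner mu f h.
Proof.
move=> Lf Lg Lh; rewrite !innerE -cintD; try exact: L2_cintegrable.
by congr cint; apply/funext => x; rewrite mulrDr.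
Qed.

Lemma innerZr (a : C) f g : L2 mu f -> L2 mu g ->
  inner mu f (fun x => a * g x) = a * inner mu f g.
Proof.
move=> Lf Lg; rewrite !innerE -cintZ; try exact: L2_cintegrable.
by congr cint; apply/funext => x; rewrite mulrCA.
Qed.

Lemma innerJ f g : L2 mu f -> L2 mu g -> inner mu g f = (inner mu f g)^*%C.
Proof.
move=> Lf Lg; rewrite !innerE -cintJ; try exact: L2_cintegrable.
by congr cint; apply/funext => x; rewrite conjcM conjcK mulrC.
Qed.

Lemma innerDl f g h : L2 mu f -> L2 mu g -> L2 mu h ->
  inner mu (fun x => g x + h x) f = inner mu g f + inner mu h f.
Proof.
move=> Lf Lg Lh; rewrite innerJ//; last exact: L2D.
by rewrite innerDr// conjcD -!innerJ.
Qed.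

Lemma innerZl (a : C) f g : L2 mu f -> L2 mu g ->
  inner mu (fun x => a * f x) g = a^*%C * inner mu f g.
Proof.
move=> Lf Lg; rewrite innerJ//; last exact: L2Z.
by rewrite innerZr// conjcM -innerJ.
Qed.

Lemma innerNr f g : L2 mu f -> L2 mu g -> inner mu f (fun x => - g x) = - inner mu f g.
Proof.
move=> Lf Lg; rewrite -mulN1r -innerZr//.
by under [in RHS]eq_fun do rewrite mulN1r.
Qed.

Lemma innerNl f g : L2 mu f -> L2 mu g -> inner mu (fun x => - f x) g = - inner mu f g.
Proof. by move=> Lf Lg; rewrite innerJ ?innerNr// ?conjcN -?innerJ//; exact: L2N. Qed.

Lemma innerBr f g h : L2 mu f -> L2 mu g -> L2 mu h ->
  inner mu f (fun x => g x - h x) = inner mu f g - inner mu f h.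
Proof. by move=> Lf Lg Lh; rewrite innerDr ?innerNr//; exact: L2N. Qed.

Lemma innerBl f g h : L2 mu f -> L2 mu g -> L2 mu h ->
  inner mu (fun x => g x - h x) f = inner mu g f - inner mu h f.
Proof. by move=> Lf Lg Lh; rewrite innerDl ?innerNl//; exact: L2N. Qed.

Lemma inner_suml I (r : seq I) (f : I -> T -> C) g :
  (forall i, L2 mu (f i)) -> L2 mu g ->
  inner mu (fun x => \sum_(i <- r) f i x) g = \sum_(i <- r) inner mu (f i) g.
Proof.
move=> Lf Lg; rewrite innerE; under [in LHS]eq_fun do rewrite conjc_sum mulr_suml.
by rewrite cint_sum// => i _; exact: L2_cintegrable.
Qed.

Lemma inner_sumr I (r : seq I) (f : I -> T -> C) g :
  (forall i, L2 mu (f i)) -> L2 mu g ->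
  inner mu g (fun x => \sum_(i <- r) f i x) = \sum_(i <- r) inner mu g (f i).
Proof.
move=> Lf Lg; rewrite innerE; under [in LHS]eq_fun do rewrite mulr_sumr.
by rewrite cint_sum// => i _; exact: L2_cintegrable.
Qed.

Lemma inner_self f : inner mu f f = Complex (L2norm mu f ^+ 2) 0.
Proof.
rewrite sqr_L2norm innerE; apply: complexP => /=.
  by apply: eq_Rintegral => x _; rewrite mul_conjc.
by under eq_Rintegral do rewrite mul_conjc/=; rewrite /Rintegral integral0.
Qed.

Lemma L2norm0_ae f : L2 mu f -> L2norm mu f = 0 -> f = cst 0 %[ae mu].
Proof.
move=> Lf f0; have := sqr_L2norm f; rewrite f0 expr0n/= => fi.
have : (\int[mu]_x `|(sqn (f x))%:E|)%E = 0%E.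
  under eq_integral do rewrite /= ger0_norm ?sqn_ge0//.
  have fin : (\int[mu]_x (sqn (f x))%:E)%E \is a fin_num.
    by apply: integrable_fin_num => //; exact: (L2_integrable Lf).
  by rewrite -(fineK fin); congr EFin; exact/esym.
move/(ae_eq_integral_abs mu measurableT
  ((measurable_EFinP _ _).2 (measurable_sqn (L2_cmeas Lf)))).
apply: filterS => x /(_ Logic.I) [fx] _.
exact: sqn_eq0.
Qed.

Lemma ae_eq_Rint (f g : T -> R) : measurable_fun setT f -> measurable_fun setT g ->
  f = g %[ae mu] -> \int[mu]_x f x = \int[mu]_x g x.
Proof.
move=> mf mg fg; congr fine; apply: ae_eq_integral => //.
- exact/measurable_EFinP.
- exact/measurable_EFinP.
- by apply: filterS fg => x /(_ Logic.I) -> _.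
Qed.

Lemma ae_eq_cint f g : cmeas f -> cmeas g -> f = g %[ae mu] -> cint f = cint g.
Proof.
move=> [f1 f2] [g1 g2] fg; apply: complexP => /=; apply: ae_eq_Rint => //;
by apply: filterS fg => x /(_ Logic.I) -> _.
Qed.

Lemma ae_eq_inner f f' g g' : cmeas f -> cmeas g -> cmeas f' -> cmeas g' ->
  f = f' %[ae mu] -> g = g' %[ae mu] -> inner mu f g = inner mu f' g'.
Proof.
move=> ? ? ? ? ff gg; apply: ae_eq_cint; try by apply: cmeasM => //; exact: cmeasJ.
by apply: filterS2 ff gg => x /(_ Logic.I) -> /(_ Logic.I) -> _.
Qed.

Lemma ae_eq_L2norm f g : cmeas f -> cmeas g -> f = g %[ae mu] -> L2norm mu f = L2norm mu g.
Proof.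
move=> ? ? fg; rewrite !L2normE; congr Num.sqrt; apply: ae_eq_Rint.
- exact: measurable_sqn.
- exact: measurable_sqn.
- by apply: filterS fg => x /(_ Logic.I) -> _.
Qed.

Lemma ae_eq_L2norm0 f : cmeas f -> f = cst 0 %[ae mu] -> L2norm mu f = 0.
Proof.
move=> mf /(ae_eq_L2norm mf (cmeas_cst _)) ->.
rewrite L2normE /Rintegral /=; under eq_integral do rewrite sqn0.
by rewrite integral0 sqrtr0.
Qed.

Lemma cauchy_schwarz f g : L2 mu f -> L2 mu g ->
  Normc.normc (inner mu f g) <= L2norm mu f * L2norm mu g.
Proof.
move=> Lf Lg.
set a := L2norm mu f; set b := L2norm mu g; set z := inner mu f g.
have a0 : 0 <= a := L2norm_ge0 f.
have b0 : 0 <= b := L2norm_ge0 g.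
have [b00|bN0] := eqVneq b 0.
  have g0 := L2norm0_ae Lg b00.
  have -> : z = 0.
    rewrite /z (@ae_eq_inner f f g (fun=> 0)).
    - rewrite innerE; apply: complexP => /=;
        by under eq_Rintegral do rewrite mulr0; rewrite /Rintegral integral0.
    - exact: L2_cmeas.
    - exact: L2_cmeas.
    - exact: L2_cmeas.
    - exact: cmeas_cst.
    - by apply: filterE.
    - by [].
  by rewrite Normc.normc0 mulr_ge0.
have {}b0 : 0 < b by rewrite lt_def bN0.
pose w := Complex (b ^+ 2) 0.
have : 0 <= complex.Re (inner mu (fun x => w * f x - z^*%C * g x) (fun x => w * f x - z^*%C * g x)).
  by rewrite inner_self /= sqr_ge0.
have L1 := L2Z w Lf; have L2' := L2Z z^*%C Lg.
rewrite innerBr ?innerBl//; try exact: L2B.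
rewrite !innerZr// ?innerZl// !inner_self -/a -/b (innerJ Lf Lg) -/z /w.
move: (z) => [p q]; rewrite !reimE /= => h.
have {}h : 0 <= b ^+ 2 * (a ^+ 2 * b ^+ 2 - (p ^+ 2 + q ^+ 2)) by move: h; lra.
rewrite pmulr_rge0 ?exprn_gt0// subr_ge0 in h.
rewrite (le_trans (ler_wsqrtr h))// -exprMn sqrtr_sqr ger0_norm//.
by rewrite mulr_ge0// ltW.
Qed.

Lemma L2norm_triangle f g : L2 mu f -> L2 mu g ->
  L2norm mu (fun x => f x + g x) <= L2norm mu f + L2norm mu g.
Proof.
move=> Lf Lg.
have fg0 : 0 <= L2norm mu f + L2norm mu g by rewrite addr_ge0// L2norm_ge0.
rewrite -(@ler_pXn2r _ 2)// ?nnegrE ?L2norm_ge0//.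
have := inner_self (fun x => f x + g x); rewrite innerDr//; last exact: L2D.
rewrite !innerDl// (innerJ Lf Lg) !inner_self.
have := cauchy_schwarz Lf Lg; have := Re_le_normc (inner mu f g).
have := ler_norm (complex.Re (inner mu f g)).
move: (inner mu f g) => z h1 h2 h3 /(congr1 (@complex.Re R)).
rewrite !reimE /= => <-; rewrite sqrrD -mulr_natl; move: h1 h2 h3; lra.
Qed.

Lemma L2normZ (a : C) f : L2 mu f ->
  L2norm mu (fun x => a * f x) = Normc.normc a * L2norm mu f.
Proof.
move=> Lf; rewrite !L2normE normcE -sqrtrM ?sqn_ge0//; congr Num.sqrt.
under eq_Rintegral do rewrite sqnM.
by rewrite RintegralZl//; exact: L2_integrable.
Qed.

Lemma L2normM (c f : T -> C) (b : R) : cmeas c -> (forall x, Normc.normc (c x) <= b) ->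
  0 <= b -> L2 mu f -> L2norm mu (fun x => c x * f x) <= b * L2norm mu f.
Proof.
move=> mc cb b0 Lf.
rewrite -(@ler_pXn2r _ 2)// ?nnegrE ?mulr_ge0 ?L2norm_ge0// exprMn !sqr_L2norm.
rewrite -RintegralZl//; last exact: L2_integrable.
apply: le_Rintegral => //.
- by have := L2_integrable (L2M mc cb Lf).
- exact: (integrableZl measurableT (b ^+ 2) (L2_integrable Lf)).
- move=> x _; rewrite sqnM ler_wpM2r ?sqn_ge0// -sqr_normcE.
  by rewrite lerXn2r// ?nnegrE ?normc_ge0.
Qed.

Lemma L2norm_sum I (r : seq I) (f : I -> T -> C) : (forall i, L2 mu (f i)) ->
  L2norm mu (fun x => \sum_(i <- r) f i x) <= \sum_(i <- r) L2norm mu (f i).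
Proof.
move=> Lf; elim: r => [|i r ih].
  rewrite big_nil; under eq_fun do rewrite big_nil.
  by rewrite (ae_eq_L2norm0 (cmeas_cst 0))//; exact: filterE.
rewrite big_cons; under eq_fun do rewrite big_cons.
apply: (le_trans (L2norm_triangle _ _)) => //; last exact: lerD.
exact: L2_sum.
Qed.

Lemma L2_dominated_cvg (v : nat -> T -> C) h (b : R) : 0 <= b ->
  (forall n, cmeas (v n)) -> (forall n x, Normc.normc (v n x) <= b * Normc.normc (h x)) ->
  {ae mu, forall x, Normc.normc (v n x) @[n --> \oo] --> (0 : R)} -> L2 mu h ->
  L2norm mu (v n) @[n --> \oo] --> (0 : R).
Proof.
move=> b0 mv vb v0 Lh.
pose F (n : nat) (x : T) := (sqn (v n x))%:E.
have mF n : measurable_fun setT (F n) by exact/measurable_EFinP/measurable_sqn.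
have [] := @dominated_convergence _ _ _ mu setT measurableT F (cst 0%E)
  (fun x => (b ^+ 2 * sqn (h x))%:E) mF.
- exact: measurable_cst.
- apply: filterS v0 => x vx _ /=; apply: cvg_EFin; first exact: nearW.
  rewrite /F /comp /=; under eq_fun do rewrite -sqr_normcE expr2.
  have := cvgM vx vx; rewrite !mul0r => hh.
  exact: hh.
- exact: (integrableZl measurableT (b ^+ 2) (L2_integrable Lh)).
- apply: filterE => x n _; rewrite /F /= lee_fin ger0_norm ?sqn_ge0//.
  by rewrite -!sqr_normcE -exprMn lerXn2r// ?nnegrE ?mulr_ge0 ?normc_ge0.
move=> _ _; rewrite integral_cst// mul0e => /fine_cvg hI.
apply: (@cvg_trans _ ((Num.sqrt (fine (\int[mu]_x F n x)%E)) @[n --> \oo])).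
  by under eq_fun do rewrite L2normE.
rewrite -(sqrtr0 R); apply: (continuous_cvg _ _ hI).
exact: sqrt_continuous.
Qed.

Lemma L2_dominated (c : nat -> T -> C) f (b : R) :
  (forall n, cmeas (c n)) -> (forall n x, Normc.normc (c n x) <= b) ->
  {ae mu, forall x, Normc.normc (c n x) @[n --> \oo] --> (0 : R)} -> L2 mu f ->
  L2norm mu (fun x => c n x * f x) @[n --> \oo] --> (0 : R).
Proof.
move=> mc cb c0 Lf; apply: (@L2_dominated_cvg _ f `|b|) => //.
- by move=> n; apply: cmeasM => //; exact: L2_cmeas.
- move=> n x; rewrite Normc.normcM ler_wpM2r ?normc_ge0//.
  exact: le_trans (cb n x) (ler_norm b).
- apply: filterS c0 => x h; under eq_fun do rewrite Normc.normcM.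
  by have := cvgM h (cvg_cst (Normc.normc (f x))); rewrite mul0r => hh; exact: hh.
Qed.

End L2Theory.

(** * Measure-preserving maps *)

Section Preserving.
Context d (T : measurableType d) (R : realType).
Variable mu : {measure set T -> \bar R}.
Variable tau : T -> T.
Hypothesis mtau : measurable_fun setT tau.
Hypothesis ptau : preserves mu tau.
Local Notation C := R[i].

Lemma ge0_integral_preserves (f : T -> \bar R) : measurable_fun setT f ->
  (forall x, 0 <= f x)%E -> (\int[mu]_x f (tau x) = \int[mu]_x f x)%E.
Proof.
move=> mf f0; transitivity (\int[pushforward mu tau]_x f x)%E.
  by rewrite ge0_integral_pushforward// preimage_setT.
by apply: eq_measure_integral => A mA _; exact: ptau.
Qed.

Lemma ae_preserves (P : T -> Prop) : {ae mu, forall x, P x} -> {ae mu, forall x, P (tau x)}.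
Proof.
move=> [A [mA A0 PA]]; exists (tau @^-1` A); split.
- by rewrite -[X in measurable X]setTI; exact: mtau.
- by rewrite ptau.
- by move=> x /= nP; exact: PA.
Qed.

Lemma integrable_preserves (f : T -> R) : mu.-integrable setT (EFin \o f) ->
  mu.-integrable setT (EFin \o (f \o tau)).
Proof.
move=> /integrableP[mf fi]; apply/integrableP; split.
  exact: (measurableT_comp mf mtau).
have := @ge0_integral_preserves (fun x => `|(f x)%:E|%E).
by move=> /(_ (measurableT_comp (@abse_measurable _ setT) mf)) /= ->.
Qed.

Lemma Rintegral_preserves (f : T -> R) : mu.-integrable setT (EFin \o f) ->
  \int[mu]_x f (tau x) = \int[mu]_x f x.
Proof.
move=> fi; rewrite /Rintegral; congr fine.
transitivity (\int[pushforward mu tau]_x (EFin \o f) x)%E.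
  rewrite integral_pushforward ?preimage_setT//.
    by have /integrableP[] := fi.
  exact: integrable_preserves.
by apply: eq_measure_integral => A mA _; exact: ptau.
Qed.

Lemma cmeas_preserves (f : T -> C) : cmeas f -> cmeas (fun x => f (tau x)).
Proof.
by move=> [f1 f2]; split; [exact: (measurableT_comp f1 mtau)|exact: (measurableT_comp f2 mtau)].
Qed.

Lemma L2_preserves (f : T -> C) : L2 mu f -> L2 mu (fun x => f (tau x)).
Proof.
move=> /L2P[mf fi]; apply/L2P; split; first exact: cmeas_preserves.
exact: (integrable_preserves (f := fun x => sqn (f x))).
Qed.

Lemma L2norm_preserves (f : T -> C) : L2 mu f ->
  L2norm mu (fun x => f (tau x)) = L2norm mu f.
Proof.
move=> Lf; rewrite !L2normE; congr Num.sqrt.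
by rewrite (Rintegral_preserves (f := fun x => sqn (f x)))//; exact: L2_integrable.
Qed.

Lemma inner_preserves (f g : T -> C) : L2 mu f -> L2 mu g ->
  inner mu (fun x => f (tau x)) (fun x => g (tau x)) = inner mu f g.
Proof.
move=> Lf Lg; have [h1 h2] := L2_cintegrable Lf Lg.
by apply: complexP; [exact: Rintegral_preserves h1|exact: Rintegral_preserves h2].
Qed.

Lemma preserves_iter N : preserves mu (iter N tau).
Proof.
elim: N => [|N ih] A mA; first by [].
rewrite -[RHS]ih// -[RHS]ptau.
  by congr (mu _); apply/seteqP; split => x; rewrite /preimage/= -iterSr.
rewrite -[X in measurable X]setTI; have : measurable_fun setT (iter N tau).
  elim: N {ih} => [|N ih]; first exact: measurable_id.
  exact: (measurableT_comp mtau ih).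
by apply.
Qed.

Lemma measurable_iter N : measurable_fun setT (iter N tau).
Proof.
elim: N => [|N ih]; first exact: measurable_id.
exact: (measurableT_comp mtau ih).
Qed.

End Preserving.

(** * The pointwise ergodic theorem for bounded functions *)

Section Birkhoff.
Context d (T : measurableType d) (R : realType).
Variable mu : probability T R.
Variable tau : T -> T.
Hypothesis mtau : measurable_fun setT tau.
Hypothesis ptau : preserves mu tau.

Definition birkhoff_sum (V : zmodType) (f : T -> V) (n : nat) (x : T) : V :=
  \sum_(k < n) f (iter k tau x).

Lemma birkhoff_sumS (V : zmodType) (f : T -> V) n x :
  birkhoff_sum f n.+1 x = f x + birkhoff_sum f n (tau x).
Proof.
rewrite /birkhoff_sum big_ord_recl; congr (_ + _).
by apply: eq_bigr => k _; rewrite /= -iterSr.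
Qed.

(** The running maximum of the Birkhoff sums of lengths 0 to n, through the
recursion that makes the maximal inequality a telescoping argument. *)
Fixpoint max_sum (f : T -> R) (n : nat) (x : T) : R :=
  if n is n'.+1 then Num.max 0 (f x + max_sum f n' (tau x)) else 0.

Lemma max_sum_ge0 f n x : 0 <= max_sum f n x.
Proof. by case: n => [|n] //=; rewrite le_max lexx. Qed.

Lemma max_sumS f n x : max_sum f n x <= max_sum f n.+1 x.
Proof.
elim: n x => [|n ih] x; first exact: (max_sum_ge0 f 1).
rewrite [leLHS]/= [leRHS]/= ge_max !le_max lexx /= ; apply/orP; right.
by rewrite lerD2l; exact: ih.
Qed.

Lemma max_sum_homo f x : {homo max_sum f ^~ x : n m / (n <= m)%N >-> n <= m}.
Proof. by apply: homo_leq; [exact: lexx|exact: le_trans|exact: (max_sumS f ^~ x)]. Qed.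

Lemma birkhoff_le_max_sum f n x : birkhoff_sum f n x <= max_sum f n x.
Proof.
elim: n x => [|n ih] x; first by rewrite /birkhoff_sum big_ord0.
by rewrite birkhoff_sumS /= le_max lerD2l ih orbT.
Qed.

Lemma measurable_max_sum f n : measurable_fun setT f -> measurable_fun setT (max_sum f n).
Proof.
move=> mf; elim: n => [|n ih]; first exact: measurable_cst.
apply: measurable_maxr; first exact: measurable_cst.
by apply: measurable_funD => //; exact: measurableT_comp ih mtau.
Qed.

Lemma max_sum_bounded f b n x : (forall x, `|f x| <= b) -> `|max_sum f n x| <= n%:R * b.
Proof.
move=> fb; rewrite ger0_norm ?max_sum_ge0//.
have b0 : 0 <= b by rewrite (le_trans _ (fb x)).
elim: n x => [|n ih] x /=; first by rewrite mul0r.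
rewrite ge_max mulr_ge0//= -natr1 mulrDl mul1r addrC lerD//.
by rewrite (le_trans (ler_norm _)).
Qed.

Lemma bounded_integrable (f : T -> R) b : measurable_fun setT f -> (forall x, `|f x| <= b) ->
  mu.-integrable setT (EFin \o f).
Proof.
move=> mf fb; apply: (le_integrable measurableT (g := cst b%:E)).
- exact/measurable_EFinP.
- by move=> x _ /=; rewrite lee_fin (le_trans (fb x))// ler_norm.
- exact: finite_measure_integrable_cst.
Qed.

(** Maximal ergodic inequality, for the event that some Birkhoff sum is positive;
where the running maximum is positive, its increment from [tau x] to [x] is
bounded by [f x], and this increment has mean zero by invariance. *)
Lemma maximal_ergodic (f : T -> R) (b : R) : measurable_fun setT f -> (forall x, `|f x| <= b) ->
  {ae mu, forall x, exists n, 0 < birkhoff_sum f n x} -> 0 <= \int[mu]_x f x.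
Proof.
move=> mf fb fpos.
have b0 : 0 <= b by rewrite (le_trans _ (fb point)).
pose E n := [set x | 0 < max_sum f n x].
have mE n : measurable (E n).
  rewrite -[X in measurable X]setTI [X in _ `&` X](_ : _ = max_sum f n @^-1` `]0, +oo[%classic).
    by apply: measurable_max_sum.
  by apply/seteqP; split => x /=; rewrite in_itv /= andbT.
pose g n x : R := f x * \1_(E n) x.
have mg n : measurable_fun setT (g n).
  by apply: measurable_funM => //; exact: measurable_indic.
have gb n x : `|g n x| <= b.
  rewrite /g normrM indicE; case: (_ \in _); rewrite ?normr1 ?mulr1//.
  by rewrite normr0 mulr0.
have g0 n : 0 <= \int[mu]_x g n x.
  have iM : mu.-integrable setT (EFin \o max_sum f n).
    apply: (@bounded_integrable _ (n%:R * b)); first exact: measurable_max_sum.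
    by move=> x; exact: max_sum_bounded.
  have iMt := integrable_preserves mtau ptau iM.
  have <- : \int[mu]_x (max_sum f n x - max_sum f n (tau x)) = 0.
    by rewrite RintegralB//; rewrite (Rintegral_preserves mtau ptau iM) subrr.
  apply: le_Rintegral => //.
  - by apply: eq_integrable (integrableB _ iM iMt) => //.
  - exact: (bounded_integrable (mg n) (gb n)).
  (* where the maximum is positive, it is [f x] plus the previous maximum at
     [tau x] *)
  - move=> x _; rewrite /g indicE; case: (boolP (x \in E n)).
      rewrite inE /E /= mulr1 => Mpos.
      case: n Mpos {mE mg gb iM iMt} => [|n] /=; first by rewrite ltxx.
      rewrite lt_max ltxx /= => h; rewrite (max_idPr (ltW h)).
      have /= := max_sumS f n (tau x); lra.
    rewrite notin_setE /E /= => /negP; rewrite -leNgt => h; rewrite mulr0.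
    have := max_sum_ge0 f n (tau x); lra.
have : \int[mu]_x g n x @[n --> \oo] --> \int[mu]_x f x.
  have [] := @dominated_convergence _ _ _ mu setT measurableT
    (fun n x => (g n x)%:E) (EFin \o f) (cst b%:E).
  - by move=> n; exact/measurable_EFinP.
  - exact/measurable_EFinP.
  - apply: filterS fpos => x [m mpos] _; apply: cvg_EFin; first exact: nearW.
    apply: cvg_near_cst; exists m => // n /= mn.
    rewrite /g indicE mem_set ?mulr1// /E /=.
    rewrite (lt_le_trans mpos)// (le_trans (birkhoff_le_max_sum _ _ _))//.
    exact: max_sum_homo.
  - exact: finite_measure_integrable_cst.
  - by apply: filterE => x n _; rewrite lee_fin.
  move=> fi _ h; apply: fine_cvg; rewrite fineK//.
  exact: integrable_fin_num.
move=> h; rewrite -(cvg_lim _ h)//; apply: limr_ge; last exact: nearW.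
by apply/cvg_ex; exists (\int[mu]_x f x).
Qed.

Hypothesis ergodic : forall E, measurable E -> tau @^-1` E = E -> mu E = 0%E \/ mu E = 1%E.

Lemma measurable_birkhoff_sum (f : T -> R) n : measurable_fun setT f ->
  measurable_fun setT (birkhoff_sum f n).
Proof.
move=> mf; rewrite /birkhoff_sum; apply: measurable_sum => k.
exact: (measurableT_comp mf (measurable_iter mtau k)).
Qed.

(** If the space average is negative, the event that the Birkhoff sums are
unbounded above is exactly invariant, and it cannot have full measure by the
maximal inequality. *)
Lemma birkhoff_sum_bounded (f : T -> R) (b : R) : measurable_fun setT f ->
  (forall x, `|f x| <= b) -> \int[mu]_x f x < 0 ->
  {ae mu, forall x, exists m : R, forall n, birkhoff_sum f n x <= m}.
Proof.
move=> mf fb fneg.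
pose E := [set x | forall m : nat, exists n, m%:R < birkhoff_sum f n x].
have mE : measurable E.
  have -> : E = \bigcap_m \bigcup_n (birkhoff_sum f n @^-1` `]m%:R, +oo[%classic).
    apply/seteqP; split => x.
      move=> Ex m _; have [n h] := Ex m; exists n => //=.
      by rewrite in_itv /= andbT.
    move=> Ex m; have [n _] := Ex m Logic.I; rewrite /= in_itv /= andbT => h.
    by exists n.
  apply: bigcap_measurable => // m _; apply: bigcup_measurable => n _.
  by rewrite -[X in measurable X]setTI; exact: measurable_birkhoff_sum.
(* the sums at [x] and at [tau x] differ by at most the bound [b] of [f] *)
have Einv : tau @^-1` E = E.
  apply/seteqP; split => x Ex m /=.
    have [n h] := Ex (m + Num.truncn b).+1; exists n.+1.
    rewrite birkhoff_sumS; move: h; rewrite -addn1 -addnA natrD addn1.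
    have := real_truncnS_gt (num_real b); have := fb x; rewrite ler_norml => /andP[]; lra.
  have [n h] := Ex (m + Num.truncn b).+1.
  case: n h => [|n] h.
    by exfalso; move: h; rewrite /birkhoff_sum big_ord0 ltNge ler0n.
  exists n; move: h; rewrite birkhoff_sumS -addn1 -addnA natrD addn1.
  have := real_truncnS_gt (num_real b); have := fb x; rewrite ler_norml => /andP[]; lra.
have [E0|E1] := ergodic mE Einv; last first.
  exfalso; suff : 0 <= \int[mu]_x f x by rewrite leNgt fneg.
  apply: (maximal_ergodic mf fb); exists (~` E); split.
  - exact: measurableC.
  - by rewrite probability_setC// E1 subee.
  - move=> x /= h Ex; apply: h; have [n h] := Ex 0; exists n.
    by apply: le_lt_trans h; rewrite ler0n.
exists E; split => // x /= h m; apply: contrapT => nh; apply: h; exists m%:R => n.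
by rewrite leNgt; apply/negP => h; apply: nh; exists n.
Qed.

(** The Birkhoff sums of [f] minus a constant slightly above its mean are
bounded above. *)
Lemma birkhoff_limsup (f : T -> R) (b : R) : measurable_fun setT f ->
  (forall x, `|f x| <= b) ->
  {ae mu, forall x, forall e, 0 < e ->
    \forall n \near \oo, n%:R^-1 * birkhoff_sum f n x <= \int[mu]_x f x + e}.
Proof.
move=> mf fb; set I := \int[mu]_x f x.
have fi := bounded_integrable mf fb.
have key (k : nat) : {ae mu, forall x, exists m : R, forall n,
    birkhoff_sum (fun x => f x - (I + k.+1%:R^-1)) n x <= m}.
  apply: (@birkhoff_sum_bounded _ (b + `|I + k.+1%:R^-1|)).
  - by apply: measurable_funB => //; exact: measurable_cst.
  - by move=> x; rewrite (le_trans (ler_normB _ _))// lerD.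
  - rewrite RintegralB//; last exact: finite_measure_integrable_cst.
    rewrite Rintegral_cst// [X in fine X]probability_setT mulr1 -/I.
    by rewrite opprD addNKr oppr_lt0 invr_gt0.
apply: filterS (ae_foralln key) => x h e e0.
have e20 : 0 < e / 2 by lra.
pose k := Num.truncn (e / 2)^-1.
have ke : k.+1%:R^-1 < e / 2.
  by rewrite invf_plt ?posrE//; exact: real_truncnS_gt (num_real _).
have [m hm] := h k.
exists (Num.truncn (m / (e / 2))).+1 => // n /= mn.
have n0 : (0 < n%:R :> R) by rewrite ltr0n (leq_trans _ mn).
have {}mn : m < (e / 2) * n%:R.
  rewrite mulrC -ltr_pdivrMr//.
  apply: (lt_le_trans (real_truncnS_gt (num_real _))).
  by rewrite ler_nat.
have := hm n; rewrite {1}/birkhoff_sum big_split /= -/(birkhoff_sum f n x).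
rewrite sumr_const card_ord => hn.
rewrite mulrC ler_pdivrMr//.
have : (I + k.+1%:R^-1) * n%:R <= (I + e / 2) * n%:R.
  by rewrite ler_wpM2r// ?lerD2l ltW.
have -> : (I + e) * n%:R = (I + e / 2) * n%:R + e / 2 * n%:R by field.
move: hn; rewrite mulNrn -(mulr_natr (I + _) n); move: mn.
set u := e / 2 * _; set v := (I + _) * _; set w := (I + _) * _; lra.
Qed.

Lemma birkhoff_cvg (f : T -> R) (b : R) : measurable_fun setT f ->
  (forall x, `|f x| <= b) ->
  {ae mu, forall x, n%:R^-1 * birkhoff_sum f n x @[n --> \oo] --> \int[mu]_x f x}.
Proof.
move=> mf fb.
have h1 := birkhoff_limsup mf fb.
have h2 : {ae mu, forall x, forall e, 0 < e ->
    \forall n \near \oo, n%:R^-1 * birkhoff_sum (fun x => - f x) n x <= \int[mu]_x (- f x) + e}.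
  apply: (@birkhoff_limsup _ b); first exact: measurableT_comp.
  by move=> x; rewrite normrN.
apply: filterS2 h1 h2 => x h1 h2.
apply/cvgrPdist_le => e e0; near=> n.
have : n%:R^-1 * birkhoff_sum f n x <= \int[mu]_x f x + e by near: n; exact: h1.
have : n%:R^-1 * birkhoff_sum (fun x => - f x) n x <= \int[mu]_x (- f x) + e.
  by near: n; exact: h2.
rewrite {1}/birkhoff_sum sumrN -/(birkhoff_sum f n x) mulrN.
have -> : \int[mu]_x (- f x) = - \int[mu]_x f x.
  under eq_Rintegral do rewrite -mulN1r.
  by rewrite RintegralZl ?mulN1r//; exact: bounded_integrable mf fb.
rewrite ler_norml; lra.
Unshelve. all: by end_near. Qed.

Lemma birkhoff_cvgC (f : T -> R[i]) (b : R) : cmeas f ->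
  (forall x, Normc.normc (f x) <= b) ->
  {ae mu, forall x, Normc.normc (n%:R^-1 * birkhoff_sum f n x - cint mu f) @[n --> \oo] --> (0 : R)}.
Proof.
move=> [f1 f2] fb.
have h1 := birkhoff_cvg f1 (fun x => le_trans (Re_le_normc _) (fb x)).
have h2 := birkhoff_cvg f2 (fun x => le_trans (Im_le_normc _) (fb x)).
apply: filterS2 h1 h2 => x h1 h2; apply/normc_cvg0; split.
  have hh : n%:R^-1 * birkhoff_sum (fun x => complex.Re (f x)) n x -
      \int[mu]_x complex.Re (f x) @[n --> \oo] --> (0 : R).
    rewrite -(subrr (\int[mu]_x complex.Re (f x))).
    by apply: cvgB h1 _; exact: cvg_cst.
  apply: cvg_trans hh; apply: near_eq_cvg; apply: nearW => n /=.
  by rewrite natCV cReD cReN cReM /= mul0r subr0 Re_sum.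
have hh : n%:R^-1 * birkhoff_sum (fun x => complex.Im (f x)) n x -
    \int[mu]_x complex.Im (f x) @[n --> \oo] --> (0 : R).
  rewrite -(subrr (\int[mu]_x complex.Im (f x))).
  by apply: cvgB h2 _; exact: cvg_cst.
apply: cvg_trans hh; apply: near_eq_cvg; apply: nearW => n /=.
by rewrite natCV cImD cImN cImM /= mul0r addr0 Im_sum.
Qed.

End Birkhoff.

Section UniqueErgodicity.
Context d (T : measurableType d) (R : realType).
Variable mu : probability T R.
Variable tau : T -> T.
Hypothesis mtau : measurable_fun setT tau.

(** Conditioning the invariant measure on an invariant event of positive
measure gives again an invariant probability measure. *)
Lemma uniquely_ergodic_ergodic : uniquely_ergodic mu tau ->
  forall E, measurable E -> tau @^-1` E = E -> mu E = 0%E \/ mu E = 1%E.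
Proof.
move=> [ptau uniq] E mE Einv.
have [->|E0] := eqVneq (mu E) 0%E; [by left|right].
pose nu : probability T R := mnormalize (mrestr mu mE) mu.
have ET : mrestr mu mE setT = mu E by rewrite /mrestr setTI.
have Efin : mu E \is a fin_num by exact: fin_num_measure.
have nuE A : nu A = (mu (A `&` E) * (fine (mu E))^-1%:E)%E.
  rewrite -[LHS]/(mnormalize (mrestr mu mE) mu A) /mnormalize /= ET (negbTE E0) /=.
  by have -> : (mu E == +oo)%E = false by move: Efin; case: (mu E).
have : nu E = mu E.
  apply: (uniq nu) => // A mA; rewrite !nuE.
  by rewrite -{1}Einv -preimage_setI ptau//; exact: measurableI.
rewrite nuE setIid => <-; rewrite -{1}(fineK Efin) -EFinM divff//.
by rewrite -eqe fineK.
Qed.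

End UniqueErgodicity.

(** * Borel product spaces and Haar measure *)

Section BorelTopology.

Lemma continuous_borel (X Y : ptopologicalType) (f : X -> Y) :
  continuous f -> measurable_fun setT (f : borel X -> borel Y).
Proof.
move=> /continuousP cf; apply: (@measurability _ _ (borel X) (borel Y) setT f (@open Y)) => //.
move=> _ [U oU <-]; rewrite setTI; apply: sub_sigma_algebra.
exact: cf.
Qed.

Lemma open_borel (X : ptopologicalType) (O : set X) : open O -> measurable (O : set (borel X)).
Proof. by move=> oO; apply: sub_sigma_algebra. Qed.

(** Products of basic open sets form a countable basis of the product, so the
product of Borel sigma-algebras contains all open sets. *)
Lemma open_prod_measurable (X Y : ptopologicalType) (O : set (X * Y)) :
  @second_countable X -> @second_countable Y -> open O ->
  measurable (O : set (borel X * borel Y)).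
Proof.
move=> [BX cX [oX bX]] [BY cY [oY bY]] oO.
pose P (p : set X * set Y) := [/\ BX p.1, BY p.2 & p.1 `*` p.2 `<=` O].
have -> : O = \bigcup_(i : {p | P p}) ((sval i).1 `*` (sval i).2).
  apply/seteqP; split => [[x y] Oxy|[x y] [[p [? ? h]] _] /= xy]; last exact: h.
  have [[U V] /= [Ux Vy] UVO] : nbhs (x, y) O by exact: open_nbhs_nbhs.
  have [U' [/= BU' U'x] U'U] := bX x _ Ux.
  have [V' [/= BV' V'y] V'V] := bY y _ Vy.
  have h : P (U', V').
    by split=> //= -[a b] /= [/U'U ? /V'V ?]; exact: UVO.
  by exists (exist _ _ h).
apply: countable_bigcupT_measurable.
  have /countable_injP[f finj] := cX; have /countable_injP[g ginj] := cY.
  apply/countable_injP; exists (fun i => pickle (f (sval i).1, g (sval i).2)).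
  move=> [[U V] h] [[U' V'] h'] _ _ /= /(pcan_inj pickleK)[e1 e2].
  have [h1 h2 _] := h; have [h1' h2' _] := h'.
  have eU : U = U' by apply: finj; rewrite ?inE.
  have eV : V = V' by apply: ginj; rewrite ?inE.
  by subst; congr exist; exact: Prop_irrelevance.
move=> [[U V] [/= BU BV _]]; apply: measurableX; apply: open_borel; [exact: oX|exact: oY].
Qed.

Lemma measurable_funR_open d (T : measurableType d) (R : realType) (f : T -> R) :
  (forall O : set R, open O -> measurable (f @^-1` O)) -> measurable_fun setT f.
Proof.
move=> h; apply: (measurability _ (RGenOInfty.measurableE R)) => _ [_ [a ->] <-].
by rewrite setTI; apply: h; exact: interval_open.
Qed.

Lemma continuous_borelR (X : ptopologicalType) (R : realType) (f : X -> R) :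
  continuous f -> measurable_fun setT (f : borel X -> R).
Proof.
by move=> /continuousP cf; apply: measurable_funR_open => O oO; apply: open_borel; exact: cf.
Qed.

Lemma continuous_borel_prodR (X Y : ptopologicalType) (R : realType) (f : X * Y -> R) :
  @second_countable X -> @second_countable Y -> continuous f ->
  measurable_fun setT (f : borel X * borel Y -> R).
Proof.
move=> sX sY /continuousP cf; apply: measurable_funR_open => O oO.
by apply: open_prod_measurable => //; exact: cf.
Qed.

Lemma continuous_borel_prod (X Y Z : ptopologicalType) (f : X * Y -> Z) :
  @second_countable X -> @second_countable Y -> continuous f ->
  measurable_fun setT (f : borel X * borel Y -> borel Z).
Proof.
move=> sX sY /continuousP cf.
apply: (@measurability _ _ (borel X * borel Y)%type (borel Z) setT f (@open Z)) => //.
move=> _ [U oU <-]; rewrite setTI; apply: open_prod_measurable => //.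
exact: cf.
Qed.

End BorelTopology.

Section ProductMeasure.
Context d1 d2 (X : measurableType d1) (Y : measurableType d2) (R : realType).
Variables (mX : probability X R) (mY : probability Y R).
Local Notation mu := (mX \x mY)%E.

Lemma prod_measureE (A : set (X * Y)) : measurable A ->
  mu A = (\int[mX]_x mY (xsection A x))%E.
Proof. by []. Qed.

Lemma ae_prod (P : X * Y -> Prop) : {ae mu, forall p, P p} ->
  {ae mX, forall x, {ae mY, forall y, P (x, y)}}.
Proof.
move=> [A [mA A0 PA]].
have mf := measurable_fun_xsection mY mA.
have : ae_eq mX setT (fun x => mY (xsection A x)) (cst 0%E).
  apply/ae_eq_integral_abs => //.
  by under eq_integral do rewrite gee0_abs//.
apply: filterS => x /(_ Logic.I) /= Ax0.
exists (xsection A x); split => //; first exact: measurable_xsection.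
by move=> y /= nP; rewrite /xsection /= mem_set//; exact: PA.
Qed.

Lemma ae_fst (P : X -> Prop) : {ae mX, forall x, P x} -> {ae mu, forall p, P p.1}.
Proof.
move=> [A [mA A0 PA]]; exists (A `*` setT); split.
- exact: measurableX.
- by rewrite product_measure1E// [X in (X * _)%E]A0 mul0e.
- by move=> [x y] /= h; split=> //; exact: PA.
Qed.

Lemma ae_inhabited (P : Y -> Prop) : {ae mY, forall y, P y} -> exists y, P y.
Proof.
move=> [A [mA A0 PA]]; apply: contrapT => nP.
have : A = setT.
  by apply/seteqP; split => // y _; apply: PA => /= Py; apply: nP; exists y.
by move=> AT; move: A0; rewrite AT probability_setT => /eqP; rewrite onee_eq0.
Qed.

End ProductMeasure.

Section Haar.
Variables (R : realType) (G : ptopologicalGroupType).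
Hypothesis G2 : @second_countable G.
Hypothesis mulc : continuous (fun p : G * G => (p.1 * p.2)%g).
Hypothesis invc : continuous (fun g : G => (g^-1)%g).
Variable mu : probability (borel G) R.
Hypothesis hmu : haar mu.

Lemma continuous_mulg (X : topologicalType) (f g : X -> G) :
  continuous f -> continuous g -> continuous (fun x => (f x * g x)%g).
Proof.
move=> cf cg x; apply: (@continuous_comp _ _ _ (fun x => (f x, g x)) (fun p => (p.1 * p.2)%g)).
  by apply: cvg_pair; [exact: cf|exact: cg].
exact: mulc.
Qed.

Lemma continuous_invg (X : topologicalType) (f : X -> G) :
  continuous f -> continuous (fun x => ((f x)^-1)%g).
Proof. by move=> cf x; apply: (@continuous_comp _ _ _ f); [exact: cf|exact: invc]. Qed.

Lemma cst_continuousG (X : topologicalType) (g : G) : continuous (fun _ : X => g).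
Proof. by move=> x; exact: cvg_cst. Qed.

Lemma id_continuousG : continuous (fun g : G => g).
Proof. by move=> x; exact: cvg_id. Qed.

(** Both iterated integrals of the indicator of [y^-1 x \in A] are immediate
from left invariance. *)
Lemma haar_inv : preserves mu (fun g : G => (g^-1)%g).
Proof.
move=> A mA; pose E := [set p : borel G * borel G | A ((p.1 : G)^-1 * p.2)%g].
have mE : measurable E.
  have -> : E = (fun p : G * G => (p.1^-1 * p.2)%g) @^-1` A by [].
  rewrite -[X in measurable X]setTI; apply: continuous_borel_prod mA => //.
  apply: continuous_mulg; first apply: continuous_invg.
    by move=> p; exact: cvg_fst.
  by move=> p; exact: cvg_snd.
have mAV : measurable ((fun g : G => (g^-1)%g) @^-1` A : set (borel G)).
  by rewrite -[X in measurable X]setTI; apply: continuous_borel mA.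
have := indic_fubini_tonelli mu mu mE.
rewrite indic_fubini_tonelli_FE// indic_fubini_tonelli_GE//.
under eq_integral => y _.
  rewrite /= (_ : xsection E y = (fun h : G => ((y : G)^-1 * h)%g) @^-1` A); last first.
    by apply/seteqP; split => x; rewrite /xsection /= ?inE.
  rewrite hmu//; over.
rewrite integral_cst// [X in (_ * X)%E = _]probability_setT mule1.
under eq_integral => y _.
  rewrite /= (_ : ysection E y = (fun h : G => ((y : G)^-1 * h)%g) @^-1` ((fun g : G => (g^-1)%g) @^-1` A)); last first.
    by apply/seteqP; split => x; rewrite /ysection /= ?inE /E /= invgM invgK.
  rewrite hmu//; over.
by rewrite integral_cst// [X in _ = (_ * X)%E]probability_setT mule1 => ->.
Qed.

(** Right translation by [h] is left translation by [h^-1] conjugated with the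
inversion. *)
Lemma haar_right (h : G) : preserves mu (fun g : G => (g * h)%g).
Proof.
move=> A mA.
have mAV : measurable ((fun g : G => (g^-1)%g) @^-1` A : set (borel G)).
  by rewrite -[X in measurable X]setTI; apply: continuous_borel mA.
rewrite -[RHS]haar_inv// -[RHS](hmu (h^-1)%g)//.
rewrite -[RHS]haar_inv.
  by congr (mu _); apply/seteqP; split => g /=; rewrite invgM !invgK.
rewrite -[X in measurable X]setTI; apply: continuous_borel mAV => //.
by apply: continuous_mulg; [exact: cst_continuousG|exact: id_continuousG].
Qed.

(** Finitely many translates of [U] cover the compact group, so they are not
all null. *)
Lemma haar_open_gt0 (U : set G) : compact [set: G] -> open U -> U 1%g -> (0 < mu U)%E.
Proof.
move=> cG oU U1; rewrite lt0e measure_ge0 andbT; apply/eqP => U0.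
have oUg (g : G) : open ((fun h : G => (g^-1 * h)%g) @^-1` U).
  by move/continuousP : (continuous_mulg (@cst_continuousG G (g^-1)%g) id_continuousG); exact.
move: cG; rewrite compact_cover => /(_ G setT (fun g => (fun h : G => (g^-1 * h)%g) @^-1` U)).
move=> []; first by move=> g _; exact: oUg.
  by move=> g _; exists g => //=; rewrite mulVg.
move=> D _ cov.
set cv := cover _ _ in cov.
have : mu.-negligible cv.
  rewrite /cv /cover bigcup_fset; apply: (big_ind (fun A => mu.-negligible A)).
  - exact: negligible_set0.
  - by move=> A B; exact: negligibleU.
  - move=> g _; exists ((fun h : G => (g^-1 * h)%g) @^-1` U); split => //.
      exact: open_borel.
    by rewrite hmu//; exact: open_borel.
move=> [A [mA A0 covA]]; have AT : A = setT.
  by apply/seteqP; split => // g _; apply: covA; exact: cov.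
by move: A0; rewrite AT probability_setT => /eqP; rewrite onee_eq0.
Qed.

End Haar.

Section SkewPreserves.
Variables (R : realType) (X : ptopologicalType) (G : ptopologicalGroupType).
Hypothesis X2 : @second_countable X.
Hypothesis G2 : @second_countable G.
Hypothesis mulc : continuous (fun p : G * G => (p.1 * p.2)%g).
Hypothesis invc : continuous (fun g : G => (g^-1)%g).
Variables (muX : probability (borel X) R) (muG : probability (borel G) R).
Hypothesis hmuG : haar muG.

(** In each fibre the map is a right translation. *)
Lemma skew_product_preserves (f : X -> X) (u : X -> G) : continuous f -> continuous u ->
  preserves (T := borel X) muX f ->
  measurable_fun setT (fun p : borel X * borel G => (f p.1, ((p.2 : G) * u p.1)%g) : borel X * borel G) /\
  preserves (muX \x muG)%E (fun p : borel X * borel G => (f p.1, ((p.2 : G) * u p.1)%g) : borel X * borel G).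
Proof.
move=> cf cu pf.
pose tau := fun p : borel X * borel G => (f p.1, ((p.2 : G) * u p.1)%g) : borel X * borel G.
have mt : measurable_fun setT tau.
  apply: measurable_fun_pair.
    exact: (measurableT_comp (continuous_borel cf) (@measurable_fst _ _ (borel X) (borel G))).
  apply: (@continuous_borel_prod X G G (fun p => (p.2 * u p.1)%g)) => //.
  apply: continuous_mulg => //; first by move=> p; exact: cvg_snd.
  move=> p; apply: (@continuous_comp _ _ _ fst u); [exact: cvg_fst|exact: cu].
split=> // A mA.
have mtA : measurable (tau @^-1` A).
  by rewrite -[X in measurable X]setTI; exact: mt.
rewrite !prod_measureE//.
rewrite -(ge0_integral_preserves (continuous_borel cf) pf (f := fun x => muG (xsection A x))).
- apply: eq_integral => x _.
  rewrite (_ : xsection (tau @^-1` A) x = (fun g : G => (g * u x)%g) @^-1` (xsection A (f x))); last first.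
    by apply/seteqP; split => g; rewrite /xsection /= !inE.
  by rewrite haar_right//; exact: measurable_xsection.
- exact: measurable_fun_xsection.
- by move=> x; exact: measure_ge0.
Qed.

End SkewPreserves.

(** * Differential calculus in charts *)

Lemma near_fst (X Y : topologicalType) (x : X) (y : Y) (P : X -> Prop) :
  (\forall a \near x, P a) -> \forall p \near (x, y), P p.1.
Proof.
by move=> Px; exists (P, setT); [split=> //; exact: filterT|move=> [a b] []].
Qed.

Lemma near_snd (X Y : topologicalType) (x : X) (y : Y) (P : Y -> Prop) :
  (\forall b \near y, P b) -> \forall p \near (x, y), P p.2.
Proof.
by move=> Px; exists (setT, P); [split=> //; exact: filterT|move=> [a b] []].
Qed.

Lemma near_continuous (X Y : topologicalType) (f : X -> Y) (x : X) (P : Y -> Prop) :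
  {for x, continuous f} -> (\forall y \near f x, P y) -> \forall z \near x, P (f z).
Proof. by move=> fc; exact: fc. Qed.

Lemma cvg_sum_seq (R : realType) (T I : Type) (r : seq I) (G : set_system T) {FG : Filter G}
    (f : I -> T -> R) (l : I -> R) :
  (forall i, f i x @[x --> G] --> l i) ->
  \sum_(i <- r) f i x @[x --> G] --> \sum_(i <- r) l i.
Proof.
move=> h; elim: r => [|i r ih].
  by rewrite big_nil; under eq_fun do rewrite big_nil; exact: cvg_cst.
rewrite big_cons; under eq_fun do rewrite big_cons.
exact: cvgD.
Qed.

Lemma Rintegral_sum d (T : measurableType d) (R : realType) (mu : {measure set T -> \bar R})
    I (r : seq I) (f : I -> T -> R) :
  (forall i, mu.-integrable setT (EFin \o f i)) ->
  mu.-integrable setT (EFin \o (fun x => \sum_(i <- r) f i x)) /\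
  \int[mu]_x (\sum_(i <- r) f i x) = \sum_(i <- r) \int[mu]_x f i x.
Proof.
move=> fi; elim: r => [|i r [ih1 ih2]].
  rewrite big_nil; split; last first.
    by under eq_Rintegral do rewrite big_nil; rewrite /Rintegral integral0.
  by under eq_fun do rewrite big_nil; exact: integrable0.
rewrite big_cons -ih2; split; last first.
  by under eq_Rintegral do rewrite big_cons; rewrite RintegralD.
under eq_fun do rewrite big_cons.
by apply: eq_integrable (integrableD _ (fi i) ih1) => // x _ /=; rewrite EFinD.
Qed.

Section Differentials.
Context (R : realType).
Implicit Types V W : normedModType R.

Lemma normed_nbhsP V (x : V) (P : V -> Prop) :
  (\forall y \near x, P y) <-> exists2 e : R, 0 < e & forall y, `|y - x| < e -> P y.
Proof.
split=> [/nbhs_normP[e /= e0 h]|[e e0 h]].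
  by exists e => // y yx; apply: h; rewrite /ball_ /= distrC.
by apply/nbhs_normP; exists e => // y; rewrite /ball_ /= distrC; exact: h.
Qed.

Lemma near_shift V (x : V) (P : V -> Prop) :
  (\forall y \near x, P (y - x)) <-> (\forall h \near (0 : V), P h).
Proof.
split=> /normed_nbhsP[e e0 h]; apply/normed_nbhsP; exists e => // y.
  by rewrite subr0 => ye; have := h (y + x); rewrite addrK; exact.
by move=> ye; apply: h; rewrite subr0.
Qed.

Lemma differentiable_epsP V W (f : V -> W) (x : V) : differentiable f x ->
  forall e : R, 0 < e -> \forall v \near x, `|f v - f x - 'd f x (v - x)| <= e * `|v - x|.
Proof.
move=> /diff_locallyP[_ /eqaddoP h] e e0.
have hx := (near_shift x (fun y => `|(f \o shift x - (cst (f x) + 'd f x)) y| <= e * `|y|)).2 (h _ e0).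
apply: filterS hx => v /=.
by rewrite /shift /= !fctE /= subrK opprD addrA.
Qed.

Lemma eps_differentiable V W (f : V -> W) (x : V) (df : {linear V -> W}) :
  continuous df ->
  (forall e : R, 0 < e -> \forall v \near x, `|f v - f x - df (v - x)| <= e * `|v - x|) ->
  differentiable f x /\ 'd f x = df :> (V -> W).
Proof.
move=> cdf h.
have H : f \o shift x = cst (f x) + df +o_ (0 : V) id.
  apply/eqaddoP => e e0; apply/near_shift.
  apply: filterS (h e e0) => v /=.
  by rewrite /shift /= !fctE /= subrK opprD addrA.
have E := diff_unique cdf H.
by split=> //; apply/diff_locallyP; rewrite E; split.
Qed.

Lemma eps_differentiable_fun V W (f : V -> W) (x : V) (df : V -> W) :
  linear df -> continuous df ->
  (forall e : R, 0 < e -> \forall v \near x, `|f v - f x - df (v - x)| <= e * `|v - x|) ->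
  differentiable f x /\ 'd f x = df :> (V -> W).
Proof.
move=> ldf; pose dfM := GRing.isLinear.Build _ _ _ _ _ ldf.
pose dfL : {linear _ -> _} := HB.pack df dfM.
exact: (@eps_differentiable _ _ f x dfL).
Qed.

Lemma near_eq_differentiable V W (f g : V -> W) (x : V) :
  (\forall v \near x, f v = g v) -> differentiable f x ->
  differentiable g x /\ 'd g x = 'd f x :> (V -> W).
Proof.
move=> fg df; apply: eps_differentiable; first exact: diff_continuous.
move=> e e0; have fgx := nbhs_singleton fg.
by apply: filterS2 fg (differentiable_epsP df e0) => v -> ; rewrite fgx.
Qed.

(** The mean value theorem in one variable applies along a segment, which stays
in the convex set. *)
Lemma mean_value_bound V (f : V -> R) (B : set V) (L : R) :
  (forall u v (t : R), B u -> B v -> 0 <= t <= 1 -> B (u + t *: (v - u))) ->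
  (forall u, B u -> differentiable f u) ->
  (forall u v w, B u -> B v -> B w -> `|'d f w (v - u)| <= L * `|v - u|) ->
  forall u v, B u -> B v -> `|f v - f u| <= L * `|v - u|.
Proof.
move=> Bconv fdiff dL u v Bu Bv.
pose g (t : R) := f (u + t *: (v - u)).
have dg (t : R) : 0 <= t <= 1 -> is_derive t (1 : R) g ('d f (u + t *: (v - u)) (v - u)).
  move=> t01.
  have Bt := Bconv _ _ _ Bu Bv t01.
  have h1 : is_diff t (fun s : R => s *: (v - u)) (fun s : R => s *: (v - u)).
    exact: is_diff_scalel.
  have h2 : is_diff t (fun s : R => u + s *: (v - u)) (fun s : R => s *: (v - u)).
    apply: is_diff_eq (is_diffD (is_diff_cst u t) h1) _.
    by apply/funext => s; rewrite !fctE add0r.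
  have h3 : is_diff t g ('d f (u + t *: (v - u)) \o (fun s : R => s *: (v - u))).
    apply: is_diff_comp; apply: DiffDef; first exact: fdiff.
    by [].
  apply: DeriveDef.
    by apply/derivable1_diffP; case: h3.
  rewrite deriveE; last by case: h3.
  by case: h3 => _ ->; rewrite /= scale1r.
have [|t|c c01] := @MVT R g (fun t => 'd f (u + t *: (v - u)) (v - u)) 0 1 ltr01.
- move=> t; rewrite in_itv /= => /andP[t0 t1]; apply: dg; by rewrite !ltW.
- apply: derivable_within_continuous => s; rewrite in_itv /= => t01.
  by have [] := dg s t01.
rewrite subr0 mulr1 /g scale1r scale0r addr0 [u + (v - u)]addrC subrK => ->.
move: c01; rewrite in_itv /= => /andP[c0 c1].
by apply: dL => //; apply: Bconv => //; rewrite !ltW.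
Qed.

Lemma mx_norm_leP m (w : 'rV[R]_m) (b : R) : 0 <= b ->
  (forall i, `|w 0 i| <= b) -> `|w| <= b.
Proof.
move=> b0 h; rewrite [`|w|]mx_normrE; apply: bigmax_le => // -[i j] _ /=.
by rewrite (ord1 i); exact: h.
Qed.

Lemma coord_le_norm m (w : 'rV[R]_m) i : `|w 0 i| <= `|w|.
Proof.
rewrite [`|w|]mx_normrE.
exact: (@le_bigmax _ _ _ 0 (fun ij : 'I_1 * 'I_m => `|w ij.1 ij.2|) (0, i)).
Qed.

(** Finite dimension, in the quantitative form used to bound linear maps by
their values on a basis. *)
Definition findim V := exists m (e : 'I_m -> V) (b : R), 0 <= b /\
  forall w, exists a : 'I_m -> R, w = \sum_i a i *: e i /\ forall i, `|a i| <= b * `|w|.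

Lemma findim_rV m : findim ('rV[R]_m).
Proof.
exists m, (fun i => delta_mx 0 i), 1; split => // w.
exists (fun i => w 0 i); split; first exact: row_sum_delta.
by move=> i; rewrite mul1r coord_le_norm.
Qed.

Lemma findim_R : findim R^o.
Proof.
exists 1, (fun=> 1), 1; split => // w; exists (fun=> w); rewrite big_ord1; split.
  by rewrite /GRing.scale /= mulr1.
by move=> _; rewrite mul1r.
Qed.

Lemma findim_prod V W : findim V -> findim W -> findim (V * W)%type.
Proof.
move=> [m [e [b [b0 h]]]] [m' [e' [b' [b'0 h']]]].
exists (m + m')%N, (fun i => match fintype.split i with inl j => (e j, 0) | inr j => (0, e' j) end).
exists (b + b'); split; first exact: addr_ge0.
move=> [v w]; have [a [av ab]] := h v; have [a' [aw ab']] := h' w.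
exists (fun i => match fintype.split i with inl j => a j | inr j => a' j end); split.
  rewrite big_split_ord /=.
  under eq_bigr do rewrite (unsplitK (inl _)).
  under [X in _ + X]eq_bigr do rewrite (unsplitK (inr _)).
  have -> : \sum_(i < m) a i *: ((e i, 0) : V * W) = (v, 0).
    rewrite {1}av; elim/big_rec2: _ => // i x y _ ->.
    by congr pair; rewrite /= scaler0 addr0.
  have -> : \sum_(i < m') a' i *: ((0, e' i) : V * W) = (0, w).
    rewrite {1}aw; elim/big_rec2: _ => // i x y _ ->.
    by congr pair; rewrite /= scaler0 addr0.
  by congr pair; rewrite /= ?addr0 ?add0r.
move=> i; rewrite prod_normE /=; case: fintype.split => j.
  rewrite (le_trans (ab j))// ler_pM// ?lerDl// le_max lexx//.
rewrite (le_trans (ab' j))// ler_pM// ?lerDr// le_max lexx orbT//.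
Qed.

Lemma differentiable_coordinate V m (f : V -> 'rV[R]_m) (x : V) i : differentiable f x ->
  differentiable (fun z => f z 0 i : R) x /\
  'd (fun z => f z 0 i : R) x = (fun h => ('d f x h) 0 i) :> (V -> R).
Proof.
move=> dfx.
have [] // := @eps_differentiable_fun V R (fun z => f z 0 i) x (fun h => ('d f x h) 0 i).
- by move=> a y z; rewrite linearP !mxE.
- move=> y; apply: (@continuous_comp _ _ _ ('d f x) (fun N : 'rV[R]_m => N 0 i)).
    exact: diff_continuous.
  exact: coord_continuous.
- move=> e e0; apply: filterS (differentiable_epsP dfx e0) => z; apply: le_trans.
  by have := coord_le_norm (f z - f x - 'd f x (z - x)) i; rewrite !mxE.
Qed.

(** On a small ball the differentials are bounded, because they are bounded on
the vectors of a basis. *)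
Lemma C1_locally_lipschitz V m (f : V -> 'rV[R]_m) (x : V) (S : set V) :
  findim V -> nbhs x S -> Ck 1 S f ->
  exists2 L : R, 0 <= L & \forall u & v \near x, `|f v - f u| <= L * `|v - u|.
Proof.
move=> [q [e [b [b0 he]]]] Sx [fd fc].
pose L0 (i : 'I_q) := `|'d f x (e i)| + 1.
have near_i (i : 'I_q) : \forall u \near x, `|'d f u (e i)| <= L0 i.
  have /= := fc (e i) x (nbhs_singleton Sx).
  move=> /cvgrPdist_le /(_ 1 ltr01); apply: filterS => u h.
  rewrite /L0 -[X in `|X| <= _](subrK ('d f x (e i))) addrC (le_trans (ler_normD _ _))//.
  by rewrite lerD2l distrC.
have near_all : \forall u \near x, forall i, `|'d f u (e i)| <= L0 i.
  exact: filter_forall.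
have /normed_nbhsP[r r0 hr] : \forall u \near x, S u /\ forall i, `|'d f u (e i)| <= L0 i.
  by near=> u; split; near: u.
pose B := [set u : V | `|u - x| < r].
have Bx : nbhs x B by apply/normed_nbhsP; exists r.
pose L := \sum_i b * L0 i.
have L00 i : 0 <= L0 i by rewrite addr_ge0.
have L_ge0 : 0 <= L by apply: sumr_ge0 => i _; rewrite mulr_ge0.
exists L => //.
have key u v : B u -> B v -> `|f v - f u| <= L * `|v - u|.
  move=> Bu Bv; apply: mx_norm_leP => [|i]; first by rewrite mulr_ge0.
  rewrite !mxE.
  have comp (w : V) : B w -> is_diff w (fun z => f z 0 i : R) (fun h => ('d f w h) 0 i).
    move=> Bw.
    have [Sw _] := hr w Bw; have [d1 d2] := differentiable_coordinate i (fd w Sw).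
    exact: DiffDef.
  apply: (@mean_value_bound _ (fun z => f z 0 i : R) B L) => //.
  - move=> y z t By Bz /andP[t0 t1]; rewrite /B /=.
    have -> : y + t *: (z - y) - x = (1 - t) *: (y - x) + t *: (z - x).
      rewrite addrAC (_ : z - y = (z - x) - (y - x)); last by rewrite opprB addrA subrK.
      by rewrite scalerBr scalerBl scale1r -[RHS]addrA [- _ + _]addrC.
    pose M := Num.max `|y - x| `|z - x|.
    have Mr : M < r by rewrite gt_max; apply/andP; split.
    apply: le_lt_trans Mr; rewrite (le_trans (ler_normD _ _))//.
    rewrite !normrZ !ger0_norm// ?subr_ge0//.
    rewrite -[leRHS]mul1r -[X in _ <= X * _](subrK t) [leRHS]mulrDl.
    by apply: lerD; apply: ler_wpM2l; rewrite ?subr_ge0// le_max lexx ?orbT.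
  - by move=> w Bw; case: (comp w Bw).
  - move=> y z w By Bz Bw; case: (comp w Bw) => _ ->.
    have [a [wa ab]] := he (z - y).
    rewrite (le_trans (coord_le_norm _ _))// wa linear_sum (le_trans (ler_norm_sum _ _ _))//.
    rewrite -wa mulr_suml ler_sum// => k _; rewrite linearZ normrZ.
    rewrite mulrAC ler_pM//.
    by have [_] := hr w Bw; exact.
by near=> u v; apply: key; [near: u|near: v].
Unshelve. all: by end_near. Qed.

(** Differentiation under the integral sign for the total differential: by
linearity it is enough to bound the remainders along sequences, where
dominated convergence applies. *)
Lemma differentiable_integral d (T : measurableType d) (mu : probability T R)
    m (f : 'rV[R]_m -> T -> R) (v0 : 'rV[R]_m) (L b : R) :
  0 <= L -> (forall v, measurable_fun setT (f v)) -> (forall v h, `|f v h| <= b) ->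
  (forall h, differentiable (f ^~ h) v0) ->
  (\forall v \near v0, forall h, `|f v h - f v0 h| <= L * `|v - v0|) ->
  differentiable (fun v => \int[mu]_h f v h) v0.
Proof.
move=> L0 mf fb fd fL.
have [r r0 hr] : exists2 r : R, 0 < r & forall v, `|v - v0| < r -> forall h, `|f v h - f v0 h| <= L * `|v - v0|.
  exact/normed_nbhsP.
pose t (n : nat) : R := r / 2 * n.+1%:R^-1.
have t0 n : 0 < t n by rewrite mulr_gt0// divr_gt0.
have tr n : t n < r.
  apply: (@le_lt_trans _ _ (r / 2)); last by lra.
  rewrite ler_piMr//; first by rewrite divr_ge0// ltW.
  by rewrite invf_le1// ler1n.
have tc : t n @[n --> \oo] --> (0 : R).
  by rewrite -(mulr0 (r / 2)); apply: cvgM; [exact: cvg_cst|exact: cvg_harmonic].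
pose D (i : 'I_m) (h : T) : R := 'd (f ^~ h) v0 (delta_mx 0 i).
have normd (i : 'I_m) : `|delta_mx 0 i : 'rV[R]_m| <= 1.
  apply: mx_norm_leP => // k; rewrite mxE eqxx /=; case: (_ == _); rewrite ?normr1//.
  by rewrite normr0.
have Dlim i h : (t n)^-1 * (f (v0 + t n *: delta_mx 0 i) h - f v0 h) @[n --> \oo] --> D i h.
  apply/cvgrPdist_le => e e0.
  have /normed_nbhsP[s s0 hs] := differentiable_epsP (fd h) e0.
  have : \forall n \near \oo, t n < s.
    by move/cvgrPdist_lt : tc => /(_ _ s0); apply: filterS => n; rewrite sub0r normrN gtr0_norm.
  apply: filterS => n tns.
  have tn : `|t n *: delta_mx 0 i : 'rV[R]_m| <= t n.
    by rewrite normrZ gtr0_norm// ler_piMr// ltW.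
  have := hs (v0 + t n *: delta_mx 0 i); rewrite addrC addKr.
  move=> /(_ (le_lt_trans tn tns)); rewrite linearZ /= -/(D i h) => H.
  have := le_trans H (ler_wpM2l (ltW e0) tn) => {}H.
  rewrite distrC -(ler_pM2l (t0 n)) -{1}(gtr0_norm (t0 n)) -normrM mulrBr mulVKf ?gt_eqF//.
  by rewrite [t n * e]mulrC; exact: H.
have Db i h : `|D i h| <= L.
  rewrite -(cvg_lim _ (cvg_norm (Dlim i h)))//; apply: limr_le.
    by apply/cvg_ex; eexists; exact: cvg_norm (Dlim i h).
  apply: nearW => n /=.
  have tn : `|t n *: delta_mx 0 i : 'rV[R]_m| <= t n.
    by rewrite normrZ gtr0_norm// ler_piMr// ltW.
  rewrite normrM normfV (gtr0_norm (t0 n)) ler_pdivrMl// [t n * L]mulrC.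
  have := hr (v0 + t n *: delta_mx 0 i); rewrite addrC addKr.
  by move=> /(_ (le_lt_trans tn (tr n)) h) /le_trans; apply; rewrite ler_wpM2l.
have mD i : measurable_fun setT (D i).
  apply: (@measurable_fun_cvg _ _ _ _ (fun n h => (t n)^-1 * (f (v0 + t n *: delta_mx 0 i) h - f v0 h))).
  - move=> n; apply: measurable_funM; first exact: measurable_cst.
    exact: measurable_funB.
  - by move=> h _; exact: Dlim.
have DE h v : 'd (f ^~ h) v0 v = \sum_i v 0 i * D i h.
  by rewrite {1}[v]row_sum_delta linear_sum; apply: eq_bigr => i _; rewrite linearZ.
have fi v : mu.-integrable setT (EFin \o f v).
  exact: bounded_integrable (mf v) (fb v).
have Di i : mu.-integrable setT (EFin \o D i).
  exact: bounded_integrable (mD i) (Db i).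
pose dF (v : 'rV[R]_m) : R := \sum_i v 0 i * \int[mu]_h D i h.
have [] // := @eps_differentiable_fun 'rV[R]_m R (fun v => \int[mu]_h f v h) v0 dF.
- move=> a v w; rewrite /dF scaler_sumr -big_split /=; apply: eq_bigr => i _.
  by rewrite !mxE mulrDl scalerAl.
- move=> v; apply: (@cvg_sum_seq R _ _ _ (nbhs v) _ (fun i w => w 0 i * _)) => i.
  by apply: (@cvgM _ _ (nbhs v)); [exact: coord_continuous|exact: cvg_cst].
move=> e e0; apply: contrapT => notnear.
have ex (n : nat) : exists v, `|v - v0| < t n /\
    e * `|v - v0| < `|\int[mu]_h f v h - \int[mu]_h f v0 h - dF (v - v0)|.
  apply: contrapT => nex; apply: notnear; apply/normed_nbhsP; exists (t n) => // v vt.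
  by rewrite leNgt; apply/negP => h; apply: nex; exists v.
have [v hv] := choice ex.
pose N n := `|v n - v0|.
have N0 n : 0 < N n.
  rewrite normr_gt0; apply/negP => /eqP vv0.
  have [_] := hv n; rewrite vv0 normr0 mulr0; move/eqP: vv0; rewrite subr_eq0 => /eqP ->.
  rewrite subrr sub0r normrN /dF big1 ?normr0 ?ltxx// => i _.
  by rewrite mxE mul0r.
pose q n h := (f (v n) h - f v0 h - 'd (f ^~ h) v0 (v n - v0)) / N n.
have mq n : measurable_fun setT (q n).
  apply: measurable_funM; last exact: measurable_cst.
  apply: measurable_funB; first exact: measurable_funB.
  under eq_fun do rewrite DE; apply: measurable_sum => i.
  by apply: measurable_funM => //; exact: measurable_cst.
have qb n h : `|q n h| <= L + m%:R * L.
  rewrite normrM normfV (gtr0_norm (N0 n)) ler_pdivrMr//.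
  rewrite (le_trans (ler_normB _ _))// mulrDl; apply: lerD.
    by apply: hr; have [/lt_trans h1 _] := hv n; exact: h1.
  rewrite DE (le_trans (ler_norm_sum _ _ _))//.
  apply: (@le_trans _ _ (\sum_(i < m) L * N n)).
    apply: ler_sum => i _; rewrite normrM mulrC ler_pM//.
    exact: coord_le_norm.
  by rewrite sumr_const card_ord -[(L * N n) *+ m]mulr_natl mulrA.
have [] := @dominated_convergence _ _ _ mu setT measurableT
  (fun n x => (q n x)%:E) (cst 0%E) (cst (L + m%:R * L)%:E).
- by move=> n; exact/measurable_EFinP.
- exact: measurable_cst.
- apply: filterE => h _; apply: cvg_EFin; first exact: nearW.
  apply/cvgrPdist_le => s s0.
  have /normed_nbhsP[w w0 hw] := differentiable_epsP (fd h) s0.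
  have : \forall n \near \oo, t n < w.
    by move/cvgrPdist_lt : tc => /(_ _ w0); apply: filterS => n; rewrite sub0r normrN gtr0_norm.
  apply: filterS => n tnw /=; rewrite sub0r normrN normrM normfV (gtr0_norm (N0 n)).
  rewrite ler_pdivrMr//; apply: hw; have [/lt_trans h1 _] := hv n; exact: h1.
- exact: finite_measure_integrable_cst.
- by apply: filterE => h n _; rewrite lee_fin.
move=> _ _; rewrite integral_cst// mul0e => /fine_cvg /cvgrPdist_lt /(_ _ e0) [n _ /(_ n (leqnn n))].
rewrite sub0r normrN -[X in `|X| < _]/(\int[mu]_h q n h).
have -> : \int[mu]_h q n h =
    (\int[mu]_h f (v n) h - \int[mu]_h f v0 h - dF (v n - v0)) / N n.
  have [di dE] := Rintegral_sum (index_enum 'I_m) (f := fun i h => (v n - v0) 0 i * D i h)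
    (fun i => integrableZl measurableT _ (Di i)).
  have ffi : mu.-integrable setT (EFin \o (fun h => f (v n) h - f v0 h)).
    by apply: eq_integrable (integrableB _ (fi (v n)) (fi v0)) => // h _ /=; rewrite EFinB.
  rewrite /q; under eq_Rintegral do rewrite DE.
  rewrite RintegralZr//; last first.
    by apply: eq_integrable (integrableB _ ffi di) => // h _ /=; rewrite EFinB.
  rewrite !RintegralB// dE; congr ((_ - _) / _).
  by apply: eq_bigr => i _; rewrite RintegralZl.
rewrite normrM normfV (gtr0_norm (N0 n)) ltr_pdivrMr//.
by have [_ /lt_trans h /h] := hv n; rewrite ltxx.
Qed.

End Differentials.

Section Charts.
Context (R : realType).
Implicit Types (E : normedModType R) (X : topologicalType).

(** The germ at [x] of a homeomorphism onto an open subset of the model space: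
all that is used of a chart in computations at one point. *)
Definition germ_chart E X (k : chart E X) (x : X) :=
  [/\ {for x, continuous (chart_fun k)},
      \forall y \near x, chart_inv k (chart_fun k y) = y,
      {for chart_fun k x, continuous (chart_inv k)} &
      \forall v \near chart_fun k x, chart_fun k (chart_inv k v) = v].

Definition lipschitz_at E E' X X' (k : chart E X) (k' : chart E' X')
    (f : X -> X') (x : X) :=
  {for x, continuous f} /\ exists2 L : R, 0 <= L &
  exists2 N, nbhs x N & forall y z, N y -> N z ->
    `|chart_fun k' (f y) - chart_fun k' (f z)| <= L * `|chart_fun k y - chart_fun k z|.

Definition diff_at E E' X X' (k : chart E X) (k' : chart E' X') (f : X -> X') (x : X) :=
  {for x, continuous f} /\
  differentiable (chart_fun k' \o f \o chart_inv k) (chart_fun k x).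

(** The Lipschitz bound near [x] dominates difference quotients where integrals
are differentiated; together with differentiability at the single point [x], it
is all the regularity that is needed, and both are stable under composition. *)
Definition smooth_at E E' X X' (k : chart E X) (k' : chart E' X') (f : X -> X') (x : X) :=
  lipschitz_at k k' f x /\ diff_at k k' f x.

Lemma is_chart_germ E X (k : chart E X) x : is_chart k -> chart_dom k x -> germ_chart k x.
Proof.
move=> [oD oI cf ci kK] Dx; split.
- by rewrite (continuous_open_subspace _ oD) in cf; apply: cf; rewrite inE.
- by apply: filterS (open_nbhs_nbhs (conj oD Dx)) => y; exact: kK.
- by rewrite (continuous_open_subspace _ oI) in ci; apply: ci; rewrite inE; exists x.
- have : nbhs (chart_fun k x) (chart_fun k @` chart_dom k).
    by apply: open_nbhs_nbhs; split=> //; exists x.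
  by apply: filterS => _ [y Dy <-]; rewrite kK.
Qed.

Lemma germ_chart_center E X (k : chart E X) x : germ_chart k x ->
  chart_inv k (chart_fun k x) = x.
Proof. by move=> [_ /nbhs_singleton]. Qed.

Lemma germ_chart_line (t : R) : germ_chart (line_atlas t) t.
Proof. by split; [exact: cvg_id|exact: filterE|exact: cvg_id|exact: filterE]. Qed.

Lemma germ_chart_prod E E' X X' (c : X -> chart E X) (c' : X' -> chart E' X') x x' :
  germ_chart (c x) x -> germ_chart (c' x') x' -> germ_chart (prod_atlas c c' (x, x')) (x, x').
Proof.
move=> [c1 k1 i1 j1] [c2 k2 i2 j2]; split.
- apply: cvg_pair => /=.
    by apply: (cvg_comp fst (chart_fun (c x)) _ c1); exact: cvg_fst.
  by apply: (cvg_comp snd (chart_fun (c' x')) _ c2); exact: cvg_snd.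
- near=> p; rewrite /=.
  have -> : chart_inv (c x) (chart_fun (c x) p.1) = p.1.
    by near: p; exact: near_fst k1.
  have -> : chart_inv (c' x') (chart_fun (c' x') p.2) = p.2.
    by near: p; exact: near_snd k2.
  by case: (p).
- apply: cvg_pair => /=.
    by apply: (cvg_comp fst (chart_inv (c x)) _ i1); exact: cvg_fst.
  by apply: (cvg_comp snd (chart_inv (c' x')) _ i2); exact: cvg_snd.
- near=> p; rewrite /=.
  have -> : chart_fun (c x) (chart_inv (c x) p.1) = p.1.
    by near: p; exact: near_fst j1.
  have -> : chart_fun (c' x') (chart_inv (c' x') p.2) = p.2.
    by near: p; exact: near_snd j2.
  by case: (p).
Unshelve. all: by end_near. Qed.

Section Composition.
Context E E' E'' X X' X'' (k : chart E X) (k' : chart E' X') (k'' : chart E'' X'').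

Lemma lipschitz_at_comp (f : X -> X') (g : X' -> X'') x :
  lipschitz_at k k' f x -> lipschitz_at k' k'' g (f x) -> lipschitz_at k k'' (g \o f) x.
Proof.
move=> [fc [L L0 [N Nx hf]]] [gc [L' L'0 [N' N'x hg]]]; split.
  exact: continuous_comp.
exists (L' * L); first exact: mulr_ge0.
exists (N `&` f @^-1` N'); first by apply: filterI => //; exact: fc.
move=> y z [Ny N'y] [Nz N'z]; rewrite -mulrA.
by rewrite (le_trans (hg _ _ N'y N'z))// ler_wpM2l// hf.
Qed.

Lemma diff_comp_near (f : X -> X') (g : X' -> X'') x : germ_chart k x -> germ_chart k' (f x) ->
  {for x, continuous f} ->
  \forall v \near chart_fun k x,
   ((chart_fun k'' \o g \o chart_inv k') \o (chart_fun k' \o f \o chart_inv k)) v =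
   (chart_fun k'' \o (g \o f) \o chart_inv k) v.
Proof.
move=> gk [_ k'K _ _] fc; have [_ _ ic _] := gk.
have := germ_chart_center gk => kx.
have H : nbhs (chart_inv k (chart_fun k x)) [set y | chart_inv k' (chart_fun k' (f y)) = f y].
  by rewrite kx; exact: (fc _ k'K).
by apply: filterS (near_continuous ic H) => v /= ->.
Qed.

(** Near [chart_fun k x] the expression of the composite in charts is the
composite of the expressions. *)
Lemma diff_at_comp (f : X -> X') (g : X' -> X'') x :
  germ_chart k x -> germ_chart k' (f x) ->
  diff_at k k' f x -> diff_at k' k'' g (f x) ->
  diff_at k k'' (g \o f) x /\
  'd (chart_fun k'' \o (g \o f) \o chart_inv k) (chart_fun k x) =
  'd (chart_fun k'' \o g \o chart_inv k') (chart_fun k' (f x)) \o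
  'd (chart_fun k' \o f \o chart_inv k) (chart_fun k x) :> (E -> E'').
Proof.
move=> gk gk' [fc fd] [gc gd].
have kx := germ_chart_center gk.
have e : (chart_fun k' \o f \o chart_inv k) (chart_fun k x) = chart_fun k' (f x).
  by rewrite /= kx.
have gd' : differentiable (chart_fun k'' \o g \o chart_inv k')
    ((chart_fun k' \o f \o chart_inv k) (chart_fun k x)) by rewrite e.
have cd := differentiable_comp fd gd'.
have [h1 h2] := near_eq_differentiable (diff_comp_near g gk gk' fc) cd.
split; first by split=> //; exact: continuous_comp.
by rewrite h2 (diff_comp fd gd') e.
Qed.

Lemma smooth_at_comp (f : X -> X') (g : X' -> X'') x :
  germ_chart k x -> germ_chart k' (f x) ->
  smooth_at k k' f x -> smooth_at k' k'' g (f x) -> smooth_at k k'' (g \o f) x.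
Proof.
move=> gk gk' [f1 f2] [g1 g2]; split; first exact: lipschitz_at_comp f1 g1.
by have [] := diff_at_comp gk gk' f2 g2.
Qed.

End Composition.

Lemma smooth_at_near_eq E E' X X' (k : chart E X) (k' : chart E' X') (f g : X -> X') x :
  germ_chart k x -> (\forall y \near x, f y = g y) -> smooth_at k k' f x -> smooth_at k k' g x.
Proof.
move=> gk fg [[fc [L L0 [N Nx hf]]] [_ fd]]; have [_ _ ic _] := gk.
have kx := germ_chart_center gk; have fgx := nbhs_singleton fg.
have gc : {for x, continuous g}.
  by rewrite /prop_for /continuous_at -fgx; apply: cvg_trans fc; exact: near_eq_cvg.
split; split=> //.
  exists L => //; exists (N `&` [set y | f y = g y]); first exact: filterI.
  by move=> y z [Ny <-] [Nz <-]; exact: hf.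
have [] // := @near_eq_differentiable R E E' _ (chart_fun k' \o g \o chart_inv k) (chart_fun k x) _ fd.
have H : \forall y \near chart_inv k (chart_fun k x), f y = g y by rewrite kx.
by apply: filterS (near_continuous ic H) => v /= ->.
Qed.

Lemma smooth_at_pair E E' E'' X X' X'' (k : chart E X) (c' : X' -> chart E' X')
    (c'' : X'' -> chart E'' X'') (f : X -> X') (g : X -> X'') x p :
  smooth_at k (c' p.1) f x -> smooth_at k (c'' p.2) g x ->
  smooth_at k (prod_atlas c' c'' p) (fun y => (f y, g y)) x.
Proof.
move=> [[fc [L L0 [N Nx hf]]] [_ fd]] [[gc [L' L'0 [N' N'x hg]]] [_ gd]]; split; split.
- exact: cvg_pair.
- exists (L + L'); first exact: addr_ge0.
  exists (N `&` N'); first exact: filterI.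
  move=> y z [Ny N'y] [Nz N'z]; rewrite prod_normE /= ge_max; apply/andP; split.
    by rewrite (le_trans (hf _ _ Ny Nz))// ler_wpM2r// lerDl.
  by rewrite (le_trans (hg _ _ N'y N'z))// ler_wpM2r// lerDr.
- exact: cvg_pair.
- exact: differentiable_pair fd gd.
Qed.

Lemma smooth_at_id E X (k : chart E X) x : germ_chart k x -> smooth_at k k (fun y => y) x.
Proof.
move=> gk; have [_ kK _ jK] := gk; split; split.
- exact: cvg_id.
- by exists 1 => //; exists setT; [exact: filterT|move=> y z _ _; rewrite mul1r].
- exact: cvg_id.
- have [] // := @near_eq_differentiable R E E id (chart_fun k \o (fun y => y) \o chart_inv k) (chart_fun k x).
  by apply: filterS jK => v /= ->.
Qed.

Lemma smooth_at_cst E E' X X' (k : chart E X) (k' : chart E' X') (a : X') x :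
  smooth_at k k' (fun=> a) x.
Proof.
split; split.
- exact: cvg_cst.
- exists 0 => //; exists setT; first exact: filterT.
  by move=> y z _ _; rewrite subrr normr0 mul0r.
- exact: cvg_cst.
- exact: differentiable_cst.
Qed.

Lemma smooth_at_fst E E' X X' (c : X -> chart E X) (c' : X' -> chart E' X') p x x' :
  germ_chart (c p.1) x -> smooth_at (prod_atlas c c' p) (c p.1) fst (x, x').
Proof.
move=> [_ kK _ jK]; split; split.
- exact: cvg_fst.
- exists 1 => //; exists setT; first exact: filterT.
  by move=> y z _ _; rewrite mul1r [leRHS]prod_normE /= le_max lexx.
- exact: cvg_fst.
- have [] // := @near_eq_differentiable R (E * E')%type E fst
    (chart_fun (c p.1) \o fst \o chart_inv (prod_atlas c c' p)) (chart_fun (prod_atlas c c' p) (x, x')).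
    have H : \forall v \near (chart_fun (c p.1) x, chart_fun (c' p.2) x'),
        chart_fun (c p.1) (chart_inv (c p.1) v.1) = v.1 by exact: near_fst jK.
    by apply: filterS H => v /= ->.
  apply: (@linear_differentiable _ _ _ fst) => v; exact: cvg_fst.
Qed.

Lemma smooth_at_snd E E' X X' (c : X -> chart E X) (c' : X' -> chart E' X') p x x' :
  germ_chart (c' p.2) x' -> smooth_at (prod_atlas c c' p) (c' p.2) snd (x, x').
Proof.
move=> [_ kK _ jK]; split; split.
- exact: cvg_snd.
- exists 1 => //; exists setT; first exact: filterT.
  by move=> y z _ _; rewrite mul1r [leRHS]prod_normE /= le_max lexx orbT.
- exact: cvg_snd.
- have [] // := @near_eq_differentiable R (E * E')%type E' snd
    (chart_fun (c' p.2) \o snd \o chart_inv (prod_atlas c c' p)) (chart_fun (prod_atlas c c' p) (x, x')).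
    have H : \forall v \near (chart_fun (c p.1) x, chart_fun (c' p.2) x'),
        chart_fun (c' p.2) (chart_inv (c' p.2) v.2) = v.2 by exact: near_snd jK.
    by apply: filterS H => v /= ->.
  apply: (@linear_differentiable _ _ _ snd) => v; exact: cvg_snd.
Qed.

Lemma C1_map_smooth_at E X X' m (c : X -> chart E X) (c' : X' -> chart 'rV[R]_m X')
    (f : X -> X') x y : findim E -> germ_chart (c x) x ->
  open (chart_dom (c x)) -> chart_dom (c x) x -> open (chart_dom (c' y)) ->
  (forall z, chart_dom (c x) z -> chart_inv (c x) (chart_fun (c x) z) = z) ->
  open (chart_fun (c x) @` chart_dom (c x)) ->
  Ck_map 1 c c' f -> chart_dom (c' y) (f x) -> smooth_at (c x) (c' y) f x.
Proof.
move=> fE [cx kK ic jK] oD Dx oD' kinv oI [fc fCk] Dfx.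
set S := chart_fun (c x) @` (chart_dom (c x) `&` f @^-1` chart_dom (c' y)).
have kx : chart_inv (c x) (chart_fun (c x) x) = x by exact: nbhs_singleton kK.
have Sx : nbhs (chart_fun (c x) x) S.
  near=> v.
  have [z Dz zv] : (chart_fun (c x) @` chart_dom (c x)) v.
    by near: v; apply: open_nbhs_nbhs; split => //; exists x.
  exists z => //; split=> //=.
  rewrite -(kinv z Dz) zv; near: v.
  apply: (ic (f @^-1` chart_dom (c' y))); rewrite kx; apply: fc.
  exact: open_nbhs_nbhs.
have CkS := fCk x y; rewrite -/S in CkS.
split; split; try exact: fc.
  have [L L0 HL] := C1_locally_lipschitz fE Sx CkS.
  exists L => //.
  have [[U V] [/= Ux Vx] UV] := HL.
  have Dnb : nbhs x (chart_dom (c x)) by exact: open_nbhs_nbhs.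
  exists (chart_dom (c x) `&` chart_fun (c x) @^-1` (U `&` V)).
    by apply: filterI => //; apply: cx; exact: filterI.
  move=> a b [Da [Ua Va]] [Db [Ub Vb]].
  have := UV (chart_fun (c x) b, chart_fun (c x) a) (conj Ub Va).
  by rewrite /= !kinv.
by have [h _] := CkS; apply: h; exact: nbhs_singleton.
Unshelve. all: by end_near. Qed.

End Charts.

(** * Products of atlases, uniform Lipschitz bounds and bump functions *)

Section RealSmooth.
Context (R : realType).
Implicit Types (E : normedModType R) (X : topologicalType).
Local Notation line := (line_atlas (0 : R)).

Lemma smooth_at_real_add E X (k : chart E X) (f g : X -> R) x :
  smooth_at k line f x -> smooth_at k line g x -> smooth_at k line (fun y => f y + g y) x.
Proof.
move=> [[fc [L L0 [N Nx hf]]] [_ fd]] [[gc [L' L'0 [N' N'x hg]]] [_ gd]]; split; split.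
- exact: cvgD.
- exists (L + L'); first exact: addr_ge0.
  exists (N `&` N'); first exact: filterI.
  move=> y z [Ny N'y] [Nz N'z] /=; rewrite opprD addrACA mulrDl.
  rewrite (le_trans (ler_normD _ _))//.
  by apply: lerD; [exact: hf|exact: hg].
- exact: cvgD.
- exact: (differentiableD fd gd).
Qed.

Lemma smooth_at_real_mul E X (k : chart E X) (f g : X -> R) x :
  smooth_at k line f x -> smooth_at k line g x -> smooth_at k line (fun y => f y * g y) x.
Proof.
move=> [[fc [L L0 [N Nx hf]]] [_ fd]] [[gc [L' L'0 [N' N'x hg]]] [_ gd]].
have near_bound (h : X -> R) : {for x, continuous h} -> \forall y \near x, `|h y| <= `|h x| + 1.
  move=> /cvgrPdist_le /(_ 1 ltr01); apply: filterS => y hy.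
  rewrite -[X in `|X| <= _](subrK (h x)) addrC (le_trans (ler_normD _ _))//.
  by rewrite lerD2l distrC.
have fb := near_bound _ fc; have gb := near_bound _ gc.
split; split.
- exact: cvgM.
- exists ((`|f x| + 1) * L' + (`|g x| + 1) * L).
    by rewrite addr_ge0// mulr_ge0// addr_ge0.
  exists ((N `&` N') `&` ([set y | `|f y| <= `|f x| + 1] `&` [set y | `|g y| <= `|g x| + 1])).
    by apply: filterI; exact: filterI.
  move=> y z [[Ny N'y] [by1 by2]] [[Nz N'z] [bz1 bz2]] /=.
  rewrite (_ : f y * g y - f z * g z = f y * (g y - g z) + g z * (f y - f z)); last by ring.
  rewrite (le_trans (ler_normD _ _))// mulrDl !normrM -!mulrA; apply: lerD.
    by apply: ler_pM => //; exact: hg.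
  by apply: ler_pM => //; exact: hf.
- exact: cvgM.
- exact: (differentiableM fd gd).
Qed.

Lemma smooth_at_real_sum E X (k : chart E X) I (r : seq I) (f : I -> X -> R) x :
  (forall i, smooth_at k line (f i) x) -> smooth_at k line (fun y => \sum_(i <- r) f i y) x.
Proof.
move=> h; elim: r => [|i r ih].
  by under eq_fun do rewrite big_nil; exact: smooth_at_cst.
by under eq_fun do rewrite big_cons; exact: smooth_at_real_add.
Qed.

Lemma smooth_at_coord n X (k : chart 'rV[R]_n X) y i : germ_chart k y ->
  smooth_at k line (fun z => chart_fun k z 0 i) y.
Proof.
move=> [cy kK ic jK].
have cs : {for y, continuous (fun z => chart_fun k z 0 i)}.
  apply: (cvg_comp (chart_fun k) (fun v : 'rV[R]_n => v 0 i) cy).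
  exact: coord_continuous.
split; split; try exact: cs.
  exists 1 => //; exists setT; first exact: filterT.
  move=> a b _ _ /=; rewrite mul1r.
  by have := coord_le_norm (chart_fun k a - chart_fun k b) i; rewrite !mxE.
have [] // := @near_eq_differentiable R _ R^o (fun v : 'rV[R]_n => v 0 i : R)
  (chart_fun line \o (fun z => chart_fun k z 0 i) \o chart_inv k) (chart_fun k y).
  by apply: filterS jK => v /= ->.
exact: differentiable_coord.
Qed.

(** Being of class C^1 and supported on a half line, this function makes bumps
without appeal to the exponential. *)
Definition pos_sq (s : R) := (Num.max 0 s) ^+ 2.

Lemma pos_sq_taylor (s v : R) :
  `|pos_sq v - pos_sq s - 2 * Num.max 0 s * (v - s)| <= (v - s) ^+ 2.
Proof.
rewrite /pos_sq /Num.max; case: ltP => hv; case: ltP => hs.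
- rewrite (_ : _ - _ - _ = (v - s) ^+ 2); last by ring.
  by rewrite ger0_norm// sqr_ge0.
- rewrite mulr0 mul0r expr0n !subr0 ger0_norm ?sqr_ge0//.
  by rewrite lerXn2r ?nnegrE; lra.
- rewrite (_ : _ - _ - _ = s * (s - 2 * v)); last by ring.
  rewrite ger0_norm; last by rewrite mulr_ge0; lra.
  by have := sqr_ge0 v; rewrite !expr2; lra.
- by rewrite mulr0 mul0r subrr subr0 normr0 sqr_ge0.
Qed.

Lemma smooth_at_pos_sq (s : R) : smooth_at (line_atlas s) line pos_sq s.
Proof.
have lip (a b : R) : `|pos_sq a - pos_sq b| <= (`|a| + `|b|) * `|a - b|.
  have h1 : `|Num.max 0 a - Num.max 0 b| <= `|a - b|.
    rewrite /Num.max; case: ltP => ha; case: ltP => hb //.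
    - by rewrite subr0 (gtr0_norm ha) (le_trans _ (ler_norm _))//; lra.
    - by rewrite sub0r normrN (gtr0_norm hb) distrC (le_trans _ (ler_norm _))//; lra.
    - by rewrite subrr normr0.
  have h2 (u : R) : `|Num.max 0 u| <= `|u|.
    by rewrite /Num.max; case: ltP => // _; rewrite normr0.
  rewrite /pos_sq subr_sqr normrM mulrC; apply: ler_pM => //.
  by rewrite (le_trans (ler_normD _ _))// lerD.
have bd (a : R) : `|a - s| < 1 -> `|a| <= `|s| + 1.
  move=> h; rewrite -[X in `|X|](subrK s) addrC (le_trans (ler_normD _ _))//.
  by rewrite lerD2l ltW.
have near1 : nbhs s [set a : R | `|a - s| < 1].
  by apply/(@normed_nbhsP R R^o); exists 1.
have sc : {for s, continuous pos_sq}.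
  apply/cvgrPdist_le => e e0; near=> a.
  have h1 : `|a - s| < 1 by near: a.
  have h2 : `|a - s| * (2 * (`|s| + 1)) <= e.
    rewrite -ler_pdivlMr; last by rewrite mulr_gt0// ltr_wpDl.
    near: a; apply/(@normed_nbhsP R R^o); exists (e / (2 * (`|s| + 1))).
      by rewrite divr_gt0// mulr_gt0// ltr_wpDl.
    by move=> y /ltW.
  rewrite (le_trans (lip _ _))// mulrC distrC (le_trans _ h2)// ler_wpM2l//.
  by have := bd _ h1; have := normr_ge0 s; lra.
have sd : differentiable (pos_sq : R^o -> R^o) s.
  pose df (h : R^o) : R^o := 2 * Num.max 0 s * h.
  have [] // := @eps_differentiable_fun R R^o R^o pos_sq s df.
  - by move=> a x y; rewrite /df /GRing.scale /=; ring.
  - by move=> x; apply: cvgM; [exact: cvg_cst|exact: cvg_id].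
  - move=> e e0; near=> v.
    have ve : `|v - s| <= e.
      near: v; apply/(@normed_nbhsP R R^o); exists e => // y; exact: ltW.
    rewrite (@le_trans _ _ ((v - s) ^+ 2))//; last first.
      by rewrite -real_normK ?num_real// expr2 ler_wpM2r.
    exact: pos_sq_taylor.
split; split => //.
exists (2 * (`|s| + 1)); first by rewrite mulr_ge0// addr_ge0.
exists [set a : R | `|a - s| < 1] => // a b ha hb /=.
rewrite (le_trans (lip _ _))// ler_wpM2r//.
by have := bd _ ha; have := bd _ hb; lra.
Unshelve. all: by end_near. Qed.

End RealSmooth.

Lemma open_prod (X Y : topologicalType) (A : set X) (B : set Y) :
  open A -> open B -> open (A `*` B).
Proof.
move=> oA oB; rewrite openE => -[a b] [/= Aa Bb].
by exists (A, B) => //; split; exact: open_nbhs_nbhs.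
Qed.

Section GoodAtlas.
Context (R : realType).
Implicit Types (E V : normedModType R) (X : topologicalType).

(** The properties of a single chart around each point; in this form they pass
to products. *)
Definition good_atlas E X (c : X -> chart E X) := forall x,
  [/\ germ_chart (c x) x, open (chart_dom (c x)), chart_dom (c x) x,
   forall y, chart_dom (c x) y -> chart_inv (c x) (chart_fun (c x) y) = y &
   open (chart_fun (c x) @` chart_dom (c x))].

Lemma manifold_good_atlas n X (c : X -> chart 'rV[R]_n X) : compact_manifold c -> good_atlas c.
Proof.
move=> [_ _ _ [ic Dx _]] x; have := ic x; move=> [oD oI cf ci kK].
by split => //; apply: is_chart_germ.
Qed.

Lemma line_good_atlas : good_atlas (@line_atlas R).
Proof.
move=> t; split => //.
- exact: germ_chart_line.
- exact: openT.
- by rewrite /= image_id; exact: openT.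
Qed.

Lemma prod_good_atlas E E' X X' (c : X -> chart E X) (c' : X' -> chart E' X') :
  good_atlas c -> good_atlas c' -> good_atlas (prod_atlas c c').
Proof.
move=> gc gc' [x x']; have [g1 o1 d1 k1 i1] := gc x; have [g2 o2 d2 k2 i2] := gc' x'.
split => //.
- exact: germ_chart_prod.
- exact: open_prod.
- by move=> [y y'] /= [Dy Dy']; rewrite k1// k2.
- rewrite (_ : _ @` _ = (chart_fun (c x) @` chart_dom (c x)) `*`
     (chart_fun (c' x') @` chart_dom (c' x'))); first exact: open_prod.
  apply/seteqP; split => [_ [[y y'] [/= Dy Dy'] <-]|[_ _] [/= [y Dy <-] [y' Dy' <-]]].
    by split; [exists y|exists y'].
  by exists (y, y').
Qed.

Lemma C1_map_smooth E X X' m (c : X -> chart E X) (c' : X' -> chart 'rV[R]_m X')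
    (f : X -> X') x y : findim E -> good_atlas c -> good_atlas c' ->
  Ck_map 1 c c' f -> chart_dom (c' y) (f x) -> smooth_at (c x) (c' y) f x.
Proof.
move=> fE gc gc' fC Dfx; have [g1 o1 d1 k1 i1] := gc x; have [_ o2 _ _ _] := gc' y.
exact: C1_map_smooth_at.
Qed.

(** Compactness of the parameter space makes local Lipschitz constants
uniform. *)
Lemma lipschitz_at_uniform V E E' X X' (v0 : V) (c0 : V -> chart V V) (c : X -> chart E X)
    (k' : chart E' X') (y : V * X -> X') :
  (forall v, chart_fun (c0 v) = id) -> compact [set: X] ->
  (forall p, lipschitz_at (prod_atlas c0 c (v0, p)) k' y (v0, p)) ->
  exists2 L : R, 0 <= L & \forall v & w \near v0, forall p,
    `|chart_fun k' (y (v, p)) - chart_fun k' (y (w, p))| <= L * `|v - w|.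
Proof.
move=> c0E cX lip.
have : \forall i \near filter_prod (pinfty_nbhs R) (filter_prod (nbhs v0) (nbhs v0)), [set: X] `<=`
  [set p | `|chart_fun k' (y (i.2.1, p)) - chart_fun k' (y (i.2.2, p))| <= i.1 * `|i.2.1 - i.2.2|].
  move/compact_near_coveringP : cX; apply.
  move=> p _; have [_ [L L0 [N [[A B] /= [Av Bp] AB] hN]]] := lip p.
  exists (B, [set i : R * (V * V) | L <= i.1 /\ A i.2.1 /\ A i.2.2]).
    split => //=; exists ([set l | L <= l], A `*` A); last by move=> [l [v w]] [? []].
    split => /=; first exact: (nbhs_pinfty_ge (num_real L)).
    by exists (A, A).
  move=> [q [l [v w]]] /= [Bq [Ll [Av' Aw']]].
  have := hN (v, q) (w, q) (AB (v, q) (conj Av' Bq)) (AB (w, q) (conj Aw' Bq)).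
  move=> /le_trans; apply; rewrite /= c0E.
  rewrite -[X in L * `|X|]/(v - w, chart_fun (c p) q - chart_fun (c p) q) subrr prod_normE /=.
  by rewrite normr0 (max_idPl _)// ler_wpM2r.
move=> [[A B] /= [[M [Mr hM]] Bv] AB].
pose L := Num.max 0 (M + 1).
exists L; first by rewrite le_max lexx.
apply: filterS Bv => v Bv p; apply: (AB (L, v)) => //; split => //=.
by apply: hM; rewrite lt_max ltrDl ltr01 orbT.
Qed.

Lemma diff_at_slice V E E' X X' (v0 : V) (c0 : V -> chart V V) (c : X -> chart E X)
    (k' : chart E' X') (y : V * X -> X') p :
  (forall v, chart_fun (c0 v) = id) -> (forall v, chart_inv (c0 v) = id) ->
  germ_chart (c p) p ->
  diff_at (prod_atlas c0 c (v0, p)) k' y (v0, p) ->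
  differentiable (fun v => chart_fun k' (y (v, p))) v0.
Proof.
move=> c0E c0I gp [_ yd]; have kp := germ_chart_center gp.
rewrite [X in differentiable _ X]/= c0E in yd.
have idd : differentiable (fun v : V => v) v0 by case: (is_diff_id v0).
have := @differentiable_comp R V (V * E)%type E' (fun v => (v, chart_fun (c p) p)) _ v0
  (differentiable_pair idd (@differentiable_cst _ _ _ _ v0)) yd.
by rewrite /comp /= c0I kp.
Qed.

End GoodAtlas.

Section Bump.
Context (R : realType) (n : nat) (X : topologicalType) (c : X -> chart 'rV[R]_n X).
Hypothesis hX : compact_manifold c.
Local Notation line := (line_atlas (0 : R)).

(** Transition maps are the local expressions of the identity. *)
Lemma smooth_at_transition x y : chart_dom (c x) y -> smooth_at (c y) (c x) (fun z => z) y.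
Proof.
move=> Dy; have gc := manifold_good_atlas hX; have [_ _ _ [_ _ tr]] := hX.
suff idC : Ck_map 1 c c (fun z => z).
  exact: (C1_map_smooth (findim_rV R n) gc gc idC (x := y) (y := x) Dy).
split; first by move=> z; exact: cvg_id.
by move=> z w; have := tr z w 1.
Qed.

Definition sq_dist (v w : 'rV[R]_n) : R := \sum_i (v 0 i - w 0 i) ^+ 2.

Lemma smooth_at_sq_dist x y w : chart_dom (c x) y ->
  smooth_at (c x) line (fun z => sq_dist (chart_fun (c x) z) w) y.
Proof.
move=> Dy; have gy : germ_chart (c x) y.
  by have [_ _ _ [ic _ _]] := hX; exact: is_chart_germ.
have coord i := smooth_at_coord i gy.
apply: smooth_at_real_sum => i.
under eq_fun do rewrite expr2.
apply: smooth_at_real_mul; apply: smooth_at_real_add => //; exact: smooth_at_cst.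
Qed.

Lemma sq_dist_ge0 v w : 0 <= sq_dist v w.
Proof. by apply: sumr_ge0 => i _; exact: sqr_ge0. Qed.

Lemma sq_dist_bound v w (e : R) : 0 <= e -> sq_dist v w <= e ^+ 2 -> `|v - w| <= e.
Proof.
move=> e0 h; apply: mx_norm_leP => // i; rewrite !mxE.
rewrite -(@ler_pXn2r _ 2)// ?nnegrE// real_normK ?num_real//.
apply: le_trans h; rewrite /sq_dist (bigD1 i)//= lerDl.
by apply: sumr_ge0 => k _; exact: sqr_ge0.
Qed.

Lemma sq_dist_continuous w : continuous (fun v => sq_dist v w).
Proof.
move=> v; apply: (@cvg_sum_seq R _ _ _ (nbhs v) _ (fun i u => (u 0 i - w 0 i) ^+ 2)) => i.
under eq_fun do rewrite expr2; rewrite expr2.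
by apply: (@cvgM _ _ (nbhs v)); apply: (@cvgB _ _ _ (nbhs v));
  solve [exact: coord_continuous|exact: cvg_cst].
Qed.

(** The bump is the squared positive part of [r] minus the squared Euclidean
distance in a chart; its support is closed as the image of a compact ball. *)
Lemma bump_function (x0 : X) (W : set X) : nbhs x0 W -> exists rho : X -> R,
  [/\ forall y, smooth_at (c y) line rho y, forall y, 0 <= rho y <= 1,
      0 < rho x0 & forall y, ~ W y -> rho y = 0].
Proof.
move=> Wx; have gc := manifold_good_atlas hX; have [g1 o1 d1 k1 i1] := gc x0.
have [_ hausX _ [ic _ _]] := hX.
set w := chart_fun (c x0) x0.
have [cx kK icx jK] := g1.
have inv0 : chart_inv (c x0) w = x0 := germ_chart_center g1.
have [e [e0 e1] he] : exists2 e : R, 0 < e /\ e <= 1 & forall v, `|v - w| <= e ->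
    (chart_fun (c x0) @` chart_dom (c x0)) v /\ W (chart_inv (c x0) v).
  have : \forall v \near w, (chart_fun (c x0) @` chart_dom (c x0)) v /\ W (chart_inv (c x0) v).
    apply: filterI; first by apply: open_nbhs_nbhs; split => //; exists x0.
    by apply: icx; rewrite inv0.
  move=> /normed_nbhsP[e e0 he]; exists (Num.min (e / 2) 1).
    split; first by rewrite lt_min divr_gt0//= ltr01.
    by rewrite ge_min lexx orbT.
  move=> v hv; apply: he; apply: (le_lt_trans hv); rewrite gt_min; apply/orP; left; lra.
pose r := e ^+ 2.
have r0 : 0 < r by rewrite exprn_gt0.
pose rho y : R := if `[< chart_dom (c x0) y >] then pos_sq (r - sq_dist (chart_fun (c x0) y) w) else 0.
pose K := chart_inv (c x0) @` [set v | sq_dist v w <= r].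
have Kin v : sq_dist v w <= r -> exists z, [/\ chart_dom (c x0) z, chart_fun (c x0) z = v & W z].
  move=> vr; have /he[[z Dz zv] Wz] : `|v - w| <= e by apply: sq_dist_bound; rewrite // ltW.
  by exists z; split => //; move: Wz; rewrite -zv k1.
have clK : closed K.
  apply: compact_closed => //; apply: continuous_compact.
    apply: continuous_in_subspaceT => v; rewrite inE /= => /Kin[z [Dz zv Wz]].
    have [_ _ icz _] : germ_chart (c x0) z by exact: is_chart_germ.
    by rewrite -zv; exact: icz.
  apply: bounded_closed_compact.
    exists (`|w| + e); split; first exact: num_real.
    move=> M hM v /= vr; have vwe : `|v - w| <= e by apply: sq_dist_bound; rewrite // ltW.
    rewrite -(subrK w v) (le_trans (ler_normD _ _))// addrC (le_trans _ (ltW hM))//.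
    by rewrite lerD2l.
  rewrite (_ : [set _ | _] = (fun v => sq_dist v w) @^-1` [set x | x <= r])//.
  by apply: closed_comp; [move=> v _; exact: sq_dist_continuous|exact: closed_le].
have rho0 y : ~ K y -> rho y = 0.
  move=> nK; rewrite /rho; case: asboolP => // Dy; rewrite /pos_sq.
  rewrite (max_idPl _) ?expr0n// subr_le0 leNgt; apply/negP => h; apply: nK.
  by exists (chart_fun (c x0) y); [exact: ltW|exact: k1].
exists rho; split.
- move=> y; have [gy _ _ _ _] := gc y.
  have [Dy|nDy] := pselect (chart_dom (c x0) y); last first.
    have nKy : ~ K y by move=> [v /Kin[z [Dz zv _]] vy]; apply: nDy; rewrite -vy -zv k1.
    apply: (smooth_at_near_eq gy _ (smooth_at_cst _ _ 0 y)).
    have : nbhs y (~` K) by apply: open_nbhs_nbhs; split => //; exact: closed_openC.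
    by apply: filterS => z nKz; rewrite rho0.
  have gxy : germ_chart (c x0) y by exact: is_chart_germ.
  have dist_smooth : smooth_at (c x0) line (fun z => r - sq_dist (chart_fun (c x0) z) w) y.
    apply: smooth_at_real_add; first exact: smooth_at_cst.
    under eq_fun do rewrite -mulN1r.
    by apply: smooth_at_real_mul; [exact: smooth_at_cst|exact: smooth_at_sq_dist].
  have bump_smooth := smooth_at_comp gxy (germ_chart_line _) dist_smooth (smooth_at_pos_sq _).
  have := smooth_at_comp gy gxy (smooth_at_transition Dy) bump_smooth.
  apply: smooth_at_near_eq => //.
  have : nbhs y (chart_dom (c x0)) by exact: open_nbhs_nbhs.
  by apply: filterS => z Dz; rewrite /rho asboolT.
- move=> y; rewrite /rho; case: asboolP => _; last by rewrite lexx ler01.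
  rewrite /pos_sq sqr_ge0 /= expr_le1// ?le_max ?lexx// ge_max ler01/=.
  have := sq_dist_ge0 (chart_fun (c x0) y) w.
  have : r <= 1 by rewrite /r expr_le1// ltW.
  lra.
- rewrite /rho asboolT// -/w /pos_sq (_ : sq_dist w w = 0); last first.
    by rewrite /sq_dist big1// => i _; rewrite subrr expr0n.
  by rewrite subr0 exprn_gt0// lt_max r0 orbT.
- by move=> y nW; apply: rho0 => -[v /Kin[z [Dz zv Wz]] vy]; apply: nW; rewrite -vy -zv k1.
Qed.

End Bump.

(** * Differentiability of representations *)

Lemma Re_realM (R : realType) (x : R) (z : R[i]) :
  complex.Re (Complex x 0 * z) = x * complex.Re z.
Proof. by rewrite cReM /= mul0r subr0. Qed.

Lemma Im_realM (R : realType) (x : R) (z : R[i]) :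
  complex.Im (Complex x 0 * z) = x * complex.Im z.
Proof. by rewrite cImM /= mul0r addr0. Qed.

Section UnitaryRep.
Variables (R : realType) (G : ptopologicalGroupType) (d : nat) (Pi : G -> 'M[R[i]]_d).
Hypothesis hPi : unitary_rep Pi.

Lemma rep1 : Pi 1%g = 1%:M. Proof. by case: hPi. Qed.
Lemma repM g h : Pi (g * h)%g = Pi g *m Pi h. Proof. by case: hPi. Qed.
Lemma repU g : Pi g *m (Pi g)^t* = 1%:M.
Proof. by apply/unitarymxP; case: hPi. Qed.
Lemma repUV g : (Pi g)^t* *m Pi g = 1%:M.
Proof. exact: mulmx1C (repU g). Qed.
Lemma repV g : Pi (g^-1)%g = (Pi g)^t*.
Proof.
have := repM g g^-1%g; rewrite mulgV rep1 => /(congr1 (fun M => (Pi g)^t* *m M)).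
by rewrite mulmx1 mulmxA repUV mul1mx.
Qed.

Lemma unitary_entry (M : 'M[R[i]]_d) k l : M *m M^t* = 1%:M -> Normc.normc (M k l) <= 1.
Proof.
move=> /(congr1 (fun N : 'M[R[i]]_d => complex.Re (N k k))); rewrite !mxE eqxx Re_sum /= => h.
rewrite -(@ler_pXn2r _ 2)// ?nnegrE ?normc_ge0// expr1n sqr_normcE -h.
rewrite (bigD1 l)//= !mxE /= !reimE mulrN opprK -!expr2 lerDl.
apply: sumr_ge0 => j _; rewrite !mxE /= !reimE mulrN opprK -!expr2.
by rewrite addr_ge0// sqr_ge0.
Qed.

Lemma rep_entry g k l : Normc.normc (Pi g k l) <= 1.
Proof. exact: unitary_entry (repU g). Qed.

Lemma rep_Re_le g k l : `|complex.Re (Pi g k l)| <= 1.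
Proof. exact: le_trans (Re_le_normc _) (rep_entry g k l). Qed.
Lemma rep_Im_le g k l : `|complex.Im (Pi g k l)| <= 1.
Proof. exact: le_trans (Im_le_normc _) (rep_entry g k l). Qed.

Lemma rep_continuous k l :
  continuous (fun g => complex.Re (Pi g k l)) /\ continuous (fun g => complex.Im (Pi g k l)).
Proof.
have [_ _ _ cP] := hPi.
suff h g : complex.Re (Pi h k l) @[h --> g] --> complex.Re (Pi g k l) /\
  complex.Im (Pi h k l) @[h --> g] --> complex.Im (Pi g k l).
  by split=> g; have [] := h g.
have /cvgC_normc/normc_cvg0[h1 h2] := cP k l g.
split; apply: cvg_sub_cst.
  by apply: cvg_trans h1; apply: near_eq_cvg; apply: filterE => h; rewrite !reimE.
by apply: cvg_trans h2; apply: near_eq_cvg; apply: filterE => h; rewrite !reimE.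
Qed.

Lemma rep_cmeas k l : cmeas (T := borel G) (fun g => Pi g k l).
Proof.
by split; apply: continuous_borelR; have [] := rep_continuous k l.
Qed.

End UnitaryRep.

Section LieGroupSmooth.
Variables (R : realType) (m : nat) (G : ptopologicalGroupType) (cG : G -> chart 'rV[R]_m G).
Hypothesis hG : compact_lie_group cG.

Let gG : good_atlas cG.
Proof. by have [hm _ _] := hG; exact: manifold_good_atlas hm. Qed.

Lemma group_mulc : continuous (fun p : G * G => (p.1 * p.2)%g).
Proof. by have [_ /(_ 1)[] ] := hG. Qed.
Lemma group_invc : continuous (fun g : G => (g^-1)%g).
Proof. by have [_ _ /(_ 1)[] ] := hG. Qed.
Lemma group_2nd : @second_countable G.
Proof. by have [[]] := hG. Qed.
Lemma group_compact : compact [set: G].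
Proof. by have [[]] := hG. Qed.
Lemma group_germ g : germ_chart (cG g) g.
Proof. by have [] := gG g. Qed.
Lemma group_dom g : chart_dom (cG g) g.
Proof. by have [] := gG g. Qed.

Section Maps.
Variables (E : normedModType R) (X : topologicalType) (k : chart E X) (x : X).
Hypothesis gk : germ_chart k x.

Lemma smooth_at_mulg (f g : X -> G) y :
  smooth_at k (cG (f x)) f x -> smooth_at k (cG (g x)) g x ->
  chart_dom (cG y) (f x * g x)%g -> smooth_at k (cG y) (fun z => (f z * g z)%g) x.
Proof.
move=> fs gs Dy; have [_ mC _] := hG.
have ms := C1_map_smooth (findim_prod (findim_rV R m) (findim_rV R m))
  (prod_good_atlas gG gG) gG (mC 1) (x := (f x, g x)) (y := y) Dy.
apply: (smooth_at_comp gk _ (smooth_at_pair (p := (f x, g x)) fs gs) ms).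
exact: germ_chart_prod (group_germ _) (group_germ _).
Qed.

Lemma smooth_at_invg (f : X -> G) y :
  smooth_at k (cG (f x)) f x -> chart_dom (cG y) (f x)^-1%g ->
  smooth_at k (cG y) (fun z => (f z)^-1%g) x.
Proof.
move=> fs Dy; have [_ _ iC] := hG.
have is_ := C1_map_smooth (findim_rV R m) gG gG (iC 1) (x := f x) (y := y) Dy.
exact: (smooth_at_comp gk (group_germ _) fs is_).
Qed.

End Maps.

Lemma smooth_at_chart_inv (E : normedModType R) (X : topologicalType) (k : chart E X) (c0 : E -> chart E E) x : germ_chart k x ->
  (forall v, chart_fun (c0 v) = id) -> (forall v, chart_inv (c0 v) = id) ->
  smooth_at (c0 (chart_fun k x)) k (chart_inv k) (chart_fun k x).
Proof.
move=> [_ kK ic jK] c0E c0I; split; split; try exact: ic.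
  exists 1 => //; exists [set v | chart_fun k (chart_inv k v) = v]; first exact: jK.
  by move=> v w /= -> ->; rewrite c0E mul1r.
rewrite c0E c0I.
have [] // := @near_eq_differentiable R E E id (chart_fun k \o chart_inv k \o id) (chart_fun k x).
by apply: filterS jK => v /= ->.
Qed.

Section Differentiability.
Variables (muG : probability (borel G) R) (hmuG : haar muG).
Variables (d : nat) (Pi : G -> 'M[R[i]]_d).
Hypothesis hPi : unitary_rep Pi.
Local Notation line := (line_atlas (0 : R)).
Local Notation e := (1%g : G).
Local Notation kappa := (chart_fun (cG e)).
Local Notation kinv := (chart_inv (cG e)).
Local Notation v0 := (kappa e).
Let idc (v : 'rV[R]_m) : chart 'rV[R]_m 'rV[R]_m := Chart setT id id.

Lemma near1_translate (rho : G -> R) h : (forall g, smooth_at (cG g) line rho g) ->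
  smooth_at (prod_atlas idc cG (v0, h)) line (fun p => rho ((kinv p.1)^-1 * p.2)%g) (v0, h).
Proof.
move=> rs; have ge := group_germ e.
have kv0 : kinv v0 = e := germ_chart_center ge.
have gi : germ_chart (idc v0) v0.
  by split; [exact: cvg_id|exact: filterE|exact: cvg_id|exact: filterE].
have gp : germ_chart (prod_atlas idc cG (v0, h)) (v0, h).
  exact: germ_chart_prod gi (group_germ h).
have s1 : smooth_at (prod_atlas idc cG (v0, h)) (cG e) (fun p => kinv p.1) (v0, h).
  apply: (smooth_at_comp (k' := idc v0) (f := fst) (g := kinv) gp gi).
    exact: smooth_at_fst.
  exact: (smooth_at_chart_inv (c0 := idc) ge).
have s2 : smooth_at (prod_atlas idc cG (v0, h)) (cG h) snd (v0, h).
  exact: (@smooth_at_snd _ _ _ _ _ idc cG (v0, h) v0 h (group_germ h)).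
have s3 : smooth_at (prod_atlas idc cG (v0, h)) (cG (kinv v0)^-1%g) (fun p => (kinv p.1)^-1%g) (v0, h).
  apply: (smooth_at_invg (f := fun p => kinv p.1) gp) => /=; last exact: group_dom.
  by rewrite kv0.
have s4 := smooth_at_mulg gp (f := fun p => (kinv p.1)^-1%g) (g := snd) s3 s2 (group_dom _).
exact: (smooth_at_comp gp (group_germ _) s4 (rs _)).
Qed.

(** Only the bump depends on [g], so the integrand is as regular as [rho] even
if [f] is merely measurable. *)
Lemma translate_average_smooth (rho : G -> R) (f : G -> R) :
  (forall g, smooth_at (cG g) line rho g) -> (forall g, 0 <= rho g <= 1) ->
  measurable_fun setT (f : borel G -> R) -> (forall g, `|f g| <= 1) ->
  smooth_at (cG e) line (fun g : G => \int[muG]_h (rho ((g : G)^-1 * h)%g * f h)) e.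
Proof.
move=> rs r01 mf f1; have ge := group_germ e.
have kv0 : kinv v0 = e := germ_chart_center ge.
have rc : continuous rho by move=> g; have [[]] := rs g.
have mrho (g : G) : measurable_fun setT (fun h : borel G => rho (g * h)%g * f h).
  apply: measurable_funM => //; apply: continuous_borelR => h.
  apply: (@continuous_comp _ _ _ (fun h => (g * h)%g) rho); last exact: rc.
  exact: (continuous_mulg group_mulc (@cst_continuousG _ _ g) (@id_continuousG _)).
have brho (g : G) h : `|rho (g * h)%g * f h| <= 1.
  have /andP[r0 r1] := r01 (g * h)%g.
  by rewrite normrM ger0_norm// mulr_ile1.
have int_rho (g : G) : muG.-integrable setT (EFin \o (fun h : borel G => rho (g * h)%g * f h)).
  exact: bounded_integrable (mrho g) (brho g).
have [L L0 lip] := @lipschitz_at_uniform R 'rV[R]_m _ _ _ _ v0 idc cG line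
  (fun p => rho ((kinv p.1)^-1 * p.2)%g) (fun=> erefl) group_compact
  (fun h => (near1_translate h rs).1).
have diff_f : differentiable (fun v => \int[muG]_h (rho ((kinv v)^-1 * h)%g * f h)) v0.
  apply: (@differentiable_integral _ _ _ _ _ _ _ L 1) => //.
  - move=> h; apply: differentiableM; last exact: differentiable_cst.
    have [_ ds] := near1_translate h rs.
    have := @diff_at_slice R 'rV[R]_m 'rV[R]_m R^o G R v0 idc cG line
      (fun p => rho ((kinv p.1)^-1 * p.2)%g) h (fun=> erefl) (fun=> erefl) (group_germ h) ds.
    exact.
  - have : \forall v \near v0, forall p, `|rho ((kinv v)^-1 * p)%g - rho ((kinv v0)^-1 * p)%g| <= L * `|v - v0|.
      have [[A B] /= [Av Bv] AB] := lip; apply: filterS Av => v Av.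
      exact: (AB (v, v0) (conj Av (nbhs_singleton Bv))).
    apply: filterS => v hv h; rewrite -mulrBl normrM.
    by rewrite -[leRHS]mulr1; apply: ler_pM => //; exact: hv.
have lipG : exists2 N, nbhs e N & forall g g', N g -> N g' ->
  `|\int[muG]_h (rho ((g : G)^-1 * h)%g * f h) - \int[muG]_h (rho ((g' : G)^-1 * h)%g * f h)| <=
    L * `|kappa g - kappa g'|.
  have [cx kK _ _] := ge; have [[A B] /= [Av Bv] AB] := lip.
  exists ([set g | kinv (kappa g) = g] `&` kappa @^-1` (A `&` B)).
    by apply: filterI => //; apply: cx; exact: filterI.
  move=> g g' [kg [Ag _]] [kg' [_ Bg']].
  rewrite -RintegralB//.
  rewrite (le_trans (le_normr_Rintegral _ _))//.
    by apply: eq_integrable (integrableB _ (int_rho _) (int_rho _)) => // h _ /=; rewrite EFinB.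
  have -> : L * `|kappa g - kappa g'| = \int[muG]_h (L * `|kappa g - kappa g'|).
    by rewrite Rintegral_cst// [X in fine X]probability_setT mulr1.
  apply: le_Rintegral => //.
  - apply: (@bounded_integrable _ _ _ _ _ 2).
      apply: measurableT_comp => //.
      by apply: measurable_funB; exact: mrho.
    by move=> h; rewrite normr_id (le_trans (ler_normB _ _))//; have := brho g^-1%g h; have := brho g'^-1%g h; lra.
  - exact: finite_measure_integrable_cst.
  - move=> h _; rewrite -mulrBl normrM -[leRHS]mulr1; apply: ler_pM => //.
    by have := AB (kappa g, kappa g') (conj Ag Bg') h; rewrite /= kg kg'.
have cf : {for e, continuous (fun g : G => \int[muG]_h (rho ((g : G)^-1 * h)%g * f h))}.
  have [cx kK _ _] := ge; have [N Ne hN] := lipG.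
  have L1 : 0 < L + 1 by rewrite ltr_wpDl.
  have /cvgrPdist_le hk := cx.
  apply/cvgrPdist_le => s s0.
  have Nee := nbhs_singleton Ne.
  apply: filterS2 Ne (hk (s / (L + 1)) (divr_gt0 s0 L1)) => g Ng kg.
  rewrite (le_trans (hN _ _ Nee Ng))//.
  rewrite (le_trans (ler_wpM2l L0 kg))// mulrA ler_pdivrMr// mulrC ler_wpM2l ?ltW//.
  by rewrite ltrDl.
by split; split => //; exists L.
Qed.

(** Let [A] be the integral of [rho h *: Pi h] for a bump [rho] near the
identity. It is invertible because [Pi] is close to the identity matrix on the
support of [rho], and by left invariance [Pi g *m A] is an integral in which [g]
moves only the bump. *)
Lemma rep_smooth k l : smooth_at (cG e) line (fun g => complex.Re (Pi g k l)) e /\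
  smooth_at (cG e) line (fun g => complex.Im (Pi g k l)) e.
Proof.
have d0 : (0 < d)%N by case: (d) (k) => // -[].
have dR : 0 < d%:R :> R by rewrite ltr0n.
(* this margin leaves the matrix [A] below, divided by the mass of the bump,
   with entries at distance at most 1 / (2 d) from those of the identity, so
   that it is diagonally dominant *)
pose eta : R := (4 * d%:R)^-1.
have eta0 : 0 < eta by rewrite invr_gt0 mulr_gt0.
have We : nbhs e [set g | forall a b : 'I_d, `|complex.Re (Pi g a b - Pi e a b)| <= eta /\
    `|complex.Im (Pi g a b - Pi e a b)| <= eta].
  apply: filter_forall => a; apply: filter_forall => b.
  have [cr ci] := rep_continuous hPi a b.
  have /cvgrPdist_le h1 := cr e; have /cvgrPdist_le h2 := ci e.
  apply: filterS2 (h1 _ eta0) (h2 _ eta0) => g; rewrite !reimE => ? ?.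
  by rewrite distrC [X in _ /\ X <= _]distrC.
have [hm _ _] := hG.
have [rho [rs r01 r0 rW]] := bump_function hm We.
have rc : continuous rho by move=> g; have [[]] := rs g.
have mr : measurable_fun setT (rho : borel G -> R) by exact: continuous_borelR.
have ri : muG.-integrable setT (EFin \o (rho : borel G -> R)).
  by apply: (@bounded_integrable _ (borel G) R muG (rho : borel G -> R) 1 mr) => g; have /andP[? ?] := r01 g; rewrite ger0_norm.
pose c := \int[muG]_h rho h.
have c0 : 0 < c.
  pose U := rho @^-1` [set x | rho e / 2 < x].
  have oU : open U by move/continuousP : rc; apply; exact: open_gt.
  have Ue : U e by rewrite /U /=; lra.
  have muU := haar_open_gt0 group_mulc hmuG group_compact oU Ue.
  have mU : measurable (U : set (borel G)) by exact: open_borel.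
  apply: (@lt_le_trans _ _ (rho e / 2 * fine (muG U))).
    rewrite mulr_gt0 ?divr_gt0// fine_gt0// muU /=.
    by rewrite (le_lt_trans (probability_le1 _ _))// ltry.
  have -> : rho e / 2 * fine (muG U) = \int[muG]_h (rho e / 2 * \1_U (h : borel G)).
    rewrite RintegralZl//; last first.
      apply: (@bounded_integrable _ _ _ _ _ 1) => //.
      by move=> h; rewrite indicE; case: (_ \in _); rewrite ?normr1 ?normr0.
    by rewrite /Rintegral integral_indic// setIT.
  apply: le_Rintegral => //.
    apply: (integrableZl measurableT (rho e / 2) (f := fun h => (\1_U (h : borel G))%:E)).
    apply: (@bounded_integrable _ _ _ _ _ 1) => //.
    by move=> h; rewrite indicE; case: (_ \in _); rewrite ?normr1 ?normr0.
  move=> h _; rewrite indicE; case: (boolP (h \in U)); last by rewrite mulr0; have /andP[] := r01 h.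
  by rewrite inE /U /= mulr1 => /ltW.
have Pm a b := rep_cmeas hPi a b.
have rPi (a b : 'I_d) : muG.-integrable setT (EFin \o (fun h : borel G => rho h * complex.Re (Pi h a b))) /\
    muG.-integrable setT (EFin \o (fun h : borel G => rho h * complex.Im (Pi h a b))).
  have [m1 m2] := Pm a b.
  split; (apply: (@bounded_integrable _ _ _ _ _ 1); first exact: measurable_funM);
    move=> h; have /andP[? ?] := r01 h; rewrite normrM ger0_norm// mulr_ile1//.
    exact: rep_Re_le.
  exact: rep_Im_le.
pose A : 'M[R[i]]_d := \matrix_(a, b) Complex (\int[muG]_h (rho h * complex.Re (Pi h a b)))
  (\int[muG]_h (rho h * complex.Im (Pi h a b))).
have Abound (a b : 'I_d) : Normc.normc (A a b - Complex (c * (a == b)%:R) 0) <= c / (2 * d%:R).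
  have key (f : G -> R) (z : R) : muG.-integrable setT (EFin \o (fun h : borel G => rho h * f h)) ->
      (forall h, rho h = 0 \/ `|f h - z| <= eta) ->
      `|\int[muG]_h (rho h * f h) - c * z| <= c * eta.
    move=> fi fz; rewrite -RintegralZr// -RintegralB//; last first.
      exact: (integrableZr measurableT z ri).
    have fzi : muG.-integrable setT (EFin \o (fun h : borel G => rho h * f h - rho h * z)).
      by apply: eq_integrable (integrableB _ fi (integrableZr measurableT z ri)) => // h _ /=; rewrite EFinB.
    rewrite (le_trans (le_normr_Rintegral _ _))// -RintegralZr//.
    apply: le_Rintegral => //.
    - by have := integrable_abse fzi.
    - exact: (integrableZr measurableT eta ri).
    - move=> h _; rewrite -mulrBr normrM; have /andP[rh _] := r01 h; rewrite ger0_norm//.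
      by have [->|] := fz h; [rewrite !mul0r|move=> ?; rewrite ler_wpM2l].
  have [i1 i2] := rPi a b.
  have dichotomy h : rho h = 0 \/ (`|complex.Re (Pi h a b - Pi e a b)| <= eta /\
    `|complex.Im (Pi h a b - Pi e a b)| <= eta).
    have [W|nW] := pselect ([set g | forall a b : 'I_d, `|complex.Re (Pi g a b - Pi e a b)| <= eta /\
    `|complex.Im (Pi g a b - Pi e a b)| <= eta] h); first by right; exact: W.
    by left; exact: rW.
  rewrite (le_trans (normc_le_ReIm _))// !mxE !reimE /= oppr0 addr0.
  have -> : c / (2 * d%:R) = c * eta + c * eta by rewrite /eta; field; rewrite gt_eqF.
  apply: lerD; first apply: key => //.
    move=> h; have [->|[h1 _]] := dichotomy h; [by left|right].
    by move: h1; rewrite reimE (rep1 hPi) mxE; case: (a == b); rewrite ?natCE /= ?reimE.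
  rewrite -[X in `|X|]subr0 -[X in `|_ - X|](mulr0 c); apply: key => //.
  move=> h; have [->|[_ h2]] := dichotomy h; [by left|right].
  by move: h2; rewrite reimE (rep1 hPi) mxE; case: (a == b); rewrite ?natCE /= ?reimE.
have Aunit : A \in unitmx.
  rewrite -row_free_unit -kermx_eq0; apply/eqP/row_matrixP => a; rewrite row0.
  have : row a (kermx A) *m A = 0 by rewrite -row_mul mulmx_ker row0.
  move: (row a (kermx A)) => v vA.
  pose S := \sum_b Normc.normc (v 0 b).
  have vb b : c * Normc.normc (v 0 b) <= \sum_a Normc.normc (v 0 a) * (c / (2 * d%:R)).
    have := congr1 (fun N : 'rV[R[i]]_d => N 0 b) vA; rewrite !mxE => vAb.
    have -> : c * Normc.normc (v 0 b) = Normc.normc (\sum_a v 0 a * (A a b - Complex (c * (a == b)%:R) 0)).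
      under eq_bigr do rewrite mulrBr.
      rewrite sumrB vAb sub0r normcNE (bigD1 b)//= big1 ?addr0; last first.
        by move=> a' /negbTE ->; rewrite mulr0 [X in _ * X](_ : _ = 0) ?mulr0//.
      by rewrite eqxx mulr1 Normc.normcM normc_real gtr0_norm// mulrC.
    rewrite (le_trans (normc_sum _ _ _))//; apply: ler_sum => a' _.
    by rewrite Normc.normcM ler_wpM2l// normc_ge0.
  have S0 : S = 0.
    apply/eqP; rewrite eq_le sumr_ge0 ?andbT; last by move=> *; exact: normc_ge0.
    have : \sum_b (c * Normc.normc (v 0 b)) <= \sum_(b < d) \sum_a Normc.normc (v 0 a) * (c / (2 * d%:R)).
      by apply: ler_sum => b _; exact: vb.
    rewrite -mulr_sumr -/S sumr_const card_ord -mulr_suml -/S -[X in _ <= X](mulr_natr (S * _) d).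
    have -> : S * (c / (2 * d%:R)) * d%:R = c * S / 2 by field; rewrite gt_eqF.
    by move=> h; have : c * S <= 0 by [lra]; rewrite pmulr_rle0.
  apply/rowP => b; rewrite mxE; apply: Normc.eq0_normc; apply/eqP.
  rewrite eq_le normc_ge0 andbT -S0 /S (bigD1 b)//= lerDl.
  by apply: sumr_ge0 => *; exact: normc_ge0.
pose B (g : G) : 'M[R[i]]_d := \matrix_(a, b)
  Complex (\int[muG]_h (rho ((g : G)^-1 * h)%g * complex.Re (Pi h a b)))
  (\int[muG]_h (rho ((g : G)^-1 * h)%g * complex.Im (Pi h a b))).
have AE a b : A a b = cint muG (fun h => Complex (rho h) 0 * Pi h a b).
  rewrite mxE; apply: complexP => /=; apply: eq_Rintegral => h _; first by rewrite Re_realM.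
  by rewrite Im_realM.
have BE g a b : B g a b = cint muG (fun h : borel G => Complex (rho ((g : G)^-1 * h)%g) 0 * Pi h a b).
  rewrite mxE; apply: complexP => /=; apply: eq_Rintegral => h _; first by rewrite Re_realM.
  by rewrite Im_realM.
have ci a b : cintegrable muG (fun h => Complex (rho h) 0 * Pi h a b).
  have [i1 i2] := rPi a b; split.
    by apply: eq_integrable i1 => // h _ /=; rewrite Re_realM.
  by apply: eq_integrable i2 => // h _ /=; rewrite Im_realM.
have PiA g : Pi g *m A = B g.
  apply/matrixP => a b; rewrite mxE BE.
  under eq_bigr do rewrite AE -cintZ//.
  rewrite -cint_sum; last by move=> j _; exact: cintegrableZ.
  pose F (h : borel G) := Complex (rho h) 0 * Pi (g * h)%g a b.
  have FE : F = fun h => \sum_j Pi g a j * (Complex (rho h) 0 * Pi h j b).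
    apply/funext => h; rewrite /F (repM hPi) mxE mulr_sumr; apply: eq_bigr => j _.
    by rewrite mulrCA.
  rewrite -FE.
  have -> : (fun h : borel G => Complex (rho ((g : G)^-1 * h)%g) 0 * Pi h a b) =
      (fun h : borel G => F ((g : G)^-1 * h)%g).
    by apply/funext => h; rewrite /F mulgA mulgV mul1g.
  have ml : measurable_fun setT (fun h : borel G => (g^-1 * (h : G))%g : borel G).
    apply: (@continuous_borel G G (fun h => (g^-1 * h)%g)); apply: (continuous_mulg group_mulc); last exact: id_continuousG.
    exact: cst_continuousG.
  have [F1 F2] : cintegrable muG F by rewrite FE; apply: cintegrable_sum => j _; exact: cintegrableZ.
  by apply: complexP => /=; [rewrite -(Rintegral_preserves ml (hmuG _) F1)|
    rewrite -(Rintegral_preserves ml (hmuG _) F2)].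
have PiE g : Pi g = B g *m invmx A by rewrite -PiA mulmxK.
have Bs a b : smooth_at (cG e) line (fun g => complex.Re (B g a b)) e /\
    smooth_at (cG e) line (fun g => complex.Im (B g a b)) e.
  have [m1 m2] := Pm a b; split; under eq_fun do rewrite mxE /=;
    by apply: translate_average_smooth => //; [move=> g; exact: rep_Re_le || exact: rep_Im_le].
split.
  under eq_fun do rewrite PiE mxE Re_sum.
  apply: smooth_at_real_sum => j; under eq_fun do rewrite cReM -mulrN.
  have [s1 s2] := Bs k j.
  by apply: smooth_at_real_add; apply: smooth_at_real_mul => //; exact: smooth_at_cst.
under eq_fun do rewrite PiE mxE Im_sum.
apply: smooth_at_real_sum => j; under eq_fun do rewrite cImM.
have [s1 s2] := Bs k j.
by apply: smooth_at_real_add; apply: smooth_at_real_mul => //; exact: smooth_at_cst.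
Qed.

End Differentiability.

End LieGroupSmooth.

(** * Families of curves through the identity of a Lie group *)

Section Curves.
Context (R : realType).
Local Notation line := (line_atlas (0 : R)).

Lemma near_dnbhs (V : topologicalType) (x : V) (Q : V -> Prop) :
  (\forall t \near x, Q t) -> \forall t \near x^', Q t.
Proof. by move=> h; apply: filterS h => t. Qed.

Lemma near_dnbhs_neq (V : topologicalType) (x : V) : \forall t \near x^', t != x.
Proof. exact: nbhs_dnbhs_neq. Qed.

Lemma cvg_seq_dnbhs (t : nat -> R) : t n @[n --> \oo] --> (0 : R) ->
  (forall n, t n != 0) -> t n @[n --> \oo] --> (0 : R)^'.
Proof. by move=> tc tN0 A hA; have h : \forall n \near \oo, t n != 0 -> A (t n) := tc _ hA; move: h; apply: filterS => n /(_ (tN0 n)). Qed.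

Definition step (n : nat) : R := n.+1%:R^-1.

Lemma step_gt0 n : 0 < step n. Proof. by rewrite invr_gt0. Qed.
Lemma step_neq0 n : step n != 0. Proof. by rewrite gt_eqF// step_gt0. Qed.
Lemma cvg_step : step n @[n --> \oo] --> (0 : R). Proof. exact: cvg_harmonic. Qed.
Lemma cvg_step_dnbhs : step n @[n --> \oo] --> (0 : R)^'.
Proof. exact: cvg_seq_dnbhs cvg_step step_neq0. Qed.

Lemma derivable_quotient (f : R -> R) : differentiable (f : R^o -> R^o) 0 ->
  t^-1 * (f t - f 0) @[t --> 0^'] --> f^`()%classic 0.
Proof.
move=> /derivable1_diffP /cvg_ex [l hl].
rewrite derive1E /derive (cvg_lim _ hl)//.
by move: hl; under eq_fun do rewrite /= /GRing.scale /= mulr1 addr0.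
Qed.

Section RealFamily.
Context (EP : normedModType R) (P : topologicalType) (cP : P -> chart EP P).
Hypothesis gP : good_atlas cP.
Hypothesis compP : compact [set: P].

Definition smooth_family (w : R * P -> R) :=
  forall p, smooth_at (prod_atlas (@line_atlas R) cP (0, p)) line w (0, p).

(** By compactness of the parameter space the difference quotients at time 0
are bounded uniformly in the parameter. *)
Lemma smooth_family_lipschitz w : smooth_family w ->
  exists2 L : R, 0 <= L & \forall t \near (0 : R), forall p, `|w (t, p) - w (0, p)| <= L * `|t|.
Proof.
move=> ws; have [L L0 [[A B] /= [A0 B0] AB]] := @lipschitz_at_uniform R R^o _ _ _ _ 0
  (@line_atlas R) cP line w (fun=> erefl) compP (fun p => (ws p).1).
exists L => //; apply: filterS A0 => t At p.
by have := AB (t, 0) (conj At (nbhs_singleton B0)) p; rewrite /= subr0.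
Qed.

Lemma smooth_family_derive w p : smooth_family w ->
  t^-1 * (w (t, p) - w (0, p)) @[t --> 0^'] --> (fun t => w (t, p))^`()%classic 0.
Proof.
move=> ws; apply: (@derivable_quotient (fun t => w (t, p))).
have [gp _ _ _ _] := gP p.
exact: (@diff_at_slice R R^o _ _ _ _ 0 (@line_atlas R) cP line w p (fun=> erefl) (fun=> erefl) gp (ws p).2).
Qed.

Lemma quotient_limit_bound (u : R -> R) (L l : R) :
  (\forall t \near (0 : R), `|u t| <= L * `|t|) ->
  t^-1 * u t @[t --> 0^'] --> l -> `|l| <= L.
Proof.
move=> uL /cvg_norm ul; rewrite -(cvg_lim _ ul)//; apply: limr_le.
  by apply/cvg_ex; eexists; exact: ul.
apply: filterS2 (near_dnbhs_neq 0) (near_dnbhs uL) => t t0 tL.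
by rewrite normrM normfV ler_pdivrMl ?normr_gt0// mulrC.
Qed.

End RealFamily.

(** [l] is the derivative at 0 of the curve [u], as a limit of real difference
quotients of a complex function. *)
Definition ctangent (u : R -> R[i]) (l : R[i]) :=
  Normc.normc (Complex t^-1 0 * (u t - u 0) - l) @[t --> 0^'] --> (0 : R).

Lemma ctangentP (u : R -> R[i]) (l : R[i]) : ctangent u l <->
  t^-1 * (complex.Re (u t) - complex.Re (u 0)) @[t --> 0^'] --> complex.Re l /\
  t^-1 * (complex.Im (u t) - complex.Im (u 0)) @[t --> 0^'] --> complex.Im l.
Proof.
split.
  move=> /normc_cvg0[h1 h2]; split; apply: cvg_sub_cst.
    apply: cvg_trans h1; apply: near_eq_cvg; apply: filterE => t.
    by rewrite cReD cReN Re_realM cReD cReN.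
  apply: cvg_trans h2; apply: near_eq_cvg; apply: filterE => t.
  by rewrite cImD cImN Im_realM cImD cImN.
move=> [h1 h2]; apply/normc_cvg0; split.
  have : t^-1 * (complex.Re (u t) - complex.Re (u 0)) - complex.Re l @[t --> 0^'] --> (0 : R).
    by have h := @cvgB R R^o _ (0 : R)^' _ _ _ _ _ h1 (@cvg_cst _ (complex.Re l : R^o) _ _ _); rewrite subrr in h; exact: h.
  apply: cvg_trans; apply: near_eq_cvg; apply: filterE => t.
  by rewrite cReD cReN Re_realM cReD cReN.
have : t^-1 * (complex.Im (u t) - complex.Im (u 0)) - complex.Im l @[t --> 0^'] --> (0 : R).
  by have h := @cvgB R R^o _ (0 : R)^' _ _ _ _ _ h2 (@cvg_cst _ (complex.Im l : R^o) _ _ _); rewrite subrr in h; exact: h.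
apply: cvg_trans; apply: near_eq_cvg; apply: filterE => t.
by rewrite cImD cImN Im_realM cImD cImN.
Qed.

Section GroupCurves.
Variables (m : nat) (G : ptopologicalGroupType) (cG : G -> chart 'rV[R]_m G).
Hypothesis hG : compact_lie_group cG.
Context (EP : normedModType R) (P : topologicalType) (cP : P -> chart EP P).
Hypothesis gP : good_atlas cP.
Hypothesis compP : compact [set: P].
Local Notation e := (1%g : G).
Local Notation kappa := (chart_fun (cG e)).
Local Notation kinv := (chart_inv (cG e)).

Variable y : R * P -> G.
Hypothesis y0 : forall p, y (0, p) = e.
Hypothesis ys : forall p, smooth_at (prod_atlas (@line_atlas R) cP (0, p)) (cG e) y (0, p).
Hypothesis yc : forall t, continuous (fun p => y (t, p)).

Definition initial_velocity (p : P) : 'rV[R]_m := (fun t => kappa (y (t, p)))^`()%classic 0.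

Let germ0 p : germ_chart (prod_atlas (@line_atlas R) cP (0, p)) (0, p).
Proof. by have [gp _ _ _ _] := gP p; exact: germ_chart_prod (germ_chart_line 0) gp. Qed.

Let ge p : germ_chart (cG e) (y (0, p)).
Proof. by rewrite y0; exact: group_germ. Qed.

Lemma family_of_chart (f : G -> R) : smooth_at (cG e) line f e ->
  smooth_family cP (fun q => f (y q)).
Proof.
move=> fs p; apply: (smooth_at_comp (germ0 p) (ge p) (ys p)).
by rewrite y0.
Qed.

Lemma coord_family i : smooth_family cP (fun q => kappa (y q) 0 i).
Proof.
apply: (family_of_chart (f := fun g => kappa g 0 i)).
exact: smooth_at_coord (group_germ hG e).
Qed.

Lemma curve_differentiable p :
  diff_at (line_atlas (0 : R)) (cG e) (fun t => y (t, p)) 0 /\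
  'd (kappa \o (fun t => y (t, p)) \o chart_inv (line_atlas (0 : R))) (0 : R^o) 1 = initial_velocity p.
Proof.
have [gp _ _ _ _] := gP p; have [_ yd] := ys p.
have yd' : differentiable (fun t : R^o => kappa (y (t, p))) 0.
  exact: (@diff_at_slice R R^o _ _ _ _ 0 (@line_atlas R) cP (cG e) y p (fun=> erefl) (fun=> erefl) gp yd).
split; last first.
  by rewrite /initial_velocity derive1E (deriveE _ yd').
split=> //.
have [yc0 _] := yd.
apply: (@continuous_comp _ _ _ (fun t : R => (t, p)) y) => //.
exact: (@cvg_pair _ _ _ (nbhs (0 : R)) (nbhs (0 : R)) (nbhs p) _ _ _ id (cst p) cvg_id (cvg_cst p)).
Qed.

Lemma initial_velocity_coord p i :
  t^-1 * (kappa (y (t, p)) 0 i - kappa e 0 i) @[t --> 0^'] --> initial_velocity p 0 i.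
Proof.
have := @smooth_family_derive _ _ _ gP _ p (coord_family i).
rewrite y0; suff -> : (fun t => kappa (y (t, p)) 0 i)^`()%classic 0 = initial_velocity p 0 i by [].
have [[_ yd] <-] := curve_differentiable p.
have [d1 d2] := differentiable_coordinate i yd.
rewrite derive1E (deriveE _ d1).
by have := congr1 (fun f => f 1) d2.
Qed.

Lemma initial_velocity_bounded : exists L : R, forall p i, `|initial_velocity p 0 i| <= L.
Proof.
have H i := smooth_family_lipschitz compP (coord_family i).
pose L i := sval (cid2 (H i)).
exists (\sum_i `|L i|) => p i.
have [L0 hL] : 0 <= L i /\ \forall t \near (0 : R), forall p, `|kappa (y (t, p)) 0 i - kappa (y (0, p)) 0 i| <= L i * `|t|.
  by rewrite /L; case: cid2.
apply: (@le_trans _ _ (L i)); last first.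
  by rewrite (bigD1 i)//= (le_trans (ler_norm _))// lerDl sumr_ge0.
apply: (@quotient_limit_bound (fun t => kappa (y (t, p)) 0 i - kappa e 0 i) (L i) (initial_velocity p 0 i)); last exact: initial_velocity_coord.
by apply: filterS hL => t /(_ p); rewrite y0.
Qed.

(** The velocity is a pointwise limit of difference quotients. These are
continuous in the parameter for small times, when by compactness all the curves
are inside the chart at the identity. *)
Lemma measurable_initial_velocity dT (T : measurableType dT) (j : T -> P) :
  (forall f : P -> R, continuous f -> measurable_fun setT (f \o j)) ->
  forall i, measurable_fun setT (fun q => initial_velocity (j q) 0 i).
Proof.
move=> mj i.
have ng : \forall t \near (0 : R), forall p, chart_dom (cG e) (y (t, p)).
  have : \forall t \near (0 : R), [set: P] `<=` [set p | chart_dom (cG e) (y (t, p))].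
    apply: ((compact_near_coveringP _).1 compP R (nbhs (0 : R)) (fun t p => chart_dom (cG e) (y (t, p)))) => p _.
    have [[yc0 _] _] := ys p.
    have : nbhs (y (0, p)) (chart_dom (cG e)).
      rewrite y0; apply: open_nbhs_nbhs; split; last exact: group_dom.
      by have [hm _ _] := hG; have [_ oD _ _ _] := manifold_good_atlas hm e.
    move=> /yc0 [[A B] /= [A0 Bp] AB]; exists (B, A) => // -[q t] /= [Bq At].
    exact: (AB (t, q)).
  by apply: filterS => t h p; exact: h.
have [N _ hN] : \forall n \near \oo, forall p, chart_dom (cG e) (y (step n, p)).
  exact: (cvg_step ng).
apply: (@measurable_fun_cvg _ _ _ _
  (fun n q => (step (n + N))^-1 * (kappa (y (step (n + N), j q)) 0 i - kappa e 0 i))).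
  move=> n; apply: (mj (fun p => (step (n + N))^-1 * (kappa (y (step (n + N), p)) 0 i - kappa e 0 i))).
  have Dn p : chart_dom (cG e) (y (step (n + N), p)) by apply: (hN (n + N)%N); rewrite /= leq_addl.
  move=> p; apply: cvgM; first exact: cvg_cst.
  apply: cvgB; last exact: cvg_cst.
  have [hm _ _] := hG; have [_ _ _ [ic _ _]] := hm.
  have [kc _ _ _] := is_chart_germ (ic e) (Dn p).
  apply: (cvg_comp (fun p => y (step (n + N), p)) (fun g => kappa g 0 i)); first exact: yc.
  apply: (cvg_comp kappa (fun v : 'rV[R]_m => v 0 i) kc); exact: coord_continuous.
move=> q _; have := cvg_comp _ _ cvg_step_dnbhs (@initial_velocity_coord (j q) i).
by rewrite -(cvg_shiftn N).
Qed.

Section Representation.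
Variables (muG : probability (borel G) R) (hmuG : haar muG).
Variables (d : nat) (Pi : G -> 'M[R[i]]_d).
Hypothesis hPi : unitary_rep Pi.

(** Chain rule at the identity, where [drep] is the differential of [Pi]. *)
Lemma rep_curve_tangent p k l :
  ctangent (fun t => Pi (y (t, p)) k l) (drep cG Pi (initial_velocity p) k l).
Proof.
have [s1 s2] := rep_smooth hG hmuG hPi k l.
have [cd <-] := curve_differentiable p.
have derive_comp (f : G -> R) : smooth_at (cG e) line f e ->
    t^-1 * (f (y (t, p)) - f (y (0, p))) @[t --> 0^'] -->
      'd (f \o kinv : 'rV[R]_m -> R^o) (kappa e)
        ('d (kappa \o (fun t => y (t, p)) \o chart_inv (line_atlas (0 : R))) (0 : R^o) 1).
  move=> fs; have := @smooth_family_derive _ _ _ gP _ p (family_of_chart fs).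
  suff -> : (fun t => f (y (t, p)))^`()%classic 0 = 'd (f \o kinv : 'rV[R]_m -> R^o) (kappa e)
        ('d (kappa \o (fun t => y (t, p)) \o chart_inv (line_atlas (0 : R))) (0 : R^o) 1) by [].
  have fd : diff_at (cG e) line f (y (0, p)) by rewrite y0; case: fs.
  have [[_ d1] d2] := diff_at_comp (germ_chart_line 0) (ge p) cd fd.
  rewrite derive1E (deriveE _ d1).
  by have := congr1 (fun f => f 1) d2; rewrite /= y0.
apply/ctangentP; rewrite /drep mxE /=; split; [exact: (derive_comp _ s1)|exact: (derive_comp _ s2)].
Qed.

Lemma rep_curve_lipschitz k l : exists2 L : R, 0 <= L & \forall t \near (0 : R), forall p,
  Normc.normc (Pi (y (t, p)) k l - Pi e k l) <= L * `|t|.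
Proof.
have [s1 s2] := rep_smooth hG hmuG hPi k l.
have [L1 L10 h1] := smooth_family_lipschitz compP (family_of_chart s1).
have [L2' L20 h2] := smooth_family_lipschitz compP (family_of_chart s2).
exists (L1 + L2'); first exact: addr_ge0.
apply: filterS2 h1 h2 => t h1 h2 p; rewrite (le_trans (normc_le_ReIm _))// mulrDl !reimE.
by apply: lerD; [have := h1 p|have := h2 p]; rewrite y0.
Qed.

End Representation.

End GroupCurves.

End Curves.

(** * Curves generated by the flow *)

Section FlowCurves.
Variables (R : realType) (n : nat) (X : ptopologicalType) (cX : X -> chart 'rV[R]_n X).
Hypothesis hX : compact_manifold cX.
Variable F : R -> X -> X.
Hypothesis hF : C1_flow cX F.
Local Notation lineA := (@line_atlas R).

Let gX : good_atlas cX. Proof. exact: manifold_good_atlas. Qed.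
Let glX : good_atlas (prod_atlas lineA cX).
Proof. exact: prod_good_atlas (@line_good_atlas R) gX. Qed.

Lemma smooth_at_flow t x y : chart_dom (cX y) (F t x) ->
  smooth_at (prod_atlas lineA cX (t, x)) (cX y) (fun p => F p.1 p.2) (t, x).
Proof.
move=> Dy; have h := C1_map_smooth (x := (t, x)) (y := y) (findim_prod (findim_R R) (@findim_rV R n)) glX gX (flow_C1 hF).
exact: (h Dy).
Qed.

Lemma flow_continuous : continuous (fun p : R * X => F p.1 p.2).
Proof. by case: (flow_C1 hF). Qed.

Lemma flow_continuousr t : continuous (F t).
Proof.
move=> x; apply: (@continuous_comp _ _ _ (fun y : X => (t, y)) (fun p : R * X => F p.1 p.2)).
  exact: (@cvg_pair _ _ _ (nbhs x) (nbhs t) (nbhs x) _ _ _ (cst t) id (cvg_cst t) cvg_id).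
exact: flow_continuous.
Qed.

Lemma measurable_flow t : measurable_fun setT (F t : borel X -> borel X).
Proof. by apply: continuous_borel; exact: flow_continuousr. Qed.

Variables (m : nat) (G : ptopologicalGroupType) (cG : G -> chart 'rV[R]_m G).
Hypothesis hG : compact_lie_group cG.
Variable phi : X -> G.
Hypothesis hphi : Ck_map 1 cX cG phi.
Local Notation e := (1%g : G).

Let gG : good_atlas cG. Proof. by case: hG => h _ _; exact: manifold_good_atlas. Qed.
Let glP : good_atlas (prod_atlas cX cG). Proof. exact: prod_good_atlas. Qed.
Let glXG : good_atlas (prod_atlas lineA (prod_atlas cX cG)).
Proof. exact: prod_good_atlas (@line_good_atlas R) glP. Qed.

Lemma cocycle_continuous : continuous phi. Proof. by case: hphi. Qed.

Lemma cocycle_smooth x : smooth_at (cX x) (cG (phi x)) phi x.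
Proof. apply: C1_map_smooth => //; [exact: findim_rV|exact: group_dom]. Qed.

(** The derivative of [phi] along the flow at [x], right translated to the
identity, is the velocity of this curve. *)
Definition base_curve (q : R * X) : G := (phi (F q.1 q.2) * (phi q.2)^-1)%g.

(** Conjugation by [g] acts on velocities at the identity by [Ad g]. *)
Definition conj_curve (q : R * (X * G)) : G :=
  (q.2.2 * base_curve (q.1, q.2.1) * q.2.2^-1)%g.

Lemma base_curve0 x : base_curve (0, x) = e.
Proof. by rewrite /base_curve /= (flow0 hF) mulgV. Qed.

Lemma conj_curve0 p : conj_curve (0, p) = e.
Proof. by rewrite /conj_curve base_curve0 mulg1 mulgV. Qed.

Lemma flow_cocycle_smooth t x :
  smooth_at (prod_atlas lineA cX (t, x)) (cG (phi (F t x))) (fun p => phi (F p.1 p.2)) (t, x).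
Proof.
have [g1 _ _ _ _] := glX (t, x); have [g2 _ D _ _] := gX (F t x).
exact: (smooth_at_comp (f := fun p => F p.1 p.2) g1 g2 (smooth_at_flow D) (cocycle_smooth (F t x))).
Qed.

Lemma base_curve_smooth x :
  smooth_at (prod_atlas lineA cX (0, x)) (cG e) base_curve (0, x).
Proof.
have [g1 _ _ _ _] := glX (0, x); have [g2 _ D _ _] := gX x.
have s2 : smooth_at (prod_atlas lineA cX (0, x)) (cG (phi x)) (fun p => phi p.2) (0, x).
  by apply: (smooth_at_comp (f := snd) g1 g2); [exact: smooth_at_snd|exact: cocycle_smooth].
have s3 := smooth_at_invg hG g1 (f := fun p => phi p.2) (y := (phi x)^-1%g) s2 (group_dom hG _).
apply: (smooth_at_mulg hG g1 (flow_cocycle_smooth 0 x) s3).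
by rewrite /= (flow0 hF) mulgV; exact: group_dom.
Qed.

Lemma conj_curve_smooth p :
  smooth_at (prod_atlas lineA (prod_atlas cX cG) (0, p)) (cG e) conj_curve (0, p).
Proof.
case: p => x g; have [g1 _ _ _ _] := glXG (0, (x, g)).
have [g2 _ _ _ _] := glP (x, g); have [g3 _ _ _ _] := glX (0, x).
have sp := @smooth_at_snd R _ _ _ _ lineA (prod_atlas cX cG) (0, (x, g)) 0 (x, g) g2.
have sx : smooth_at (prod_atlas lineA (prod_atlas cX cG) (0, (x, g))) (cX x) (fun q => q.2.1) (0, (x, g)).
  apply: (smooth_at_comp (f := snd) (g := fst) g1 g2 sp).
  by apply: smooth_at_fst; case: (gX x).
have sg : smooth_at (prod_atlas lineA (prod_atlas cX cG) (0, (x, g))) (cG g) (fun q => q.2.2) (0, (x, g)).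
  apply: (smooth_at_comp (f := snd) (g := snd) g1 g2 sp).
  by apply: smooth_at_snd; case: (gG g).
have st : smooth_at (prod_atlas lineA (prod_atlas cX cG) (0, (x, g))) (lineA 0) fst (0, (x, g)).
  by apply: (@smooth_at_fst R _ _ _ _ lineA); exact: germ_chart_line.
have sb : smooth_at (prod_atlas lineA (prod_atlas cX cG) (0, (x, g))) (cG (base_curve (0, x)))
    (fun q => base_curve (q.1, q.2.1)) (0, (x, g)).
  apply: (smooth_at_comp (f := fun q => (q.1, q.2.1)) (g := base_curve) (k' := prod_atlas lineA cX (0, x)) g1 g3).
    exact: (@smooth_at_pair R _ _ _ _ _ _ _ lineA cX fst (fun q => q.2.1) _ (0, x)).
  by rewrite base_curve0; exact: base_curve_smooth.
have sgb := smooth_at_mulg hG g1 (y := (g * base_curve (0, x))%g) sg sb (group_dom hG _).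
have si := smooth_at_invg hG g1 (y := g^-1%g) sg (group_dom hG _).
apply: (smooth_at_mulg hG g1 sgb si).
by rewrite /= base_curve0 mulg1 mulgV; exact: group_dom.
Qed.

Lemma base_curve_continuous t : continuous (fun x => base_curve (t, x)).
Proof.
apply: (continuous_mulg (group_mulc hG)).
  by move=> x; apply: (continuous_comp (f := F t)); [exact: flow_continuousr|exact: cocycle_continuous].
by move=> x; apply: (continuous_comp (f := phi)); [exact: cocycle_continuous|exact: (group_invc hG)].
Qed.

Lemma conj_curve_continuous t : continuous (fun p => conj_curve (t, p)).
Proof.
apply: (continuous_mulg (group_mulc hG)).
  apply: (continuous_mulg (group_mulc hG)); first by move=> p; exact: cvg_snd.
  by move=> p; apply: (continuous_comp (f := fst) (g := fun x => base_curve (t, x))); [exact: cvg_fst|exact: base_curve_continuous].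
by move=> p; apply: (continuous_comp (f := snd)); [exact: cvg_snd|exact: (group_invc hG)].
Qed.

(** Chain rule in the charts around [gamma 0] and [f (gamma 0)]. *)
Lemma tangent_map_velocity (gamma : R -> G) (f : G -> G) :
  diff_at (lineA 0) (cG (gamma 0)) gamma 0 ->
  smooth_at (cG (gamma 0)) (cG (f (gamma 0))) f (gamma 0) ->
  tangent_map cG cG f (gamma 0) (velocity cG gamma 0) = velocity cG (f \o gamma) 0.
Proof.
move=> gd [_ fd].
have [[_ d1] d2] := diff_at_comp (germ_chart_line 0) (group_germ hG (gamma 0)) gd fd.
case: gd => _ gd.
rewrite /tangent_map /velocity !derive1E (deriveE _ gd) (deriveE _ d1).
by have := congr1 (fun f => f 1) d2.
Qed.

Lemma Mphi_velocity x : Mphi F phi cG x = initial_velocity cG base_curve x.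
Proof.
have E0 : phi (F 0 x) = phi x by rewrite (flow0 hF).
rewrite /Mphi /right_translate /lie_derivative -E0.
rewrite (tangent_map_velocity (gamma := fun t => phi (F t x)) (f := fun k => (k * (phi (F 0 x))^-1)%g)).
- by rewrite /velocity /initial_velocity /base_curve /= mulgV E0.
- have [g1 _ _ _ _] := gX x.
  split; last first.
    exact: (@diff_at_slice R _ _ _ _ _ 0 lineA cX (cG (phi (F 0 x))) (fun q => phi (F q.1 q.2)) x (fun=> erefl) (fun=> erefl) g1 (flow_cocycle_smooth 0 x).2).
  have [_ [c0 _]] := flow_cocycle_smooth 0 x.
  apply: (@continuous_comp _ _ _ (fun t : R => (t, x)) (fun q => phi (F q.1 q.2))) => //.
  exact: (@cvg_pair _ _ _ (nbhs (0 : R)) (nbhs (0 : R)) (nbhs x) _ _ _ id (cst x) cvg_id (cvg_cst x)).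
- apply: (smooth_at_mulg hG (group_germ hG _) (f := id) (g := cst _)) => //=.
  + exact/smooth_at_id/group_germ.
  + exact: smooth_at_cst.
  + exact: group_dom.
Qed.

Lemma Ad_velocity x g : Ad cG g (Mphi F phi cG x) = initial_velocity cG conj_curve (x, g).
Proof.
have [cd _] := curve_differentiable gX base_curve_smooth x.
have -> : Mphi F phi cG x = velocity cG (fun t => base_curve (t, x)) 0.
  by rewrite Mphi_velocity /velocity base_curve0.
rewrite /Ad -(base_curve0 x).
rewrite (tangent_map_velocity (gamma := fun t => base_curve (t, x)) (f := fun h => (g * h * g^-1)%g)).
- by rewrite /velocity /initial_velocity /conj_curve /= base_curve0 mulg1 mulgV.
- by rewrite base_curve0.
- apply: (smooth_at_mulg hG (group_germ hG _) (f := fun h => (g * h)%g) (g := cst _)) => //=.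
  + apply: (smooth_at_mulg hG (group_germ hG _) (f := cst g) (g := id)) => //=.
    * exact: smooth_at_cst.
    * exact/smooth_at_id/group_germ.
    * exact: group_dom.
  + exact: smooth_at_cst.
  + exact: group_dom.
Qed.

End FlowCurves.

(** * Functions differentiable along the flow, and the generator *)

Section Tangent.
Context (R : realType).
Local Notation C := R[i].
Implicit Types (u v : R -> C) (l : C).

Let fd : Filter (0 : R)^'. Proof. by typeclasses eauto. Qed.

Local Notation quotient u := (fun t : R => Complex t^-1 0 * (u t - u 0)).

Lemma ctangent_cvgE u l : ctangent u l <->
  (quotient u t : C^o) @[t --> (0 : R)^'] --> (l : C^o).
Proof. by rewrite cvgC_normc. Qed.

Lemma ctangent_cvg u l : ctangent u l -> (u t : C^o) @[t --> (0 : R)^'] --> (u 0 : C^o).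
Proof.
move=> /ctangent_cvgE h.
have t0 : (Complex t 0 : C^o) @[t --> (0 : R)^'] --> (0 : C^o).
  apply/cvgC_normc; under eq_fun do rewrite subr0 normc_real.
  have h0 : `|t| @[t --> (0 : R)^'] --> `|0 : R| by apply: cvg_norm; exact: cvg_within.
  by rewrite normr0 in h0.
have := @cvgD _ _ _ (0 : R)^' fd _ _ _ _ (@cvgM _ _ (0 : R)^' fd _ _ _ _ t0 h) (@cvg_cst _ (u 0 : C^o) _ (0 : R)^' fd).
rewrite mul0r add0r; apply: cvg_trans; apply: near_eq_cvg.
apply: filterS (near_dnbhs_neq (0 : R)) => t tn0 /=.
suff h1 : Complex t 0 * (Complex t^-1 0 * (u t - u 0)) = u t - u 0 by rewrite !fctE /= h1 subrK.
rewrite mulrA (_ : Complex t 0 * Complex t^-1 0 = 1) ?mul1r//.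
by apply: complexP; rewrite !reimE /= ?mulr0 ?mul0r ?subr0 ?addr0 ?divff.
Qed.

Lemma ctangent_cst l : ctangent (fun=> l) 0.
Proof. by apply/ctangent_cvgE; under eq_fun do rewrite subrr mulr0; exact: cvg_cst. Qed.

Lemma ctangentD u v l l' : ctangent u l -> ctangent v l' -> ctangent (fun t => u t + v t) (l + l').
Proof.
move=> /ctangent_cvgE h /ctangent_cvgE h'; apply/ctangent_cvgE.
have hs := @cvgD _ _ _ (0 : R)^' fd _ _ _ _ h h'; apply: cvg_trans hs; apply: near_eq_cvg; apply: filterE => t /=.
by rewrite -mulrDr; congr (_ * _); rewrite opprD addrACA.
Qed.

Lemma ctangentM u v l l' : ctangent u l -> ctangent v l' ->
  ctangent (fun t => u t * v t) (l * v 0 + u 0 * l').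
Proof.
move=> h /ctangent_cvgE h'; have uc := ctangent_cvg h; move/ctangent_cvgE: h => h.
apply/ctangent_cvgE.
have hs := @cvgD _ _ _ (0 : R)^' fd _ _ _ _
  (@cvgM _ _ (0 : R)^' fd _ _ _ _ h (@cvg_cst _ (v 0 : C^o) _ (0 : R)^' fd)) (@cvgM _ _ (0 : R)^' fd _ _ _ _ uc h').
apply: cvg_trans hs; apply: near_eq_cvg; apply: filterE => t; rewrite !fctE /=; ring.
Qed.

Lemma ctangentJ u l : ctangent u l -> ctangent (fun t => (u t)^*%C) l^*%C.
Proof.
rewrite /ctangent => h; have := h; apply: cvg_trans; apply: near_eq_cvg; apply: filterE => t /=.
rewrite -[LHS]normcJE; congr Normc.normc; rewrite conjcD conjcN conjcM conjcD conjcN.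
by congr (_ * _ - _); apply: complexP; rewrite !reimE /= ?oppr0.
Qed.

Lemma ctangent_sum I (r : seq I) (u : I -> R -> C) (l : I -> C) :
  (forall i, ctangent (u i) (l i)) -> ctangent (fun t => \sum_(i <- r) u i t) (\sum_(i <- r) l i).
Proof.
move=> h; elim: r => [|i r IH].
  by rewrite big_nil; under eq_fun do rewrite big_nil; exact: ctangent_cst.
by rewrite big_cons; under eq_fun do rewrite big_cons; exact: ctangentD.
Qed.

Lemma ctangent_uniq u l l' : ctangent u l -> ctangent u l' -> l = l'.
Proof. by move=> /ctangent_cvgE h /ctangent_cvgE h'; exact: (cvg_unique _ h h'). Qed.

Lemma ctangent_seq u l (t : nat -> R) : t n @[n --> \oo] --> (0 : R) -> (forall n, t n != 0) ->
  ctangent u l -> Normc.normc (Complex (t n)^-1 0 * (u (t n) - u 0) - l) @[n --> \oo] --> (0 : R).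
Proof. by move=> t0 tN0 h; exact: (cvg_comp _ _ (cvg_seq_dnbhs t0 tN0) h). Qed.

End Tangent.

Section FlowSmooth.
Context dT (T : measurableType dT) (R : realType).
Variable mu : probability T R.
Variable F : R -> T -> T.
Hypothesis F0 : forall x, F 0 x = x.
Hypothesis FD : forall s t x, F (s + t) x = F s (F t x).
Hypothesis mF : forall t, measurable_fun setT (F t).
Hypothesis pF : forall t, preserves mu (F t).
Local Notation C := R[i].
Implicit Types u v : T -> C.

(** A class of multipliers, stable under all the operations that build the
cocycle, on which the derivative along the flow exists at every point and is
a limit in the mean as well. *)
Definition flow_smooth u u' := [/\ cmeas u, exists B, forall x, Normc.normc (u x) <= B,
  exists2 L : R, 0 <= L & \forall t \near (0 : R), forall x,
    Normc.normc (u (F t x) - u x) <= L * `|t| &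
  forall x, ctangent (fun t => u (F t x)) (u' x)].

Lemma flow_smooth_cst (a : C) : flow_smooth (fun=> a) (fun=> 0).
Proof.
split.
- exact: cmeas_cst.
- by exists (Normc.normc a).
- by exists 0 => //; apply: filterE => t x; rewrite subrr Normc.normc0 mul0r.
- by move=> x; exact: ctangent_cst.
Qed.

Lemma flow_smoothD u u' v v' : flow_smooth u u' -> flow_smooth v v' ->
  flow_smooth (fun x => u x + v x) (fun x => u' x + v' x).
Proof.
move=> [mu1 [B1 b1] [L1 L10 l1] t1] [mu2 [B2 b2] [L2' L20 l2] t2]; split.
- exact: cmeasD.
- by exists (B1 + B2) => x; rewrite (le_trans (normcD _ _))// lerD.
- exists (L1 + L2'); first exact: addr_ge0.
  apply: filterS2 l1 l2 => t h1 h2 x; rewrite opprD addrACA (le_trans (normcD _ _))//.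
  by rewrite mulrDl lerD.
- by move=> x; exact: ctangentD.
Qed.

Lemma flow_smoothM u u' v v' : flow_smooth u u' -> flow_smooth v v' ->
  flow_smooth (fun x => u x * v x) (fun x => u' x * v x + u x * v' x).
Proof.
move=> [mu1 [B1 b1] [L1 L10 l1] t1] [mu2 [B2 b2] [L2' L20 l2] t2].
have B10 (x : T) : 0 <= B1 by exact: le_trans (normc_ge0 (u x)) (b1 x).
have B20 (x : T) : 0 <= B2 by exact: le_trans (normc_ge0 (v x)) (b2 x).
split.
- exact: cmeasM.
- exists (B1 * B2) => x; rewrite Normc.normcM ler_pM// normc_ge0//.
- exists (`|B1| * L2' + L1 * `|B2|); first by rewrite addr_ge0// mulr_ge0.
  apply: filterS2 l1 l2 => t h1 h2 x.
  have -> : u (F t x) * v (F t x) - u x * v x =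
    u (F t x) * (v (F t x) - v x) + (u (F t x) - u x) * v x by ring.
  rewrite (le_trans (normcD _ _))// !Normc.normcM [X in _ <= X]mulrDl -[_ * L2' * _]mulrA [_ * `|B2| * _]mulrAC.
  apply: lerD; apply: ler_pM; rewrite ?normc_ge0//.
    exact: le_trans (b1 _) (ler_norm _).
  exact: le_trans (b2 _) (ler_norm _).
- by move=> x; have := ctangentM (t1 x) (t2 x); rewrite F0.
Qed.

Lemma flow_smoothJ u u' : flow_smooth u u' ->
  flow_smooth (fun x => (u x)^*%C) (fun x => (u' x)^*%C).
Proof.
move=> [mu1 [B1 b1] [L1 L10 l1] t1]; split.
- exact: cmeasJ.
- by exists B1 => x; rewrite normcJE.
- by exists L1 => //; apply: filterS l1 => t h1 x; rewrite -conjcN -conjcD normcJE.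
- by move=> x; exact: ctangentJ.
Qed.

Lemma flow_smooth_sum I (r : seq I) (u u' : I -> T -> C) :
  (forall i, flow_smooth (u i) (u' i)) ->
  flow_smooth (fun x => \sum_(i <- r) u i x) (fun x => \sum_(i <- r) u' i x).
Proof.
move=> h; elim: r => [|i r IH].
  under eq_fun do rewrite big_nil; under [X in flow_smooth _ X]eq_fun do rewrite big_nil.
  exact: flow_smooth_cst.
under eq_fun do rewrite big_cons; under [X in flow_smooth _ X]eq_fun do rewrite big_cons.
exact: flow_smoothD.
Qed.

Lemma flow_smooth_flow s u u' : flow_smooth u u' ->
  flow_smooth (fun x => u (F s x)) (fun x => u' (F s x)).
Proof.
have Fs t x : F s (F t x) = F t (F s x) by rewrite -!FD addrC.
move=> [mu1 [B1 b1] [L1 L10 l1] t1]; split.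
- exact: (cmeas_preserves (mF s) mu1).
- by exists B1 => x.
- by exists L1 => //; apply: filterS l1 => t h1 x; rewrite Fs.
- by move=> x; under eq_fun do rewrite Fs; exact: t1.
Qed.

Lemma flow_smooth_derivative_bounded u u' : flow_smooth u u' ->
  exists B, forall x, Normc.normc (u' x) <= B.
Proof.
move=> [_ _ [L L0 hL] tx]; exists L => x; apply/ler_addgt0Pr => e e0.
have /cvgrPdist_lt/(_ e e0) h := tx x.
have [t [[t0 tL] te]] := filter_ex (filterI (filterI (near_dnbhs_neq (0 : R)) (near_dnbhs hL)) h).
move: te; rewrite sub0r normrN ger0_norm ?normc_ge0// F0 => /ltW te.
set q := Complex _ _ * _ in te.
have -> : u' x = q - (q - u' x) by rewrite opprB addrC subrK.
rewrite (le_trans (normcD _ _))// normcNE lerD// Normc.normcM normc_real normfV.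
by rewrite ler_pdivrMl ?normr_gt0// mulrC.
Qed.

Lemma flow_smooth_derivative_cmeas u u' : flow_smooth u u' -> cmeas u'.
Proof.
move=> [mu1 _ _ tx].
have mq n : cmeas (fun x => Complex (step R n)^-1 0 * (u (F (step R n) x) - u x)).
  apply: cmeasM; first exact: cmeas_cst.
  by apply: cmeasB => //; exact: (cmeas_preserves (mF _) mu1).
have qc x := ctangent_seq (@cvg_step R) (@step_neq0 R) (tx x).
split.
  apply: (@measurable_fun_cvg _ _ _ _ (fun n x => complex.Re (Complex (step R n)^-1 0 * (u (F (step R n) x) - u x)))).
    by move=> n; exact: (mq n).1.
  move=> x _; have /normc_cvg0[h _] := qc x; apply: cvg_sub_cst; move: h.
  by under eq_fun do rewrite cReD cReN F0.
apply: (@measurable_fun_cvg _ _ _ _ (fun n x => complex.Im (Complex (step R n)^-1 0 * (u (F (step R n) x) - u x)))).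
  by move=> n; exact: (mq n).2.
move=> x _; have /normc_cvg0[_ h] := qc x; apply: cvg_sub_cst; move: h.
by under eq_fun do rewrite cImD cImN F0.
Qed.

Lemma bounded_L2 u : cmeas u -> (exists B, forall x, Normc.normc (u x) <= B) -> L2 mu u.
Proof.
move=> mu1 [B hB]; apply: (@L2_le _ _ _ _ u (cst (B ^+ 2)) mu1).
  by apply: (@bounded_integrable _ _ _ mu _ `|B ^+ 2|) => // x.
move=> x; rewrite -sqr_normcE; apply: lerXn2r; rewrite ?nnegrE ?normc_ge0//.
exact: le_trans (normc_ge0 _) (hB x).
Qed.

Lemma flow_smooth_L2 u u' : flow_smooth u u' -> L2 mu u.
Proof. by move=> [h1 h2 _ _]; exact: bounded_L2. Qed.

(** Sequential form of the generator, for which dominated convergence is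
available. *)
Definition seq_generator (f h : T -> C) := [/\ L2 mu f, L2 mu h &
  forall t : nat -> R, t n @[n --> \oo] --> (0 : R) -> (forall n, t n != 0) ->
  L2norm mu (fun x => Complex 0 (t n)^-1 * (f (F (t n) x) - f x) - h x) @[n --> \oo] --> (0 : R)].

(** The uniform Lipschitz bound dominates the difference quotients. *)
Lemma flow_smooth_quotient_cvg u u' g : flow_smooth u u' -> L2 mu g ->
  forall t : nat -> R, t n @[n --> \oo] --> (0 : R) -> (forall n, t n != 0) ->
  L2norm mu (fun x => (Complex 0 (t n)^-1 * (u (F (t n) x) - u x) - Complex 0 1 * u' x) * g x)
    @[n --> \oo] --> (0 : R).
Proof.
move=> us gL t t0 tN0; have [mu1 _ [L L0 hL] tx] := us.
have [B hB] := flow_smooth_derivative_bounded us.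
have mu' := flow_smooth_derivative_cmeas us.
have [N _ hN] : \forall n \near \oo, forall x, Normc.normc (u (F (t n) x) - u x) <= L * `|t n| by exact: t0 hL.
rewrite -(cvg_shiftn N).
apply: (@L2_dominated _ _ _ _ (fun n x => Complex 0 (t (n + N)%N)^-1 * (u (F (t (n + N)%N) x) - u x) - Complex 0 1 * u' x) g (L + `|B|)) => //.
- move=> n; apply: cmeasB; apply: cmeasM => //; try exact: cmeas_cst.
  by apply: cmeasB => //; exact: (cmeas_preserves (mF _) mu1).
- move=> n x; rewrite (le_trans (normcD _ _))// normcNE !Normc.normcM !normc_imag normr1 mul1r.
  apply: lerD; last by rewrite (le_trans (hB x))// ler_norm.
  by rewrite normfV ler_pdivrMl ?normr_gt0// mulrC hN//= leq_addl.
- apply: aeW => x; rewrite (cvg_shiftn N (fun n => Normc.normc (Complex 0 (t n)^-1 * (u (F (t n) x) - u x) - Complex 0 1 * u' x))).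
  have := ctangent_seq t0 tN0 (tx x); apply: cvg_trans; apply: near_eq_cvg; apply: filterE => n.
  have -> : Complex 0 (t n)^-1 * (u (F (t n) x) - u x) - Complex 0 1 * u' x =
      Complex 0 1 * (Complex (t n)^-1 0 * (u (F (t n) x) - u x) - u' x).
    rewrite [RHS]mulrBr mulrA; congr (_ * _ - _).
    by apply: complexP; rewrite !reimE /= ?mul0r ?mul1r ?mulr0 ?oppr0 ?addr0 ?add0r ?subr0.
  by rewrite F0 Normc.normcM normc_imag normr1 mul1r.
Qed.

Lemma flow_smooth_generator u u' : flow_smooth u u' ->
  seq_generator u (fun x => Complex 0 1 * u' x).
Proof.
move=> us; split.
- exact: flow_smooth_L2 us.
- apply: L2Z; apply: bounded_L2; first exact: flow_smooth_derivative_cmeas us.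
  exact: flow_smooth_derivative_bounded us.
- move=> t t0 tN0.
  have one : L2 mu (fun=> (1 : C)).
    apply: bounded_L2; first exact: cmeas_cst.
    by exists (Normc.normc (1 : C)).
  have := flow_smooth_quotient_cvg us one t0 tN0.
  by apply: cvg_trans; apply: near_eq_cvg; apply: filterE => n; congr (L2norm mu _); apply/funext => x; rewrite mulr1.
Qed.

Lemma seq_generator_flow s f h : seq_generator f h ->
  seq_generator (fun x => f (F s x)) (fun x => h (F s x)).
Proof.
have Fs t x : F s (F t x) = F t (F s x) by rewrite -!FD addrC.
move=> [fL hL fh]; split; try exact: (L2_preserves (mF s) (@pF s)).
move=> t t0 tN0; have := fh t t0 tN0; apply: cvg_trans; apply: near_eq_cvg; apply: filterE => n.
under [in RHS]eq_fun do rewrite Fs.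
rewrite (L2norm_preserves (mF s) (@pF s) (f := fun x => Complex 0 (t n)^-1 * (f (F (t n) x) - f x) - h x))//.
apply: L2B => //; apply: L2Z; apply: L2B => //; exact: (L2_preserves (mF _) (@pF _)).
Qed.

(** Leibniz rule. The error splits into three terms: the error of the generator
of [f], multiplied by a bounded function; the increment of [q], uniformly small;
and the error of the derivative of [q], where dominated convergence applies. *)
Lemma seq_generator_mul q q' f h : flow_smooth q q' -> seq_generator f h ->
  seq_generator (fun x => q x * f x) (fun x => q x * h x + Complex 0 1 * q' x * f x).
Proof.
move=> qs [fL hL fh]; have [mq [B bB] [L L0 hLq] tq] := qs.
have [B' bB'] := flow_smooth_derivative_bounded qs.
have mq' := flow_smooth_derivative_cmeas qs.
have Lf t : L2 mu (fun x => f (F t x)) by exact: (L2_preserves (mF _) (@pF _)).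
have mqF t : cmeas (fun x => q (F t x)) by exact: (cmeas_preserves (mF _) mq).
have mi : cmeas (fun x => Complex 0 1 * q' x : C) by apply: cmeasM => //; exact: cmeas_cst.
have bi x : Normc.normc (Complex 0 1 * q' x) <= B' by rewrite Normc.normcM normc_imag normr1 mul1r.
split.
- exact: L2M mq bB fL.
- by apply: L2D; [exact: L2M mq bB hL|exact: L2M mi bi fL].
move=> t t0 tN0.
have c1 := fh t t0 tN0.
have c2 := flow_smooth_quotient_cvg qs fL t0 tN0.
have [N _ hN] : \forall n \near \oo, forall x, Normc.normc (q (F (t n) x) - q x) <= L * `|t n| by exact: t0 hLq.
have c3 : L2norm mu (fun x => (q (F (t n) x) - q x) * h x) @[n --> \oo] --> (0 : R).
  have tB : `|t n| * (L * L2norm mu h) @[n --> \oo] --> (0 : R).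
    rewrite -[X in _ --> X](mul0r (L * L2norm mu h)); apply: cvgM; last exact: cvg_cst.
    by rewrite -[X in _ --> X](@normr0 _ R); apply: cvg_norm.
  apply: (@squeeze_cvgr _ _ _ _ (cst 0) (fun n => `|t n| * (L * L2norm mu h))) => //; last exact: cvg_cst.
  exists N => // n /= Nn; rewrite L2norm_ge0/= mulrA [_ * L]mulrC.
  apply: L2normM => //; first by apply: cmeasB.
    by move=> x; exact: hN.
  by rewrite mulr_ge0.
have B0 (x : T) : 0 <= B by exact: le_trans (normc_ge0 _) (bB x).
have bBa x : Normc.normc (q x) <= `|B| by exact: le_trans (bB x) (ler_norm _).
apply: (@squeeze_cvgr _ _ _ _ (cst 0) (fun n =>
   `|B| * L2norm mu (fun x => Complex 0 (t n)^-1 * (f (F (t n) x) - f x) - h x) +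
   (L2norm mu (fun x => (q (F (t n) x) - q x) * h x) +
    L2norm mu (fun x => (Complex 0 (t n)^-1 * (q (F (t n) x) - q x) - Complex 0 1 * q' x) * f x)))); last 2 first.
- exact: cvg_cst.
- rewrite -[X in _ --> X]addr0; apply: cvgD.
    by rewrite -[X in _ --> X](mulr0 `|B|); apply: cvgM => //; exact: cvg_cst.
  by rewrite -[X in _ --> X]addr0; apply: cvgD.
apply: filterE => n; rewrite L2norm_ge0 /=.
have LA : L2 mu (fun x => Complex 0 (t n)^-1 * (f (F (t n) x) - f x) - h x).
  by apply: L2B => //; apply: L2Z; apply: L2B.
have LB : L2 mu (fun x => (q (F (t n) x) - q x) * h x).
  apply: (@L2M _ _ _ _ _ _ (B + B)) => //; first exact: cmeasB.
  by move=> x; rewrite (le_trans (normcD _ _))// normcNE lerD.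
have LC : L2 mu (fun x => (Complex 0 (t n)^-1 * (q (F (t n) x) - q x) - Complex 0 1 * q' x) * f x).
  apply: (@L2M _ _ _ _ _ _ (`|(t n)^-1| * (B + B) + B')) => //.
    by apply: cmeasB => //; apply: cmeasM; [exact: cmeas_cst|exact: cmeasB].
  move=> x; rewrite (le_trans (normcD _ _))// normcNE lerD// Normc.normcM normc_imag ler_wpM2l//.
  by rewrite (le_trans (normcD _ _))// normcNE lerD.
have -> : (fun x => Complex 0 (t n)^-1 * (q (F (t n) x) * f (F (t n) x) - q x * f x) -
   (q x * h x + Complex 0 1 * q' x * f x)) = (fun x =>
   q (F (t n) x) * (Complex 0 (t n)^-1 * (f (F (t n) x) - f x) - h x) +
   ((q (F (t n) x) - q x) * h x +
    (Complex 0 (t n)^-1 * (q (F (t n) x) - q x) - Complex 0 1 * q' x) * f x)).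
  by apply/funext => x; ring.
have LqA : L2 mu (fun x => q (F (t n) x) * (Complex 0 (t n)^-1 * (f (F (t n) x) - f x) - h x)).
  by apply: (@L2M _ _ _ _ _ _ B).
apply: (le_trans (L2norm_triangle LqA (L2D LB LC))); apply: lerD; last exact: L2norm_triangle.
by apply: L2normM.
Qed.

Lemma inner_cvgl (a : nat -> T -> C) b c : (forall n, L2 mu (a n)) -> L2 mu b -> L2 mu c ->
  L2norm mu (fun x => a n x - b x) @[n --> \oo] --> (0 : R) ->
  Normc.normc (inner mu (a n) c - inner mu b c) @[n --> \oo] --> (0 : R).
Proof.
move=> La Lb Lc h.
apply: (@squeeze_cvgr _ _ _ _ (cst 0) (fun n => L2norm mu (fun x => a n x - b x) * L2norm mu c)); last 2 first.
- exact: cvg_cst.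
- by rewrite -[X in _ --> X](mul0r (L2norm mu c)); apply: cvgM => //; exact: cvg_cst.
apply: filterE => n; have [La' Lc'] := (La n, Lc); rewrite /cst normc_ge0 andTb -(@innerBl _ _ _ mu c (a n) b)//.
by apply: cauchy_schwarz => //; exact: L2B.
Qed.

(** The generator is symmetric because the flow is unitary. *)
Lemma seq_generator_symmetric f h g k : seq_generator f h -> seq_generator g k ->
  inner mu h g = inner mu f k.
Proof.
move=> [fL hL fh] [gL kL gk].
pose t := step R.
have t0 : t n @[n --> \oo] --> (0 : R) by exact: cvg_step.
have t0' : - t n @[n --> \oo] --> (0 : R) by rewrite -[X in _ --> X]oppr0; apply: cvgN.
have tN0 n : t n != 0 by exact: step_neq0.
have tN0' n : - t n != 0 by rewrite oppr_eq0.
have LF s u : L2 mu u -> L2 mu (fun x => u (F s x)) by move=> ?; exact: (L2_preserves (mF _) (@pF _)).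
have Lq s u : L2 mu u -> L2 mu (fun x => Complex 0 s^-1 * (u (F s x) - u x)).
  by move=> uL; apply: L2Z; apply: L2B => //; exact: LF.
have c1 := @inner_cvgl (fun n x => Complex 0 (t n)^-1 * (f (F (t n) x) - f x)) h g (fun n => Lq _ _ fL) hL gL (fh t t0 tN0).
have c2 := @inner_cvgl (fun n x => Complex 0 (- t n)^-1 * (g (F (- t n) x) - g x)) k f (fun n => Lq _ _ gL) kL fL (gk _ t0' tN0').
have E n : inner mu (fun x => Complex 0 (t n)^-1 * (f (F (t n) x) - f x)) g =
    (inner mu (fun x => Complex 0 (- t n)^-1 * (g (F (- t n) x) - g x)) f)^*%C.
  have LfF := LF (t n) _ fL; have LgF := LF (- t n) _ gL.
  rewrite -innerJ//; last exact: Lq.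
  rewrite innerZl//; last exact: L2B.
  rewrite innerZr//; last exact: L2B.
  rewrite innerBl// innerBr//.
  have -> : inner mu (fun x => f (F (t n) x)) g = inner mu f (fun x => g (F (- t n) x)).
    rewrite -(inner_preserves (mF (t n)) (@pF (t n)) fL LgF); congr (inner mu _ _).
    by apply/funext => x; rewrite -FD addNr F0.
  congr (_ * _); apply: complexP; rewrite !reimE/= ?oppr0//.
  by rewrite invrN.
have : Normc.normc (inner mu h g - inner mu f k) <= 0; last first.
  by rewrite le_eqVlt ltNge normc_ge0 orbF => /eqP/Normc.eq0_normc/eqP; rewrite subr_eq0 => /eqP.
apply/ler_addgt0Pr => e e0; rewrite add0r.
have e2 : 0 < e / 2 by rewrite divr_gt0.
move/cvgrPdist_lt/(_ _ e2) : c1 => c1; move/cvgrPdist_lt/(_ _ e2) : c2 => c2.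
have [n [h1 h2]] := filter_ex (filterI c1 c2).
move: h1 h2; rewrite !sub0r !normrN !ger0_norm ?normc_ge0// E => /ltW h1 /ltW h2.
move: h2; set a := inner mu _ f; rewrite -[X in X <= _]normcJE conjcD conjcN -(innerJ kL fL) => h2.
have -> : inner mu h g - inner mu f k = - (a^*%C - inner mu h g) + (a^*%C - inner mu f k) by ring.
by rewrite (le_trans (normcD _ _))// normcNE [e]splitr lerD.
Qed.

End FlowSmooth.

(** * Schur orthogonality *)

Section ProductIntegral.
Context d1 d2 (X : measurableType d1) (Y : measurableType d2) (R : realType).
Variables (mX : probability X R) (mY : probability Y R).
Local Notation mu := (mX \x mY)%E.
Local Notation C := R[i].

Lemma integrable_fst (a : X -> R) : mX.-integrable setT (EFin \o a) ->
  mu.-integrable setT (EFin \o (fun p : X * Y => a p.1)).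
Proof.
move=> ai; have ma : measurable_fun setT a by apply/measurable_EFinP; exact: measurable_int ai.
have ma1 : measurable_fun setT (fun p : X * Y => a p.1) by exact: measurableT_comp.
apply/integrableP; split; first exact/measurable_EFinP.
rewrite (fubini_tonelli1 (fun p : X * Y => `|(EFin \o (fun p : X * Y => a p.1)) p|%E)); last 2 first.
- by apply: measurableT_comp => //; exact/measurable_EFinP.
- by move=> p; exact: abse_ge0.
move/integrableP : ai => [_]; rewrite (eq_integral (fubini_F mY (fun p : X * Y => `|(EFin \o (fun p : X * Y => a p.1)) p|%E)))//.
move=> x _; rewrite /fubini_F /= integral_cst//= [mY _]probability_setT mule1//.
Qed.

Lemma integral_prod (a : X -> R) (b : Y -> R) (B : R) : mX.-integrable setT (EFin \o a) ->
  measurable_fun setT b -> (forall y, `|b y| <= B) ->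
  mu.-integrable setT (EFin \o (fun p : X * Y => a p.1 * b p.2)) /\
  \int[mu]_p (a p.1 * b p.2) = \int[mX]_x a x * \int[mY]_y b y.
Proof.
move=> ai mb bB; have ma : measurable_fun setT a by apply/measurable_EFinP; exact: measurable_int ai.
have abi : mu.-integrable setT (EFin \o (fun p : X * Y => a p.1 * b p.2)).
  have h := integrable_fst ai.
  have hB : mu.-integrable setT (EFin \o (fun p : X * Y => B * a p.1)).
    have -> : EFin \o (fun p : X * Y => B * a p.1) = (fun p => B%:E * (EFin \o (fun p : X * Y => a p.1)) p)%E.
      by apply/funext => p /=; rewrite EFinM.
    exact: integrableZl.
  apply: (le_integrable _ _ _ hB) => //.
    apply/measurable_EFinP; apply: measurable_funM; exact: measurableT_comp.
  move=> p _; rewrite /= lee_fin normrM mulrC [leRHS]normrM ler_wpM2r//.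
  exact: le_trans (bB _) (ler_norm _).
have bi := bounded_integrable mY mb bB.
split=> //; rewrite /Rintegral -(integral12_prod_meas1 abi).
have -> : (\int[mX]_x fubini_F mY (EFin \o (fun p : X * Y => a p.1 * b p.2)%R) x =
   \int[mX]_x ((\int[mY]_y b y)%:E * (EFin \o a) x))%E.
  apply: eq_integral => x _; rewrite /fubini_F /= muleC.
  rewrite /Rintegral fineK; last exact: integrable_fin_num.
  by rewrite -integralZl//; apply: eq_integral => y _.
rewrite integralZl//= fineM//; last exact: integrable_fin_num.
by rewrite mulrC.
Qed.

Lemma cint_prod (f : X -> C) (g : Y -> C) (B : R) : cintegrable mX f -> cmeas g ->
  (forall y, Normc.normc (g y) <= B) ->
  cintegrable mu (fun p : X * Y => f p.1 * g p.2) /\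
  cint mu (fun p : X * Y => f p.1 * g p.2) = cint mX f * cint mY g.
Proof.
move=> [f1 f2] [g1 g2] gB.
have B1 y : `|complex.Re (g y)| <= B by exact: le_trans (Re_le_normc _) (gB y).
have B2 y : `|complex.Im (g y)| <= B by exact: le_trans (Im_le_normc _) (gB y).
have [i11 e11] := integral_prod f1 g1 B1.
have [i12 e12] := integral_prod f1 g2 B2.
have [i21 e21] := integral_prod f2 g1 B1.
have [i22 e22] := integral_prod f2 g2 B2.
split.
  split.
    under [X in _.-integrable _ (_ \o X)]eq_fun do rewrite cReM.
    exact: (integrableB measurableT i11 i22).
  under [X in _.-integrable _ (_ \o X)]eq_fun do rewrite cImM.
  exact: (integrableD measurableT i12 i21).
apply: complexP; rewrite !reimE /=.
  transitivity (\int[mu]_p (complex.Re (f p.1) * complex.Re (g p.2) - complex.Im (f p.1) * complex.Im (g p.2))).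
    by apply: eq_Rintegral => p _; rewrite cReM.
  by rewrite RintegralB// e11 e22.
transitivity (\int[mu]_p (complex.Re (f p.1) * complex.Im (g p.2) + complex.Im (f p.1) * complex.Re (g p.2))).
  by apply: eq_Rintegral => p _; rewrite cImM.
by rewrite RintegralD// e12 e21 mulrC.
Qed.

Lemma L2_prod (f : X -> C) (g : Y -> C) (B : R) : L2 mX f -> cmeas g ->
  (forall y, Normc.normc (g y) <= B) -> L2 mu (fun p : X * Y => f p.1 * g p.2).
Proof.
move=> fL mg gB; have mf := L2_cmeas fL.
have mf1 : cmeas (fun p : X * Y => f p.1) by split; [exact: (measurableT_comp mf.1)|exact: (measurableT_comp mf.2)].
have mg1 : cmeas (fun p : X * Y => g p.2) by split; [exact: (measurableT_comp mg.1)|exact: (measurableT_comp mg.2)].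
have h : L2 mu (fun p : X * Y => f p.1).
  by apply/L2P; split => //; exact: (integrable_fst (L2_integrable fL)).
under [X in L2 _ X]eq_fun do rewrite mulrC.
by apply: (@L2M _ _ _ _ _ _ B).
Qed.

End ProductIntegral.

Section Schur.
Variables (R : realType) (m : nat) (G : ptopologicalGroupType) (cG : G -> chart 'rV[R]_m G).
Hypothesis hG : compact_lie_group cG.
Variables (muG : probability (borel G) R) (hmuG : haar muG).
Variables (d : nat) (Pi : G -> 'M[R[i]]_d) (j : 'I_d).
Hypothesis hPi : unitary_rep Pi.
Hypothesis hirr : irreducible_rep Pi.
Local Notation C := R[i].

(** Schur's lemma: an eigenspace of the commuting matrix is stable. *)
Lemma commuting_scalar (M : 'M[C]_d) : (forall g, Pi g *m M = M *m Pi g) -> exists c, M = c%:M.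
Proof.
move=> hM; have [d0 irr] := hirr.
have [c /negP cE] := eigenvalue_closed M^T d0.
have st g : stablemx (eigenspace M^T c) (Pi g)^T.
  by apply: comm_mx_stable_eigenspace; rewrite /comm_mx -!trmx_mul hM.
exists c; have [r0|rd] := irr _ st.
  by case: cE; apply/eqP/eqP; rewrite -mxrank_eq0 r0.
have full : row_full (eigenspace M^T c) by rewrite /row_full rd.
have : (1%:M <= eigenspace M^T c)%MS by rewrite sub1mx.
by move=> /eigenspaceP; rewrite mul1mx scalemx1 => /(congr1 trmx); rewrite trmxK tr_scalar_mx.
Qed.

Let entry_meas k l : cmeas (T := borel G) (fun g => Pi g k l).
Proof. exact: rep_cmeas. Qed.

Let pair_meas k l : cmeas (T := borel G) (fun g => (Pi g j k)^*%C * Pi g j l).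
Proof. by apply: cmeasM => //; exact: cmeasJ. Qed.

Let pair_bound k l g : Normc.normc ((Pi g j k)^*%C * Pi g j l) <= 1.
Proof.
by rewrite Normc.normcM normcJE mulr_ile1 ?normc_ge0//; exact: rep_entry.
Qed.

Let pair_int k l : cintegrable muG (fun g : borel G => (Pi g j k)^*%C * Pi g j l).
Proof.
apply: (@cintegrable_le _ _ _ _ _ (cst 1)) => //.
by apply: (@bounded_integrable _ _ _ muG _ 1) => // x; rewrite normr1.
Qed.

Definition schur_mx : 'M[C]_d :=
  \matrix_(k, l) cint muG (fun g : borel G => (Pi g j k)^*%C * Pi g j l).

(** The change of variables by right translation conjugates the matrix by
[Pi h]. *)
Lemma schur_mx_commutes h : Pi h *m schur_mx = schur_mx *m Pi h.
Proof.
suff E : schur_mx = (Pi h)^t* *m schur_mx *m Pi h.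
  by rewrite {1}E !mulmxA (repU hPi) mul1mx.
apply/matrixP => k l; rewrite mxE.
have mR := haar_right (group_2nd hG) (group_mulc hG) (group_invc hG) hmuG h.
have mh : measurable_fun setT (fun g : borel G => (g * h)%g : borel G).
  apply: continuous_borel; apply: (continuous_mulg (group_mulc hG)).
    exact: id_continuousG.
  exact: cst_continuousG.
transitivity (cint muG (fun g : borel G => (Pi (g * h)%g j k)^*%C * Pi (g * h)%g j l)).
  have [i1 i2] := pair_int k l.
  rewrite /cint; congr Complex.
    by rewrite -(Rintegral_preserves mh mR i1).
  by rewrite -(Rintegral_preserves mh mR i2).
transitivity (cint muG (fun g : borel G => \sum_a \sum_b ((Pi h a k)^*%C * Pi h b l) * ((Pi g j a)^*%C * Pi g j b))).
  congr (cint _ _); apply/funext => g; rewrite (repM hPi) !mxE conjc_sum big_distrl /=.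
  apply: eq_bigr => a _; rewrite big_distrr /=; apply: eq_bigr => b _.
  by rewrite conjcM; ring.
have pZ a b (c : C) : cintegrable muG (fun g : borel G => c * ((Pi g j a)^*%C * Pi g j b)).
  exact: cintegrableZ.
rewrite cint_sum; last by move=> a _; apply: cintegrable_sum.
rewrite [RHS]mxE [RHS](eq_bigr (fun b => \sum_a (Pi h a k)^*%C * Pi h b l * schur_mx a b)); last first.
  move=> b _; rewrite mxE big_distrl /=; apply: eq_bigr => a _.
  by rewrite /schur_mx !mxE; ring.
rewrite exchange_big /=; apply: eq_bigr => a _.
by rewrite cint_sum//; apply: eq_bigr => b _; rewrite cintZ// mxE.
Qed.

Lemma dim_neq0 : d%:R != 0 :> C.
Proof. by rewrite pnatr_eq0 -lt0n; case: hirr. Qed.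

(** By Schur's lemma the matrix of integrals is scalar; its trace is the integral
of the squared norm of a row of a unitary matrix. *)
Lemma schur_orthogonality k l :
  cint muG (fun g : borel G => (Pi g j k)^*%C * Pi g j l) = (k == l)%:R / d%:R.
Proof.
have [c cE] := commuting_scalar schur_mx_commutes.
have tr : \tr schur_mx = 1.
  rewrite /mxtrace (eq_bigr (fun k => cint muG (fun g : borel G => (Pi g j k)^*%C * Pi g j k))); last first.
    by move=> a _; rewrite mxE.
  rewrite -cint_sum// (_ : (fun x => _) = (fun=> 1)); last first.
    apply/funext => g; have := congr1 (fun M : 'M[C]_d => M j j) (repU hPi g).
    rewrite !mxE eqxx mulr1n => <-; apply: eq_bigr => a _.
    by rewrite !mxE mulrC.
  apply: complexP; rewrite /cint /= /Rintegral integral_cst//= probability_setT ?mul0e ?mul1e//=.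
have cd : c * d%:R = 1 by rewrite mulr_natr -tr cE mxtrace_scalar.
have -> : cint muG (fun g : borel G => (Pi g j k)^*%C * Pi g j l) = schur_mx k l by rewrite mxE.
rewrite cE mxE -[c](mulfK dim_neq0) cd mul1r.
by case: (k == l); rewrite ?mulr1n ?mulr0n ?mul1r ?mul0r.
Qed.

Section Tensor.
Variables (X : ptopologicalType) (muX : probability (borel X) R).
Local Notation mu := (muX \x muG)%E.
Implicit Types f h : 'I_d -> X -> C.

Lemma tensor_L2 f : (forall k, L2 muX (f k)) -> L2 mu (tensor Pi j f).
Proof.
move=> fL; rewrite /tensor; apply: L2_sum => k _.
exact: (@L2_prod _ _ _ _ _ muX muG (f k) (fun g : borel G => Pi g j k) 1 (fL k) (entry_meas j k)
  (fun g => rep_entry hPi g j k)).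
Qed.

(** Orthogonality makes the component a space of vector-valued functions on
[X]. *)
Lemma inner_tensor f h : (forall k, L2 muX (f k)) -> (forall k, L2 muX (h k)) ->
  inner mu (tensor Pi j f) (tensor Pi j h) = d%:R^-1 * \sum_k inner muX (f k) (h k).
Proof.
move=> fL hL; rewrite innerE.
have I k l := cint_prod muG (L2_cintegrable (fL k) (hL l)) (pair_meas k l) (pair_bound k l).
rewrite (_ : (fun x => _) = (fun p : borel X * borel G => \sum_k \sum_l
    ((f k p.1)^*%C * h l p.1) * ((Pi p.2 j k)^*%C * Pi p.2 j l))); last first.
  apply/funext => p; rewrite /tensor conjc_sum big_distrl /=; apply: eq_bigr => k _.
  rewrite big_distrr /=; apply: eq_bigr => l _.
  by rewrite conjcM; ring.
rewrite cint_sum; last by move=> k _; apply: cintegrable_sum => l _; exact: (I k l).1.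
rewrite mulr_sumr; apply: eq_bigr => k _.
rewrite cint_sum; last by move=> l _; exact: (I k l).1.
rewrite (bigD1 k)//= big1 ?addr0; last first.
  move=> l lk; rewrite (I k l).2 schur_orthogonality eq_sym (negbTE lk) mul0r mulr0//.
by rewrite (I k k).2 schur_orthogonality eqxx mul1r mulrC -innerE.
Qed.

Lemma L2norm_tensor f : (forall k, L2 muX (f k)) ->
  L2norm mu (tensor Pi j f) ^+ 2 = d%:R^-1 * \sum_k L2norm muX (f k) ^+ 2.
Proof.
move=> fL; have := inner_tensor fL fL; rewrite inner_self => /(congr1 (@complex.Re R)) /=.
rewrite natCV Re_realM => ->; congr (_ * _); rewrite Re_sum; apply: eq_bigr => k _.
by rewrite inner_self.
Qed.

End Tensor.

End Schur.

(** * The cocycle and the averages of its logarithmic derivative *)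

Lemma drep_integral (R : realType) (m : nat) (G : ptopologicalGroupType) (cG : G -> chart 'rV[R]_m G)
    (d : nat) (Pi : G -> 'M[R[i]]_d) dT (T : measurableType dT) (mu : probability T R)
    (Z : T -> 'rV[R]_m) (B : R) :
  (forall i, measurable_fun setT (fun x => Z x 0 i)) -> (forall x i, `|Z x 0 i| <= B) ->
  forall k l, cmeas (fun x => drep cG Pi (Z x) k l) /\
    cint mu (fun x => drep cG Pi (Z x) k l) = drep cG Pi (\row_i \int[mu]_x Z x 0 i) k l.
Proof.
move=> mZ bZ.
have lin (L : {linear 'rV[R]_m -> R^o}) : measurable_fun setT (fun x => L (Z x) : R) /\
    \int[mu]_x L (Z x) = L (\row_i \int[mu]_x Z x 0 i).
  have LE (v : 'rV[R]_m) : L v = \sum_i v 0 i * L (delta_mx 0 i).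
    by rewrite {1}(row_sum_delta v) linear_sum; apply: eq_bigr => i _; rewrite linearZ.
  have -> : (fun x => L (Z x) : R) = (fun x => \sum_i Z x 0 i * L (delta_mx 0 i)).
    by apply/funext => x; rewrite LE.
  split; first by apply: measurable_sum => i; apply: measurable_funM.
  have ZI i : mu.-integrable setT (EFin \o (fun x => Z x 0 i)) by exact: (bounded_integrable mu (mZ i) (bZ ^~ i)).
  have ZLI i : mu.-integrable setT (EFin \o (fun x => Z x 0 i * L (delta_mx 0 i))).
    have -> : EFin \o (fun x => Z x 0 i * L (delta_mx 0 i)) = (fun x => (L (delta_mx 0%R i))%:E * (EFin \o (fun y : T => Z y (0 : 'I_1)%R i)) x)%E.
      by apply/funext => x /=; rewrite mulrC.
    exact: integrableZl.
  rewrite LE (Rintegral_sum (index_enum 'I_m) (fun i => ZLI i)).2; apply: eq_bigr => i _.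
  by rewrite RintegralZr// mxE.
move=> k l.
pose L1 : {linear 'rV[R]_m -> R^o} :=
  'd (fun v => complex.Re (Pi (chart_inv (cG 1%g) v) k l) : R^o) (chart_fun (cG 1%g) 1%g).
pose L2' : {linear 'rV[R]_m -> R^o} :=
  'd (fun v => complex.Im (Pi (chart_inv (cG 1%g) v) k l) : R^o) (chart_fun (cG 1%g) 1%g).
have dE z : drep cG Pi z k l = Complex (L1 z) (L2' z) by rewrite /drep mxE.
have [m1 i1] := lin L1; have [m2 i2] := lin L2'.
have -> : (fun x => drep cG Pi (Z x) k l) = (fun x => Complex (L1 (Z x)) (L2' (Z x))).
  by apply/funext => x; exact: dE.
split; first exact: (conj m1 m2).
rewrite dE.
rewrite -i1.
rewrite -i2.
by [].
Qed.

Section Cocycle.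
Variables (R : realType) (n : nat) (X : ptopologicalType) (cX : X -> chart 'rV[R]_n X).
Hypothesis hX : compact_manifold cX.
Variable muX : probability (borel X) R.
Variable F : R -> X -> X.
Hypothesis hF : C1_flow cX F.
Hypothesis hFmu : forall t, preserves (T := borel X) muX (F t).
Variables (m : nat) (G : ptopologicalGroupType) (cG : G -> chart 'rV[R]_m G).
Hypothesis hG : compact_lie_group cG.
Variables (muG : probability (borel G) R) (hmuG : haar muG).
Variables (d : nat) (Pi : G -> 'M[R[i]]_d).
Hypothesis hPi : unitary_rep Pi.
Variable phi : X -> G.
Hypothesis hphi : Ck_map 1 cX cG phi.
Local Notation C := R[i].
Local Notation mu := (muX \x muG)%E.
Local Notation T := (skew_map F phi).

Let gX : good_atlas cX. Proof. exact: manifold_good_atlas. Qed.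
Let gG : good_atlas cG. Proof. by case: hG => h _ _; exact: manifold_good_atlas. Qed.
Let compX : compact [set: X]. Proof. by case: hX. Qed.
Let X2 : @second_countable X. Proof. by case: hX. Qed.
Let F0 (x : borel X) : F 0 x = x := flow0 hF x.
Let FD s t (x : borel X) : F (s + t) x = F s (F t x) := flowD hF s t x.
Let mF t : measurable_fun setT (F t : borel X -> borel X).
Proof. exact: (measurable_flow hF t). Qed.
Let bs := base_curve_smooth hX hF hG hphi.
Let b0 := @base_curve0 R n X cX F hF G phi.
Let bc := base_curve_continuous hF hG hphi.
Let cs := conj_curve_smooth hX hF hG hphi.
Let c0 := @conj_curve0 R n X cX F hF G phi.
Let cc := conj_curve_continuous hF hG hphi.
Let gP : good_atlas (prod_atlas cX cG). Proof. exact: prod_good_atlas. Qed.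
Let compP : compact [set: X * G].
Proof. by rewrite -setXTT; apply: compact_setX => //; exact: group_compact hG. Qed.

(** This is a logarithmic derivative: along the flow, the derivative of
[Pi \o phi] is [log_derivative *m (Pi \o phi)]. *)
Definition log_derivative (x : X) : 'M[C]_d := drep cG Pi (Mphi F phi cG x).
Local Notation ld := log_derivative.

Lemma log_derivative_tangent x k l :
  ctangent (fun t => Pi (base_curve F phi (t, x)) k l) (ld x k l).
Proof.
rewrite /log_derivative (Mphi_velocity hX hF hG hphi).
exact: (rep_curve_tangent hG gX b0 bs hmuG hPi).
Qed.

(** Both sides are the derivative at time 0 of [Pi] along [conj_curve]. *)
Lemma log_derivative_Ad x g :
  drep cG Pi (Ad cG g (Mphi F phi cG x)) = Pi g *m ld x *m (Pi g)^t*.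
Proof.
apply/matrixP => k l; rewrite (Ad_velocity hX hF hG hphi).
apply: ctangent_uniq (rep_curve_tangent hG gP c0 cs hmuG hPi (x, g) k l) _.
have -> : (fun t => Pi (conj_curve F phi (t, (x, g))) k l) =
    (fun t => \sum_b (\sum_a Pi g k a * Pi (base_curve F phi (t, x)) a b) * (Pi g)^t* b l).
  by apply/funext => t; rewrite /conj_curve /= (repM hPi (g * base_curve F phi (t, x))%g) (repM hPi g) (repV hPi) mxE; apply: eq_bigr => b _; rewrite mxE.
rewrite mxE; apply: ctangent_sum => b.
rewrite [(_ *m ld x) _ _]mxE.
have := ctangentM (u := fun t => \sum_a Pi g k a * Pi (base_curve F phi (t, x)) a b) (v := fun=> (Pi g)^t* b l)
   (l := \sum_a Pi g k a * ld x a b) _ (ctangent_cst _).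
rewrite mulr0 addr0; apply; apply: ctangent_sum => a.
have := ctangentM (ctangent_cst (Pi g k a)) (log_derivative_tangent x a b).
by rewrite mul0r add0r.
Qed.

Lemma Mphi_measurable_bounded : (forall i, measurable_fun setT (fun x : borel X => Mphi F phi cG x 0 i)) /\
  exists B : R, forall x i, `|Mphi F phi cG x 0 i| <= B.
Proof.
have [B hB] := initial_velocity_bounded hG gX compX b0 bs.
split; last by exists B => x i; rewrite (Mphi_velocity hX hF hG hphi).
move=> i; under eq_fun do rewrite (Mphi_velocity hX hF hG hphi).
apply: (measurable_initial_velocity hG gX compX b0 bs bc (T := borel X) (j := id)).
by move=> f cf; exact: continuous_borelR.
Qed.

Lemma Ad_Mphi_measurable_bounded :
  (forall i, measurable_fun setT (fun p : borel X * borel G => Ad cG p.2 (Mphi F phi cG p.1) 0 i)) /\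
  exists B : R, forall (p : borel X * borel G) i, `|Ad cG p.2 (Mphi F phi cG p.1) 0 i| <= B.
Proof.
have [B hB] := initial_velocity_bounded hG gP compP c0 cs.
split; last by exists B => -[x g] i; rewrite (Ad_velocity hX hF hG hphi).
move=> i; under eq_fun do rewrite (Ad_velocity hX hF hG hphi).
apply: (measurable_initial_velocity hG gP compP c0 cs cc (T := (borel X * borel G)%type) (j := fun p => (p.1, p.2))).
move=> f cf; rewrite (_ : _ \o _ = f); last by apply/funext => -[].
by apply: continuous_borel_prodR => //; exact: group_2nd hG.
Qed.

Definition mx_flow_smooth (M M' : X -> 'M[C]_d) := forall k l,
  flow_smooth (T := borel X) F (fun x => M x k l) (fun x => M' x k l).

Lemma mx_flow_smoothM M M' N N' : mx_flow_smooth M M' -> mx_flow_smooth N N' ->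
  mx_flow_smooth (fun x => M x *m N x) (fun x => M' x *m N x + M x *m N' x).
Proof.
move=> hM hN k l; under eq_fun do rewrite mxE.
rewrite (_ : (fun x => (M' x *m N x + M x *m N' x) k l) =
  (fun x => \sum_a (M' x k a * N x a l + M x k a * N' x a l))); last first.
  by apply/funext => x; rewrite !mxE -big_split.
apply: flow_smooth_sum => a; exact: flow_smoothM.
Qed.

Lemma mx_flow_smooth_flow s M M' : mx_flow_smooth M M' ->
  mx_flow_smooth (fun x => M (F s x)) (fun x => M' (F s x)).
Proof. by move=> h k l; exact: (flow_smooth_flow FD mF s (h k l)). Qed.

(** At time t, [Pi \o phi] has been multiplied on the left by [Pi] along
[base_curve]. *)
Lemma rep_cocycle_smooth : mx_flow_smooth (fun x => Pi (phi x)) (fun x => ld x *m Pi (phi x)).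
Proof.
have phiE t x : Pi (phi (F t x)) = Pi (base_curve F phi (t, x)) *m Pi (phi x).
  by rewrite -(repM hPi) /base_curve /= mulgVK.
move=> k l; split.
- have [h1 h2] := rep_cmeas hPi k l.
  have mphi : measurable_fun setT (phi : borel X -> borel G).
    by apply: continuous_borel; exact: cocycle_continuous hphi.
  by split; [exact: (measurableT_comp h1 mphi)|exact: (measurableT_comp h2 mphi)].
- by exists 1 => x; exact: rep_entry.
- have H a := rep_curve_lipschitz hG gX compX b0 bs hmuG hPi k a.
  pose L a := sval (cid2 (H a)).
  have HL a : 0 <= L a /\ \forall t \near (0 : R), forall p,
      Normc.normc (Pi (base_curve F phi (t, p)) k a - Pi 1%g k a) <= L a * `|t|.
    by rewrite /L; case: cid2.
  exists (\sum_a L a); first by apply: sumr_ge0 => a _; case: (HL a).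
  have : \forall t \near (0 : R), forall a p,
      Normc.normc (Pi (base_curve F phi (t, p)) k a - Pi 1%g k a) <= L a * `|t|.
    have hh a := (HL a).2; exact: (@filter_forall _ 'I_d (fun a t => forall p : X, Normc.normc (Pi (base_curve F phi (t, p)) k a - Pi 1%g k a) <= L a * `|t|) (nbhs (0 : R)) _ hh).
  apply: filterS => t ht x; rewrite phiE.
  have -> : (Pi (base_curve F phi (t, x)) *m Pi (phi x)) k l - Pi (phi x) k l =
    \sum_a (Pi (base_curve F phi (t, x)) k a - Pi 1%g k a) * Pi (phi x) a l.
    rewrite -[Pi (phi x) in X in _ - X]mul1mx -(rep1 hPi) [in LHS]mxE [X in _ - X]mxE -sumrB.
    by apply: eq_bigr => a _; rewrite mulrBl.
  rewrite (le_trans (normc_sum _ _ _))// mulr_suml ler_sum// => a _.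
  rewrite Normc.normcM -[leRHS]mulr1 ler_pM ?normc_ge0//; exact: rep_entry.
- move=> x; have -> : (fun t => Pi (phi (F t x)) k l) =
     (fun t => \sum_a Pi (base_curve F phi (t, x)) k a * Pi (phi x) a l).
    by apply/funext => t; rewrite phiE mxE.
  rewrite mxE; apply: ctangent_sum => a.
  have := ctangentM (log_derivative_tangent x k a) (ctangent_cst (Pi (phi x) a l)).
  by rewrite mulr0 addr0.
Qed.

Lemma log_derivative_bounded : exists2 B : R, 0 <= B & forall x k l, Normc.normc (ld x k l) <= B.
Proof.
have H k l := flow_smooth_derivative_bounded F0 (rep_cocycle_smooth k l).
pose B k l := sval (cid (H k l)).
have HB k l x : Normc.normc ((ld x *m Pi (phi x)) k l) <= B k l by rewrite /B; case: cid.
exists (\sum_k \sum_l `|B k l|); first by rewrite !sumr_ge0// => k _; rewrite sumr_ge0.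
move=> x k l.
have -> : ld x = (ld x *m Pi (phi x)) *m (Pi (phi x))^t* by rewrite -mulmxA (repU hPi) mulmx1.
rewrite mxE (le_trans (normc_sum _ _ _))//.
rewrite [leRHS](bigD1 k)//= ler_wpDr//; first by rewrite sumr_ge0// => a _; rewrite sumr_ge0.
apply: ler_sum => a _; rewrite Normc.normcM -[leRHS]mulr1 ler_pM ?normc_ge0//.
  by rewrite (le_trans (HB _ _ _))// ler_norm.
by rewrite -(repV hPi); exact: rep_entry.
Qed.

(** The N-th iterate of the skew product maps [(x, g)] to
[(F N x, g * group_cocycle N x)]. *)
Fixpoint group_cocycle (N : nat) (x : X) : G :=
  if N is N'.+1 then (group_cocycle N' x * phi (F N'%:R x))%g else 1%g.

Definition cocycle N x : 'M[C]_d := Pi (group_cocycle N x).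
Local Notation Q := cocycle.

Fixpoint cocycle_derivative (N : nat) (x : X) : 'M[C]_d :=
  if N is N'.+1 then
    cocycle_derivative N' x *m Pi (phi (F N'%:R x)) +
    Q N' x *m (ld (F N'%:R x) *m Pi (phi (F N'%:R x)))
  else 0.
Local Notation Q' := cocycle_derivative.

Lemma cocycleS N x : Q N.+1 x = Q N x *m Pi (phi (F N%:R x)).
Proof. by rewrite /cocycle /= (repM hPi). Qed.

Lemma cocycle_smooth_flow N : mx_flow_smooth (Q N) (Q' N).
Proof.
elim: N => [|N IH].
  by move=> k l; under eq_fun do rewrite /cocycle /=; under [X in flow_smooth _ _ X]eq_fun do rewrite mxE; exact: flow_smooth_cst.
rewrite (_ : Q N.+1 = (fun x => Q N x *m Pi (phi (F N%:R x)))); last by apply/funext => x; exact: cocycleS.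
exact: (mx_flow_smoothM IH (mx_flow_smooth_flow N%:R rep_cocycle_smooth)).
Qed.

(** Leibniz rule; in the term where factor k is differentiated, unitarity
cancels all later factors. *)
Lemma cocycle_derivative_sum N x : Q' N x *m (Q N x)^t* =
  \sum_(k < N) Q k x *m ld (F k%:R x) *m (Q k x)^t*.
Proof.
elim: N => [|N IH]; first by rewrite big_ord0 mul0mx.
rewrite big_ord_recr /= -IH cocycleS trmx_mul map_mxM /= mulmxDl.
congr (_ + _); rewrite -!mulmxA.
  by rewrite [X in _ *m X]mulmxA (repU hPi) mul1mx.
by rewrite [X in _ *m (_ *m X)]mulmxA (repU hPi) mul1mx.
Qed.

Lemma iter_flow N x : iter N (F 1) x = F N%:R x.
Proof.
elim: N x => [|N IH] x /=; first by rewrite F0.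
by rewrite IH -FD -natr1 addrC.
Qed.

Lemma iter_skew N p : iter N T p = (F N%:R p.1, (p.2 * group_cocycle N p.1)%g).
Proof.
elim: N => [|N IH] /=; first by rewrite F0 mulg1; case: p.
by rewrite IH /skew_map /= -FD -natr1 addrC mulgA.
Qed.

(** This convergence and the commutation of the limit with [Pi \o phi] are what
the ergodicity hypotheses are used for. *)
Definition limit_along (Mbar : 'M[C]_d) := {ae muX, forall x, forall k l,
  Normc.normc ((N%:R^-1 *: (Q' N x *m (Q N x)^t*)) k l - Mbar k l) @[N --> \oo] --> (0 : R)}.

(** Diagonal unitary matrices cancel in the conjugations, so the averages are
Birkhoff averages of [log_derivative] on the base. *)
Lemma diagonal_limit : uniquely_ergodic (T := borel X) muX (F 1) ->
  (forall x, is_diag_mx (Pi (phi x))) ->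
  let Mbar := drep cG Pi (Mstar_diag F phi cG muX) in
  limit_along Mbar /\ forall x, Mbar *m Pi (phi x) = Pi (phi x) *m Mbar.
Proof.
move=> ue hd Mbar.
have ldd x : is_diag_mx (ld x).
  apply/is_diag_mxP => k l kl.
  apply: ctangent_uniq (log_derivative_tangent x k l) _.
  have -> : (fun t => Pi (base_curve F phi (t, x)) k l) = (fun=> 0); last exact: ctangent_cst.
  apply/funext => t; rewrite /base_curve /= (repM hPi) (repV hPi).
  have [/diag_mxP[u ->] /diag_mxP[v ->]] := (hd (F t x), hd x).
  by rewrite tr_diag_mx map_diag_mx mulmx_diag mxE -val_eqE /= (negbTE kl) mulr0n.
have qd N x : is_diag_mx (Q N x).
  elim: N => [|N IH]; first by rewrite /cocycle /= (rep1 hPi) scalar_mx_is_diag.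
  rewrite cocycleS; have [/diag_mxP[u ->] /diag_mxP[v ->]] := (IH, hd (F N%:R x)).
  by rewrite mulmx_diag diag_mx_is_diag.
have comm A B : is_diag_mx A -> is_diag_mx B -> A *m B = B *m A :> 'M[C]_d.
  by move=> /diag_mxP[u ->] /diag_mxP[v ->]; exact: diag_mxC.
have [mZ [B hB]] := Mphi_measurable_bounded.
have dI k l := drep_integral cG Pi muX mZ hB k l.
have MbarE k l : Mbar k l = cint muX (fun x : borel X => ld x k l) by rewrite (dI k l).2.
split; last first.
  move=> x; apply: comm => //; apply/is_diag_mxP => k l kl.
  rewrite MbarE (_ : (fun x => _) = (fun=> 0)); last first.
    by apply/funext => y; move/is_diag_mxP : (ldd y) => ->.
  by apply: complexP; rewrite /= /Rintegral integral0.
have [B' B'0 hB'] := log_derivative_bounded.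
have bk k l := birkhoff_cvgC (mF 1) (hFmu 1) (uniquely_ergodic_ergodic ue)
  (dI k l).1 (fun x => hB' x k l).
rewrite /limit_along.
have : {ae muX, forall x : borel X, forall k l,
   Normc.normc (n%:R^-1 * birkhoff_sum (T := borel X) (F 1) (fun x => ld x k l) n x - cint muX (fun x : borel X => ld x k l)) @[n --> \oo] --> (0 : R)}.
  by apply: filter_forall => k; apply: filter_forall => l.
apply: filterS => x h k l; have := h k l; apply: cvg_trans; apply: near_eq_cvg; apply: filterE => N.
rewrite MbarE; congr (Normc.normc (_ - _)); rewrite mxE; congr (_ * _).
rewrite cocycle_derivative_sum /birkhoff_sum summxE; apply: eq_bigr => a _.
by rewrite iter_flow (comm (Q a x))// -mulmxA (repU hPi) mulmx1.
Qed.

Lemma conj_rep_bound (g : G) (M : 'M[C]_d) (b : R) k l :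
  (forall k l, Normc.normc (M k l) <= b) ->
  Normc.normc ((Pi g *m M *m (Pi g)^t*) k l) <= d%:R * (d%:R * b).
Proof.
move=> hM; have b0' : 0 <= b by exact: le_trans (normc_ge0 _) (hM k l).
rewrite mxE (le_trans (normc_sum _ _ _))// mulr_natl -[X in _ <= _ *+ X](card_ord d) -sumr_const ler_sum// => a _.
rewrite Normc.normcM -[leRHS]mulr1 ler_pM ?normc_ge0//; last first.
  by rewrite -(repV hPi); exact: rep_entry.
rewrite mxE (le_trans (normc_sum _ _ _))// mulr_natl -[X in _ <= _ *+ X](card_ord d) -sumr_const ler_sum// => a' _.
by rewrite Normc.normcM -[leRHS]mul1r ler_pM ?normc_ge0//; exact: rep_entry.
Qed.

Lemma cocycle_average_bound : exists2 B : R, 0 <= B & forall N x k l,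
  Normc.normc ((N%:R^-1 *: (Q' N x *m (Q N x)^t*)) k l) <= B.
Proof.
have [B B0 hB] := log_derivative_bounded.
exists (d%:R * (d%:R * B)); first by rewrite !mulr_ge0.
move=> N x k l; rewrite mxE Normc.normcM natCV normc_real ger0_norm//.
rewrite cocycle_derivative_sum summxE.
have [->|N0] := posnP N; first by rewrite invr0 mul0r !mulr_ge0.
rewrite ler_pdivrMl ?ltr0n// (le_trans (normc_sum _ _ _))//.
have -> : N%:R * (d%:R * (d%:R * B)) = \sum_(a < N) d%:R * (d%:R * B) by rewrite sumr_const card_ord mulr_natl.
apply: ler_sum => a _.
by apply: conj_rep_bound => *; exact: hB.
Qed.

(** The matrices [Pi (phi x)] are unitary, so the derivative of
[Pi (phi x) *m (Pi (phi x))^t*] along the flow vanishes. *)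
Lemma log_derivative_antihermitian x : (ld x)^t* = - ld x.
Proof.
have cJ (M M' : X -> 'M[C]_d) : mx_flow_smooth M M' ->
    mx_flow_smooth (fun x => (M x)^t*) (fun x => (M' x)^t*).
  move=> h k l; under eq_fun do rewrite !mxE; under [X in flow_smooth _ _ X]eq_fun do rewrite !mxE.
  exact: (flow_smoothJ (h l k)).
have h := mx_flow_smoothM rep_cocycle_smooth (cJ _ _ rep_cocycle_smooth).
apply/eqP; rewrite -subr_eq0 opprK addrC; apply/eqP/matrixP => k l.
have [_ _ _ /(_ x) hx] := h k l; rewrite [RHS]mxE.
have -> : (ld x + (ld x)^t*) k l = (ld x *m Pi (phi x) *m (Pi (phi x))^t* + Pi (phi x) *m (ld x *m Pi (phi x))^t*) k l.
  by rewrite trmx_mul map_mxM /= [Pi (phi x) *m (_ *m _)]mulmxA (repU hPi) mul1mx -mulmxA (repU hPi) mulmx1.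
apply: ctangent_uniq hx _.
by under eq_fun do rewrite (repU hPi); exact: ctangent_cst.
Qed.

Lemma cocycle_derivative_antihermitian N x :
  (Q' N x *m (Q N x)^t*)^t* = - (Q' N x *m (Q N x)^t*).
Proof.
rewrite cocycle_derivative_sum raddf_sum /= map_mx_sum -sumrN; apply: eq_bigr => a _.
rewrite !trmx_mul !map_mxM /= -[(ld _)^t*]/((ld (F a%:R x))^t*) log_derivative_antihermitian.
by rewrite trmxCK mulNmx mulmxN mulmxA.
Qed.

Lemma left_translate_preserves h :
  measurable_fun setT (fun p : borel X * borel G => (p.1, (h * (p.2 : G))%g) : borel X * borel G) /\
  preserves mu (fun p : borel X * borel G => (p.1, (h * (p.2 : G))%g) : borel X * borel G).
Proof.
have mh : measurable_fun setT (fun p : borel X * borel G => (p.1, (h * (p.2 : G))%g) : borel X * borel G).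
  apply: measurable_fun_pair => //.
  apply: (@continuous_borel_prod X G G (fun p => (h * p.2)%g)) => //; first exact: group_2nd hG.
  apply: (continuous_mulg (group_mulc hG)); first exact: cst_continuousG.
  by move=> p; exact: cvg_snd.
split => // A mA; rewrite !prod_measureE//; last by rewrite -[X in measurable X]setTI; exact: mh.
apply: eq_integral => x _; rewrite -(hmuG h (measurable_xsection x mA)); congr (muG _).
Qed.

(** The matrices [Psi (x, g) = Pi g *m ld x *m (Pi g)^t*] are the images of
[Ad_g Mphi x] under [drep], and their Birkhoff sums along the orbit of [(x, g)]
are the sums over the cocycle at [x] conjugated by [Pi g]. For almost every [x]
some [g] gives convergence to the mean of [Psi]; since this mean commutes with
the representation, the conjugation by [Pi g] can be undone. *)
Lemma skew_limit : uniquely_ergodic mu T ->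
  let Mbar := drep cG Pi (Mstar_skew F phi cG muX muG) in
  limit_along Mbar /\ forall x, Mbar *m Pi (phi x) = Pi (phi x) *m Mbar.
Proof.
move=> ue Mbar.
pose Psi (p : borel X * borel G) : 'M[C]_d := Pi p.2 *m ld p.1 *m (Pi p.2)^t*.
have PsiE p : Psi p = drep cG Pi (Ad cG p.2 (Mphi F phi cG p.1)) by rewrite log_derivative_Ad.
have [mZ [B hB]] := Ad_Mphi_measurable_bounded.
have dI k l := drep_integral cG Pi mu mZ hB k l.
have mPsi k l : cmeas (fun p => Psi p k l) by have := (dI k l).1; under eq_fun do rewrite -PsiE.
have MbarE k l : Mbar k l = cint mu (fun p => Psi p k l).
  by under [in RHS]eq_fun do rewrite PsiE; rewrite (dI k l).2.
have [B' B'0 hB'] := log_derivative_bounded.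
have bPsi k l p : Normc.normc (Psi p k l) <= d%:R * (d%:R * B').
  by apply: conj_rep_bound => *; exact: hB'.
have iPsi k l : cintegrable mu (fun p => Psi p k l).
  apply: (@cintegrable_le _ _ _ _ _ (cst (d%:R * (d%:R * B')))) => //.
  by apply: (@bounded_integrable _ _ _ mu _ `|d%:R * (d%:R * B')|).
have inv h : Pi h *m Mbar *m (Pi h)^t* = Mbar.
  apply/matrixP => k l.
  have [mh ph] := left_translate_preserves h.
  have -> : Mbar k l = cint mu (fun p : borel X * borel G => Psi (p.1, (h * (p.2 : G))%g) k l).
    rewrite MbarE; have [i1 i2] := iPsi k l; rewrite /cint.
    by rewrite -(Rintegral_preserves mh ph i1) -(Rintegral_preserves mh ph i2).
  have E p : Psi (p.1, (h * (p.2 : G))%g) k l = \sum_b \sum_a (Pi h k a * (Pi h)^t* b l) * Psi p a b.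
    have -> : Psi (p.1, (h * (p.2 : G))%g) = Pi h *m Psi p *m (Pi h)^t*.
      by rewrite /Psi /= (repM hPi) trmx_mul map_mxM /= !mulmxA.
    rewrite mxE; apply: eq_bigr => b _; rewrite mxE big_distrl /=; apply: eq_bigr => a _.
    by rewrite mulrAC.
  under [in RHS]eq_fun do rewrite E.
  have iZ a b (c : C) : cintegrable mu (fun p => c * Psi p a b) by exact: cintegrableZ.
  rewrite cint_sum; last by move=> b _; apply: cintegrable_sum.
  rewrite mxE; apply: eq_bigr => b _; rewrite cint_sum// mxE big_distrl /=; apply: eq_bigr => a _.
  by rewrite cintZ// MbarE mulrAC.
have commM h : Mbar *m Pi h = Pi h *m Mbar.
  by rewrite -{1}(inv h) -mulmxA (repUV hPi) mulmx1.
split; last by move=> x.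
have fc : continuous (F 1) by move=> x; exact: (flow_continuousr hF).
have [mT pT] := skew_product_preserves X2 (group_2nd hG) (group_mulc hG) (group_invc hG) hmuG
  fc (cocycle_continuous hphi) (hFmu 1).
have bk k l := birkhoff_cvgC mT pT (uniquely_ergodic_ergodic ue) (mPsi k l) (bPsi k l).
have : {ae mu, forall p, forall k l,
   Normc.normc (n%:R^-1 * birkhoff_sum T (fun p => Psi p k l) n p - cint mu (fun p => Psi p k l)) @[n --> \oo] --> (0 : R)}.
  by apply: filter_forall => k; apply: filter_forall => l.
move=> /ae_prod; rewrite /limit_along; apply: filterS => x /ae_inhabited[g hg] k l.
pose E N := N%:R^-1 *: (Q' N x *m (Q N x)^t*).
have EE N a b : (Pi g *m E N *m (Pi g)^t*) a b = N%:R^-1 * birkhoff_sum T (fun p => Psi p a b) N (x, g).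
  rewrite /E -scalemxAr -scalemxAl mxE; congr (_ * _).
  rewrite cocycle_derivative_sum mulmx_sumr mulmx_suml summxE; apply: eq_bigr => i _.
  by rewrite iter_skew /Psi /= (repM hPi) trmx_mul map_mxM /= !mulmxA.
have MM : Mbar = (Pi g)^t* *m Mbar *m Pi g.
  by rewrite -mulmxA commM mulmxA (repUV hPi) mul1mx.
have DE N : E N - Mbar = (Pi g)^t* *m (Pi g *m E N *m (Pi g)^t* - Mbar) *m Pi g.
  rewrite mulmxBr mulmxBl -MM; congr (_ - _).
  by rewrite !mulmxA (repUV hPi) mul1mx -mulmxA (repUV hPi) mulmx1.
have DE' N : Normc.normc (E N k l - Mbar k l) <=
   \sum_b \sum_a Normc.normc (N%:R^-1 * birkhoff_sum T (fun p => Psi p a b) N (x, g) - cint mu (fun p => Psi p a b)).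
  have -> : E N k l - Mbar k l = (E N - Mbar) k l by rewrite [RHS]mxE [X in _ = _ + X]mxE.
  rewrite DE mxE (le_trans (normc_sum _ _ _))// ler_sum// => b _.
  rewrite Normc.normcM -[leRHS]mulr1 ler_pM ?normc_ge0//; last exact: rep_entry.
  rewrite mxE (le_trans (normc_sum _ _ _))// ler_sum// => a _.
  rewrite Normc.normcM -[leRHS]mul1r ler_pM ?normc_ge0//.
    by rewrite -(repV hPi); exact: rep_entry.
  by rewrite -EE -MbarE mxE [(- Mbar) a b]mxE.
apply: (@squeeze_cvgr _ _ _ _ (cst 0) (fun N => \sum_b \sum_a Normc.normc (N%:R^-1 * birkhoff_sum T (fun p => Psi p a b) N (x, g) - cint mu (fun p => Psi p a b)))).
- by apply: filterE => N; rewrite normc_ge0 /=; exact: DE'.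
- exact: cvg_cst.
- have h : (fun N => \sum_b \sum_a Normc.normc (N%:R^-1 * birkhoff_sum T (fun p => Psi p a b) N (x, g) - cint mu (fun p => Psi p a b)))
      @ \oo --> \sum_(b < d) \sum_(a < d) (0 : R).
    apply: cvg_sum_seq => b; apply: cvg_sum_seq => a.
    exact: hg.
  have z : \sum_(b < d) \sum_(a < d) (0 : R) = 0 by rewrite big1// => b _; rewrite big1.
  by rewrite z in h.
Qed.

(** A limit of averages of antihermitian matrices. *)
Lemma limit_antihermitian Mbar : limit_along Mbar -> Mbar^t* = - Mbar.
Proof.
move=> /ae_inhabited[x hx]; apply/matrixP => k l; rewrite !mxE.
pose E N := N%:R^-1 *: (Q' N x *m (Q N x)^t*).
have EJ N : (E N l k)^*%C = - E N k l.
  have EE : ((Q' N x *m (Q N x)^t*) l k)^*%C = - (Q' N x *m (Q N x)^t*) k l.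
    have := congr1 (fun M : 'M[C]_d => M k l) (cocycle_derivative_antihermitian N x).
    by rewrite [LHS]mxE [X in X = _ -> _]/= [X in Num.conj X]mxE [RHS]mxE.
  have SE a b : E N a b = N%:R^-1 * (Q' N x *m (Q N x)^t*) a b by rewrite /E mxE.
  rewrite !SE conjcM EE mulrN; congr (- (_ * _)).
  by rewrite natCV; apply: complexP; rewrite /= ?oppr0.
have h1 := hx l k; have h2 := hx k l.
suff : Normc.normc ((Mbar l k)^*%C + Mbar k l) = 0.
  by move=> /Normc.eq0_normc/eqP; rewrite addr_eq0 => /eqP.
apply/eqP; rewrite eq_le normc_ge0 andbT; apply/ler_addgt0Pr => e e0; rewrite add0r.
have e2 : 0 < e / 2 by rewrite divr_gt0.
move/cvgrPdist_lt/(_ _ e2) : h1 => h1; move/cvgrPdist_lt/(_ _ e2) : h2 => h2.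
have [N [{}h1 {}h2]] := filter_ex (filterI h1 h2).
move: h1 h2; rewrite !sub0r !normrN !ger0_norm ?normc_ge0// -/(E N) => /ltW h1 /ltW h2.
have -> : (Mbar l k)^*%C + Mbar k l = - (E N l k - Mbar l k)^*%C - (E N k l - Mbar k l).
  by rewrite conjcD conjcN EJ; ring.
rewrite (le_trans (normcD _ _))// !normcNE normcJE [e]splitr.
exact: lerD.
Qed.

End Cocycle.

(** * Density of the functions differentiable along the flow *)

Import HBNNSimple.

Section Density.
Variables (R : realType) (n : nat) (X : ptopologicalType) (cX : X -> chart 'rV[R]_n X).
Hypothesis hX : compact_manifold cX.
Variable muX : probability (borel X) R.
Variable F : R -> X -> X.
Hypothesis hF : C1_flow cX F.
Local Notation C := R[i].
Local Notation line := (line_atlas (0 : R)).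
Implicit Types f g u : X -> C.

Let gX : good_atlas cX. Proof. exact: manifold_good_atlas. Qed.
Let compX : compact [set: X]. Proof. by case: hX. Qed.
Let F0 (x : borel X) : F 0 x = x := flow0 hF x.
Let FD s t (x : borel X) : F (s + t) x = F s (F t x) := flowD hF s t x.
Let mF t : measurable_fun setT (F t : borel X -> borel X).
Proof. exact: (measurable_flow hF t). Qed.

Definition smooth_along u := exists u', flow_smooth (T := borel X) F u u'.

Lemma smooth_along_cst (a : C) : smooth_along (fun=> a).
Proof. by exists (fun=> 0); exact: flow_smooth_cst. Qed.

Lemma smooth_alongD f g : smooth_along f -> smooth_along g -> smooth_along (fun x => f x + g x).
Proof. by move=> [f' hf] [g' hg]; eexists; exact: flow_smoothD hf hg. Qed.

Lemma smooth_alongM f g : smooth_along f -> smooth_along g -> smooth_along (fun x => f x * g x).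
Proof. by move=> [f' hf] [g' hg]; eexists; exact: (flow_smoothM F0 hf hg). Qed.

Lemma smooth_along_exp f k : smooth_along f -> smooth_along (fun x => f x ^+ k).
Proof.
move=> hf; elim: k => [|k IH]; first by under eq_fun do rewrite expr0; exact: smooth_along_cst.
by under eq_fun do rewrite exprS; exact: smooth_alongM.
Qed.

Lemma smooth_along_prod I (r : seq I) (f : I -> X -> C) : (forall i, smooth_along (f i)) ->
  smooth_along (fun x => \prod_(i <- r) f i x).
Proof.
move=> hf; elim: r => [|i r IH]; first by under eq_fun do rewrite big_nil; exact: smooth_along_cst.
by under eq_fun do rewrite big_cons; exact: smooth_alongM.
Qed.

Lemma smooth_along_L2 f : smooth_along f -> L2 muX f.
Proof. by move=> [f' hf]; exact: (flow_smooth_L2 muX hf). Qed.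

Lemma smooth_along_bump (rho : X -> R) : (forall x, smooth_at (cX x) line rho x) ->
  (forall x, 0 <= rho x <= 1) -> smooth_along (fun x => (rho x)%:C%C).
Proof.
move=> rs rb.
have ws : smooth_family cX (fun q : R * X => rho (F q.1 q.2)).
  move=> x; have [g2 _ D _ _] := gX (F 0 x).
  have [g1 _ _ _ _] := prod_good_atlas (@line_good_atlas R) gX (0, x).
  exact: (smooth_at_comp (f := fun p : R * X => F p.1 p.2) (g := rho) g1 g2 (smooth_at_flow hX hF D) (rs (F 0 x))).
have rc : continuous rho by move=> x; have [_ []] := rs x.
exists (fun x => Complex ((fun t => rho (F t x))^`()%classic 0) 0); split.
- by split; [exact: continuous_borelR|exact: measurable_cst].
- by exists 1 => x; rewrite normc_real ger0_norm; case/andP: (rb x).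
- have [L L0 hL] := smooth_family_lipschitz compX ws.
  exists L => //; apply: filterS hL => t h x.
  have hx : `|rho (F t x) - rho x| <= L * `|t| by have := h x; rewrite /= F0.
  have -> : (rho (F t x))%:C%C - (rho x)%:C%C = (rho (F t x) - rho x)%:C%C by rewrite rmorphB.
  by rewrite normc_real.
- move=> x; apply/ctangentP; split => /=.
    exact: (@smooth_family_derive _ _ _ _ gX _ x ws).
  by under eq_fun do rewrite subrr mulr0; exact: cvg_cst.
Qed.

Definition approximable f := L2 muX f /\ forall e : R, 0 < e ->
  exists2 u, smooth_along u & L2norm muX (fun x => f x - u x) < e.

Lemma smooth_approximable u : smooth_along u -> approximable u.
Proof.
move=> hu; split; first exact: smooth_along_L2.
move=> e e0; exists u => //.
rewrite (ae_eq_L2norm0 (mu := muX) (f := fun x : borel X => u x - u x))//; last by apply: aeW => x; rewrite subrr.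
by apply: cmeasB; exact: L2_cmeas (smooth_along_L2 hu).
Qed.

Lemma approximable_lim f (g : nat -> X -> C) : L2 muX f -> (forall k, approximable (g k)) ->
  L2norm muX (fun x => f x - g k x) @[k --> \oo] --> (0 : R) -> approximable f.
Proof.
move=> fL ga fg; split=> // e e0; have e2 : 0 < e / 2 by rewrite divr_gt0.
have /cvgrPdist_lt/(_ _ e2)[k _ /(_ k (leqnn _))] := fg.
rewrite sub0r normrN ger0_norm ?L2norm_ge0// => hk.
have [gL /(_ _ e2)[u us hu]] := ga k; exists u => //.
have uL := smooth_along_L2 us.
rewrite (_ : (fun x => f x - u x) = (fun x => (f x - g k x) + (g k x - u x))); last first.
  by apply/funext => x; rewrite addrA subrK.
by rewrite (le_lt_trans (L2norm_triangle (L2B fL gL) (L2B gL uL)))// [e]splitr ltrD.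
Qed.

Lemma approximableD f g : approximable f -> approximable g -> approximable (fun x => f x + g x).
Proof.
move=> [fL ha] [gL hb]; split; first exact: L2D.
move=> e e0; have e2 : 0 < e / 2 by rewrite divr_gt0.
have [u us hu] := ha _ e2; have [v vs hv] := hb _ e2.
exists (fun x => u x + v x); first exact: smooth_alongD.
rewrite (_ : (fun x => f x + g x - (u x + v x)) = (fun x => (f x - u x) + (g x - v x))); last first.
  by apply/funext => x; rewrite opprD addrACA.
have uL := smooth_along_L2 us; have vL := smooth_along_L2 vs.
by rewrite (le_lt_trans (L2norm_triangle (L2B fL uL) (L2B gL vL)))// [e]splitr ltrD.
Qed.

Lemma approximableZ (a : C) f : approximable f -> approximable (fun x => a * f x).
Proof.
move=> [fL ha]; split; first exact: L2Z.
move=> e e0; have [u us hu] := ha (e / (Normc.normc a + 1)) (divr_gt0 e0 (ltr_wpDl (normc_ge0 a) ltr01)).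
exists (fun x => a * u x); first by apply: smooth_alongM => //; exact: smooth_along_cst.
have uL := smooth_along_L2 us.
rewrite (_ : (fun x => a * f x - a * u x) = (fun x => a * (f x - u x))); last first.
  by apply/funext => x; rewrite mulrBr.
rewrite (L2normZ a (L2B fL uL)).
have [a0|a0] := eqVneq (Normc.normc a) 0; first by rewrite a0 mul0r.
have ap : 0 < Normc.normc a by rewrite lt_neqAle eq_sym a0 normc_ge0.
apply: (@lt_trans _ _ (Normc.normc a * (e / (Normc.normc a + 1)))); first by rewrite ltr_pM2l.
rewrite mulrCA -[ltRHS]mulr1 ltr_pM2l// ltr_pdivrMr ?mul1r ?ltrDl//.
exact: ltr_wpDl (normc_ge0 a) ltr01.
Qed.

Lemma approximable_sum I (r : seq I) (f : I -> X -> C) : (forall i, approximable (f i)) ->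
  approximable (fun x => \sum_(i <- r) f i x).
Proof.
move=> hf; elim: r => [|i r IH].
  by under eq_fun do rewrite big_nil; apply: smooth_approximable; exact: smooth_along_cst.
by under eq_fun do rewrite big_cons; exact: approximableD.
Qed.

(** Approximation is checked through dominated pointwise convergence. *)
Lemma approximable_dominated f h (g : nat -> X -> C) (b : R) : 0 <= b -> L2 muX f -> L2 muX h ->
  (forall k, approximable (g k)) ->
  (forall k x, Normc.normc (f x - g k x) <= b * Normc.normc (h x)) ->
  (forall x, Normc.normc (f x - g k x) @[k --> \oo] --> (0 : R)) -> approximable f.
Proof.
move=> b0 fL hL ga bg g0; apply: (approximable_lim fL ga).
apply: (@L2_dominated_cvg _ (borel X) R muX (fun k x => f x - g k x) h b) => //.
- by move=> k; apply: cmeasB; [exact: L2_cmeas fL|exact: L2_cmeas (ga k).1].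
- by apply: aeW => x; exact: g0.
Qed.

Lemma one_L2 : L2 muX (fun=> (1 : C)).
Proof. exact/smooth_along_L2/smooth_along_cst. Qed.

Local Notation ind A := (fun x => (\1_A x)%:C%C : C).

Lemma ind_cmeas (A : set X) : measurable (A : set (borel X)) -> cmeas (T := borel X) (ind A).
Proof. by move=> mA; split; [exact: measurable_indic|exact: measurable_cst]. Qed.

Lemma ind_L2 (A : set X) : measurable (A : set (borel X)) -> L2 muX (ind A).
Proof.
move=> mA; apply: bounded_L2; first exact: ind_cmeas.
by exists 1 => x; rewrite normc_real indicE; case: (x \in A); rewrite ?normr1 ?normr0.
Qed.

(** The indicator of an open set is the limit of products built from countably
many bumps supported in it. *)
Lemma open_approximable (O : set X) : open O -> approximable (ind O).
Proof.
move=> oO; have [_ _ [BX cB [oB bB]] _] := hX.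
have /countable_injP[nu nuinj] := cB.
(* a bump is chosen for each set of the countable basis on which some bump
   supported in [O] is positive *)
pose good (rho : X -> R) := [/\ smooth_along (fun x => (rho x)%:C%C),
  forall x, 0 <= rho x <= 1 & forall x, ~ O x -> rho x = 0].
pose Q k := exists rho, good rho /\ exists2 U, BX U & nu U = k /\ forall x, U x -> 0 < rho x.
pose rho k : X -> R := if pselect (Q k) is left h then sval (cid h) else fun=> 0.
have rgood k : good (rho k).
  rewrite /rho; case: pselect => [h|_]; first by case: cid => r [].
  by split=> //; [exact: smooth_along_cst|by move=> x; rewrite lexx ler01].
have rpos x : O x -> exists k, 0 < rho k x.
  move=> Ox; have [r [rs rb rx r0]] := bump_function hX (open_nbhs_nbhs (conj oO Ox)).
  have rc : continuous r by move=> y; have [_ []] := rs y.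
  have opos : open [set y | 0 < r y].
    by apply: (@open_comp _ _ r [set s | 0 < s]) => [y _|]; [exact: rc|exact: open_gt].
  have [U [BU Ux] US] := bB x _ (open_nbhs_nbhs (conj opos rx)).
  have Qn : Q (nu U).
    exists r; split; first by split=> //; exact: smooth_along_bump.
    by exists U.
  exists (nu U); rewrite /rho; case: pselect => // h; case: cid => r' [_ [V BV [nuV hV]]] /=.
  by apply: hV; rewrite (nuinj V U) ?inE.
(* the growing exponent makes the product tend to 0 as soon as one of the bumps
   is positive at [x] *)
pose P k x : R := \prod_(i < k) (1 - rho i x) ^+ k.
have Pb k x : 0 <= P k x <= 1.
  have b01 i : 0 <= (1 - rho i x) ^+ k <= 1.
    have [_ rb _] := rgood i; have /andP[r0 r1] := rb x.
    by rewrite exprn_ge0 ?subr_ge0//= exprn_ile1// ?subr_ge0// lerBlDr lerDl.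
  apply/andP; split; first by apply: prodr_ge0 => i _; case/andP: (b01 i).
  by apply: prodr_ile1 => i _; exact: b01.
have Ps k : smooth_along (fun x => (P k x)%:C%C).
  rewrite (_ : (fun x => _) = (fun x => \prod_(i < k) (1 + (-1) * (rho i x)%:C%C) ^+ k)); last first.
    apply/funext => x; rewrite rmorph_prod; apply: eq_bigr => i _.
    by rewrite rmorphXn rmorphB rmorph1 mulN1r.
  apply: smooth_along_prod => i; apply: smooth_along_exp; apply: smooth_alongD; first exact: smooth_along_cst.
  by apply: smooth_alongM; [exact: smooth_along_cst|have [] := rgood i].
have mO : measurable (O : set (borel X)) by exact: open_borel.
have PO k x : ~ O x -> P k x = 1.
  by move=> nO; rewrite /P big1// => i _; have [_ _ ->] := rgood i; rewrite ?subr0 ?expr1n.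
have P0 x : O x -> P k x @[k --> \oo] --> (0 : R).
  move=> /rpos[i ri]; have [_ rb _] := rgood i; have /andP[r0 r1] := rb x.
  apply: (@squeeze_cvgr _ _ _ _ (cst 0) (fun k => (1 - rho i x) ^+ k)); last 2 first.
  - exact: cvg_cst.
  - by apply: cvg_expr; rewrite ger0_norm ?subr_ge0// gtrBl.
  exists i.+1 => // k /= ik; have /andP[-> _] := Pb k x => /=.
  rewrite /P (bigD1 (Ordinal ik))//= ler_piMr ?exprn_ge0 ?subr_ge0//.
  apply: prodr_ile1 => a _; have [_ rb' _] := rgood a; have /andP[a0 a1] := rb' x.
  by rewrite exprn_ge0 ?subr_ge0//= exprn_ile1// ?subr_ge0// lerBlDr lerDl.
have dE k x : ind O x - (1 + (-1) * (P k x)%:C%C) = (\1_O x - (1 - P k x))%:C%C.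
  by rewrite !rmorphB rmorph1 mulN1r.
apply: (@approximable_dominated _ (fun=> 1) (fun k x => 1 + (-1) * (P k x)%:C%C) 1) => //.
- exact: ind_L2.
- exact: one_L2.
- move=> k; apply: smooth_approximable; apply: smooth_alongD; first exact: smooth_along_cst.
  by apply: smooth_alongM => //; exact: smooth_along_cst.
- move=> k x; rewrite dE normc_real mul1r Normc.normc1; have /andP[p0 p1] := Pb k x.
  have [Ox|nOx] := pselect (O x).
    by rewrite indicE mem_set// opprB addrC subrK ger0_norm.
  by rewrite indicE memNset// PO// subrr subr0 normr0.
- move=> x; under eq_fun do rewrite dE normc_real.
  have [Ox|nOx] := pselect (O x).
    have := P0 x Ox; apply: cvg_trans; apply: near_eq_cvg; apply: filterE => k.
    have /andP[p0 p1] := Pb k x.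
    by rewrite indicE mem_set// opprB addrC subrK ger0_norm.
  by under eq_fun do rewrite indicE memNset// PO// subrr subr0 normr0; exact: cvg_cst.
Qed.

(** The open sets are stable under intersection and generate the Borel sets;
complements and countable disjoint unions preserve approximability. *)
Lemma measurable_approximable (A : set X) : measurable (A : set (borel X)) -> approximable (ind A).
Proof.
move=> mA; apply: (@dynkin_induction _ (borel X) (@open X) (fun A => approximable (ind A))) => //.
- by move=> U V; exact: openI.
- by apply: open_approximable; exact: openT.
- by move=> U; exact: open_approximable.
- move=> S mS hS; rewrite (_ : ind (~` S) = (fun x => 1 + (-1) * ind S x)); last first.
    apply/funext => x; rewrite !indicE in_setC; case: (x \in S) => /=.
      by rewrite mulN1r rmorph1 subrr rmorph0.
    by rewrite rmorph0 mulr0 addr0 rmorph1.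
  apply: approximableD; last exact: approximableZ.
  by apply: smooth_approximable; exact: smooth_along_cst.
- move=> S mS tS hS.
  have mU : measurable (\bigcup_k S k : set (borel X)) by exact: bigcup_measurable.
  pose s k x : R := \sum_(i < k) \1_(S i) x.
  have s1 k x i : S i x -> s k x = (i < k)%N%:R.
    move=> Six; have E a : (\1_(S a) x : R) = (a == i)%:R.
      rewrite indicE; have [->|ai] := eqVneq a i; first by rewrite mem_set.
      rewrite memNset// => Sax; move/trivIsetP : tS => /(_ a i I I ai) /seteqP[+ _].
      by move=> /(_ x (conj Sax Six)).
    rewrite /s (eq_bigr (fun a : 'I_k => ((a : nat) == i)%:R)) => [|a _]; last exact: E.
    case: ltnP => ik; last first.
      by rewrite big1// => a _; rewrite ltn_eqF// (leq_trans (ltn_ord a)).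
    rewrite (bigD1 (Ordinal ik))//= eqxx big1 ?addr0// => a.
    by rewrite -val_eqE /= => /negbTE ->.
  have s0 k x : ~ (\bigcup_k S k) x -> s k x = 0.
    by move=> nS; rewrite /s big1// => a _; rewrite indicE memNset// => Sax; apply: nS; exists a.
  have dE k x : ind (\bigcup_k S k) x - \sum_(i < k) ind (S i) x = (\1_(\bigcup_k S k) x - s k x)%:C%C.
    by rewrite rmorphB rmorph_sum.
  apply: (@approximable_dominated _ (fun=> 1) (fun k x => \sum_(i < k) ind (S i) x) 1) => //.
  + exact: ind_L2.
  + exact: one_L2.
  + by move=> k; exact: approximable_sum.
  + move=> k x; rewrite dE normc_real Normc.normc1 mul1r.
    have [[i _ Six]|nS] := pselect ((\bigcup_k S k) x); last first.
      by rewrite indicE memNset// s0// subrr normr0.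
    rewrite indicE mem_set; last by exists i.
    by rewrite (s1 k x i Six); case: (i < k)%N; rewrite ?subrr ?subr0 ?normr0 ?normr1.
  + move=> x; under eq_fun do rewrite dE normc_real.
    have [[i _ Six]|nS] := pselect ((\bigcup_k S k) x); last first.
      by under eq_fun do rewrite indicE memNset// s0// subrr normr0; exact: cvg_cst.
    apply: cvg_near_cst; exists i.+1 => // k /= ik.
    rewrite indicE mem_set; last by exists i.
    by rewrite (s1 k x i Six) ik subrr normr0.
Qed.

(** Simple functions below [f] converge to it and are dominated by it. *)
Lemma nonneg_approximable (f : X -> R) : (forall x, 0 <= f x) ->
  L2 muX (fun x => (f x)%:C%C) -> approximable (fun x => (f x)%:C%C).
Proof.
move=> f0 fL.
have mf : measurable_fun (setT : set (borel X)) (EFin \o f).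
  by apply/measurable_EFinP; exact: (L2_cmeas fL).1.
pose g := nnsfun_approx measurableT mf.
have gc x : EFin \o (fun k => g k x) @ \oo --> (EFin \o f) x.
  by apply: cvg_nnsfun_approx => // y _; rewrite lee_fin.
have gf k x : g k x <= f x.
  by rewrite -lee_fin /g nnsfun_approxE; apply: le_approx => // y _; rewrite lee_fin.
have dE k x : (f x)%:C%C - (g k x)%:C%C = (f x - g k x)%:C%C :> C by rewrite rmorphB.
apply: (@approximable_dominated _ (fun x => (f x)%:C%C) (fun k x => (g k x)%:C%C) 1) => //.
- move=> k; pose s : seq R := finmap.enum_fset (fset_set (range (g k))).
  rewrite (_ : (fun x => _) = (fun x =>
    \sum_(i < size s) (s`_i)%:C%C * ind (g k @^-1` [set s`_i]) x)); last first.
    apply/funext => x; rewrite fimfunEord rmorph_sum; apply: eq_bigr => i _.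
    by rewrite rmorphM.
  apply: approximable_sum => i; apply: approximableZ; apply: measurable_approximable.
  exact: measurable_sfunP.
- move=> k x; rewrite dE !normc_real mul1r !ger0_norm// ?subr_ge0// lerBlDr lerDl.
  exact: fun_ge0.
- move=> x; have h : g k x @[k --> \oo] --> f x by exact: (fine_cvg (gc x)).
  have h2 : ((f x - g k x : R^o) @[k --> \oo] --> (f x - f x : R^o)).
    by apply: cvgB; [exact: cvg_cst|exact: h].
  rewrite subrr in h2; move: h2; apply: cvg_trans; apply: near_eq_cvg; apply: filterE => k.
  by rewrite dE normc_real ger0_norm ?subr_ge0.
Qed.

Lemma L2_approximable f : L2 muX f -> approximable f.
Proof.
move=> fL; have [mre mim] := L2_cmeas fL.
have key (v : X -> R) : measurable_fun (setT : set (borel X)) v ->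
    (forall x, `|v x| <= Normc.normc (f x)) -> approximable (fun x => (v x)%:C%C).
  move=> mv vf.
  have part (w : X -> R) : measurable_fun (setT : set (borel X)) w -> (forall x, 0 <= w x) ->
      (forall x, w x <= `|v x|) -> approximable (fun x => (w x)%:C%C).
    move=> mw w0 wv; apply: nonneg_approximable => //.
    apply: (@L2_le _ (borel X) R muX _ (fun x => sqn (f x))); last 2 first.
    - exact: L2_integrable fL.
    - move=> x; rewrite -!sqr_normcE normc_real lerXn2r ?nnegrE ?normc_ge0// ger0_norm//.
      exact: le_trans (wv x) (vf x).
    - by split=> //; exact: measurable_cst.
  rewrite (_ : (fun x => _) = (fun x => (Num.max (v x) 0)%:C%C + (-1) * (Num.max (- v x) 0)%:C%C)); last first.
    apply/funext => x; rewrite mulN1r -rmorphB; congr (_%:C%C).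
    by case: (leP (v x) 0) => h; case: (leP (- v x) 0) => h'; lra.
  apply: approximableD; last apply: approximableZ; apply: part.
  - exact: measurable_maxr.
  - by move=> x; rewrite le_max lexx orbT.
  - by move=> x; rewrite ge_max ler_norm normr_ge0.
  - by apply: measurable_maxr => //; exact: measurableT_comp.
  - by move=> x; rewrite le_max lexx orbT.
  - by move=> x; rewrite ge_max normr_ge0 andbT -normrN ler_norm.
rewrite (_ : f = (fun x => (complex.Re (f x))%:C%C + Complex 0 1 * (complex.Im (f x))%:C%C)); last first.
  by apply/funext => x; apply: complexP; rewrite !reimE /= ?mul0r ?mulr0 ?mul1r ?subr0 ?addr0 ?add0r.
apply: approximableD; last apply: approximableZ; apply: key => // x.
  exact: Re_le_normc.
exact: Im_le_normc.
Qed.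

End Density.

(** * Weighted composition operators on vector-valued functions *)

Section VectorFunctions.
Context dT (T : measurableType dT) (R : realType).
Variable mu : probability T R.
Variable F : R -> T -> T.
Hypothesis F0 : forall x, F 0 x = x.
Hypothesis FD : forall s t x, F (s + t) x = F s (F t x).
Hypothesis mF : forall t, measurable_fun setT (F t).
Hypothesis pF : forall t, preserves mu (F t).
Variable d : nat.
Local Notation C := R[i].
Local Notation vec := ('I_d -> T -> C).
Implicit Types (f g : vec) (M : T -> 'M[C]_d).

Definition bounded_mx M := (forall k l, cmeas (fun x => M x k l)) /\
  exists B : R, forall x k l, Normc.normc (M x k l) <= B.

(** The weighted composition operators [f |-> M (f \o F s)] on vector valued
functions, to which all operators of the statement reduce. *)
Definition mul_shift M (s : R) f : vec := fun k x => \sum_l M x k l * f l (F s x).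

Lemma entrywise_bound M : (forall k l, exists B : R, forall x, Normc.normc (M x k l) <= B) ->
  exists B : R, forall x k l, Normc.normc (M x k l) <= B.
Proof.
move=> H; exists (\sum_k \sum_l `|sval (cid (H k l))|) => x k l.
have hB := svalP (cid (H k l)); rewrite (le_trans (hB x))// (le_trans (ler_norm _))//.
rewrite (bigD1 k)//= (bigD1 l)//= -addrA lerDl addr_ge0// sumr_ge0// => *.
by apply: sumr_ge0.
Qed.

Lemma bounded_mx_cst (M : 'M[C]_d) : bounded_mx (fun=> M).
Proof.
split; first by move=> k l; exact: cmeas_cst.
by apply: entrywise_bound => k l; exists (Normc.normc (M k l)).
Qed.

Lemma mul_shift_L2 M s f : bounded_mx M -> (forall k, L2 mu (f k)) ->
  forall k, L2 mu (mul_shift M s f k).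
Proof.
move=> [mM [B hB]] fL k; apply: L2_sum => l _.
by apply: (@L2M _ _ _ _ _ _ B) => //; exact: (L2_preserves (mF s) (@pF s)).
Qed.

Definition size_vec f : R := \sum_k L2norm mu (f k).

Lemma size_vec_ge0 f : 0 <= size_vec f.
Proof. by apply: sumr_ge0 => k _; exact: L2norm_ge0. Qed.

Lemma L2norm_le_size f k : L2norm mu (f k) <= size_vec f.
Proof. by rewrite /size_vec (bigD1 k)//= lerDl sumr_ge0// => *; exact: L2norm_ge0. Qed.

Lemma mul_shift_le M s f (B : R) k : bounded_mx M -> (forall x k l, Normc.normc (M x k l) <= B) ->
  0 <= B -> (forall k, L2 mu (f k)) -> L2norm mu (mul_shift M s f k) <= B * size_vec f.
Proof.
move=> [mM _] hB B0 fL; have fLs l : L2 mu (fun x => f l (F s x)) by exact: (L2_preserves (mF s) (@pF s)).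
rewrite (le_trans (L2norm_sum _ _))//.
  by move=> l; apply: (@L2M _ _ _ _ _ _ B).
rewrite /size_vec mulr_sumr ler_sum// => l _.
by rewrite -(L2norm_preserves (mF s) (@pF s) (fL l)) L2normM.
Qed.

Lemma mul_shift_comp M N s t f : mul_shift M s (mul_shift N t f) =
  mul_shift (fun x => M x *m N (F s x)) (t + s) f.
Proof.
apply/funext => k; apply/funext => x; rewrite /mul_shift.
under eq_bigr do rewrite big_distrr /=.
rewrite exchange_big /=; apply: eq_bigr => a _; rewrite mxE big_distrl /=.
by apply: eq_bigr => l _; rewrite FD mulrA.
Qed.

Lemma mul_shift_ae M s f g : (forall k, f k = g k %[ae mu]) ->
  forall k, mul_shift M s f k = mul_shift M s g k %[ae mu].
Proof.
move=> fg k.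
have : {ae mu, forall x, forall l, f l x = g l x}.
  by apply: filter_forall => l; apply: filterS (fg l) => x; exact.
move=> /(ae_preserves (mF s) (@pF s)); apply: filterS => x h _.
by apply: eq_bigr => l _; rewrite h.
Qed.

Lemma mul_shift_lin M s (a : C) f g : mul_shift M s (fun k x => a * f k x + g k x) =
  (fun k x => a * mul_shift M s f k x + mul_shift M s g k x).
Proof.
apply/funext => k; apply/funext => x; rewrite /mul_shift mulr_sumr -big_split /=.
by apply: eq_bigr => l _; ring.
Qed.

Lemma inner_mul_adjoint M f g : bounded_mx M -> (forall k, L2 mu (f k)) -> (forall k, L2 mu (g k)) ->
  \sum_k inner mu (mul_shift M 0 f k) (g k) =
  \sum_k inner mu (f k) (mul_shift (fun x => (M x)^t*) 0 g k).
Proof.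
move=> [mM [B hB]] fL gL.
have fLM k l : L2 mu (fun x => M x k l * f l (F 0 x)).
  apply: (@L2M _ _ _ _ _ _ B) => //; exact: (L2_preserves (mF 0) (@pF 0)).
have gLM k l : L2 mu (fun x => (M x)^t* l k * g k (F 0 x)).
  apply: (@L2M _ _ _ _ _ _ B) => //; last exact: (L2_preserves (mF 0) (@pF 0)).
    by under eq_fun do rewrite !mxE; exact: cmeasJ.
  by move=> x; rewrite !mxE normcJE.
rewrite (eq_bigr (fun k => \sum_l inner mu (fun x => M x k l * f l (F 0 x)) (g k))); last first.
  by move=> k _; rewrite /mul_shift inner_suml.
rewrite exchange_big /=; apply: eq_bigr => l _.
rewrite /mul_shift inner_sumr//; apply: eq_bigr => k _.
rewrite !innerE; congr (cint mu _); apply/funext => x.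
have -> : (M x)^t* l k = (M x k l)^*%C by rewrite !mxE.
by rewrite !F0 conjcM; ring.
Qed.

Lemma seq_generatorD (f1 h1 f2 h2 : T -> C) : seq_generator mu F f1 h1 -> seq_generator mu F f2 h2 ->
  seq_generator mu F (fun x => f1 x + f2 x) (fun x => h1 x + h2 x).
Proof.
move=> [f1L h1L g1] [f2L h2L g2]; split; try exact: L2D.
move=> t t0 tN0.
have Lq u v k : L2 mu u -> L2 mu v -> L2 mu (fun x => Complex 0 (t k)^-1 * (u (F (t k) x) - u x) - v x).
  move=> uL vL; apply: L2B => //; apply: L2Z; apply: L2B => //; exact: (L2_preserves (mF _) (@pF _)).
pose q1 k := L2norm mu (fun x => Complex 0 (t k)^-1 * (f1 (F (t k) x) - f1 x) - h1 x).
pose q2 k := L2norm mu (fun x => Complex 0 (t k)^-1 * (f2 (F (t k) x) - f2 x) - h2 x).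
have z : q1 k + q2 k @[k --> \oo] --> (0 : R).
  by rewrite -[X in _ --> X]addr0; apply: cvgD; [exact: g1|exact: g2].
apply: (@squeeze_cvgr _ _ _ _ (cst 0) (fun k => q1 k + q2 k)) => //; last exact: cvg_cst.
apply: filterE => k; rewrite L2norm_ge0 /=.
rewrite (le_trans _ (L2norm_triangle (Lq _ _ k f1L h1L) (Lq _ _ k f2L h2L)))// le_eqVlt.
by apply/orP; left; apply/eqP; congr (L2norm mu _); apply/funext => x; ring.
Qed.

Lemma seq_generator_sum I (r : seq I) (f h : I -> T -> C) :
  (forall i, seq_generator mu F (f i) (h i)) ->
  seq_generator mu F (fun x => \sum_(i <- r) f i x) (fun x => \sum_(i <- r) h i x).
Proof.
move=> fh; elim: r => [|i r IH].
  under eq_fun do rewrite big_nil; under [X in seq_generator _ _ _ X]eq_fun do rewrite big_nil.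
  have := flow_smooth_generator mu F0 mF (flow_smooth_cst F (0 : C)).
  by under [X in seq_generator _ _ _ X]eq_fun do rewrite mulr0.
under eq_fun do rewrite big_cons; under [X in seq_generator _ _ _ X]eq_fun do rewrite big_cons.
exact: seq_generatorD.
Qed.

(** Leibniz rule, then symmetry of the generator. *)
Lemma generator_commutator M M' s (f h g r : vec) :
  (forall k l, flow_smooth F (fun x => M x k l) (fun x => M' x k l)) ->
  (forall k, seq_generator mu F (f k) (h k)) -> (forall k, seq_generator mu F (g k) (r k)) ->
  forall k, inner mu (h k) (mul_shift M s g k) - inner mu (f k) (mul_shift M s r k) =
    inner mu (f k) (mul_shift (fun x => Complex 0 1 *: M' x) s g k).
Proof.
move=> Ms fh gr k.
have gen : seq_generator mu F (mul_shift M s g k)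
    (fun x => mul_shift M s r k x + mul_shift (fun x => Complex 0 1 *: M' x) s g k x).
  rewrite (_ : (fun x => _) = (fun x => \sum_l (M x k l * r l (F s x) + Complex 0 1 * M' x k l * g l (F s x)))); last first.
    by apply/funext => x; rewrite /mul_shift -big_split /=; apply: eq_bigr => l _; rewrite mxE.
  apply: seq_generator_sum => l.
  exact: (seq_generator_mul F0 mF pF (Ms k l) (seq_generator_flow FD mF pF s (gr l))).
rewrite (seq_generator_symmetric F0 FD mF pF (fh k) gen).
have [fL _ _] := fh k.
have bM : bounded_mx M.
  split; first by move=> a b; case: (Ms a b).
  by apply: entrywise_bound => a b; case: (Ms a b).
have bM' : bounded_mx (fun x => Complex 0 1 *: M' x).
  split.
    move=> a b; under eq_fun do rewrite mxE; apply: cmeasM; first exact: cmeas_cst.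
    exact: (flow_smooth_derivative_cmeas F0 mF (Ms a b)).
  have [B hB] := entrywise_bound (fun a b => flow_smooth_derivative_bounded F0 (Ms a b)).
  by exists B => x a b; rewrite mxE Normc.normcM normc_imag normr1 mul1r.
have gL l : L2 mu (g l) by case: (gr l).
have rL l : L2 mu (r l) by case: (gr l).
rewrite innerDr//; last 2 first.
- exact: mul_shift_L2.
- exact: mul_shift_L2.
by rewrite addrAC subrr add0r.
Qed.

End VectorFunctions.

(** * Operators on an isotypic component *)

Section Isotypic.
Variables (R : realType) (n : nat) (X : ptopologicalType) (cX : X -> chart 'rV[R]_n X).
Hypothesis hX : compact_manifold cX.
Variable muX : probability (borel X) R.
Variable F : R -> X -> X.
Hypothesis hF : C1_flow cX F.
Hypothesis hFmu : forall t, preserves (T := borel X) muX (F t).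
Variables (m : nat) (G : ptopologicalGroupType) (cG : G -> chart 'rV[R]_m G).
Hypothesis hG : compact_lie_group cG.
Variables (muG : probability (borel G) R) (hmuG : haar muG).
Variables (d : nat) (Pi : G -> 'M[R[i]]_d).
Hypothesis hPi : unitary_rep Pi.
Hypothesis hirr : irreducible_rep Pi.
Variable j : 'I_d.
Variable phi : X -> G.
Hypothesis hphi : Ck_map 1 cX cG phi.
Local Notation C := R[i].
Local Notation P := (borel X * borel G)%type.
Local Notation mu := (muX \x muG)%E.
Local Notation T := (skew_map F phi).
Local Notation Tinv := (skew_inv F phi).
Local Notation H := (Hpi muX muG Pi j).
Local Notation tensor := (tensor Pi j).
Local Notation vec := ('I_d -> borel X -> C).
Local Notation mshift := (mul_shift (T := borel X) F).
Local Notation Q := (cocycle F Pi phi).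
Local Notation Q' := (cocycle_derivative F cG Pi phi).
Implicit Types (f g : vec) (psi : P -> C).

Let F0 (x : borel X) : F 0 x = x := flow0 hF x.
Let FD s t (x : borel X) : F (s + t) x = F s (F t x) := flowD hF s t x.
Let mF t : measurable_fun setT (F t : borel X -> borel X).
Proof. exact: (measurable_flow hF t). Qed.
Let X2 : @second_countable X. Proof. by case: hX. Qed.
Let d0 : (0 < d)%N. Proof. by case: hirr. Qed.
Let tL2 f : (forall k, L2 muX (f k)) -> L2 mu (tensor f).
Proof. exact: (tensor_L2 muG j hPi). Qed.
Let itensor f g : (forall k, L2 muX (f k)) -> (forall k, L2 muX (g k)) ->
  inner mu (tensor f) (tensor g) = d%:R^-1 * \sum_k inner muX (f k) (g k).
Proof. exact: (inner_tensor hG hmuG j hPi hirr). Qed.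
Let ntensor f : (forall k, L2 muX (f k)) ->
  L2norm mu (tensor f) ^+ 2 = d%:R^-1 * \sum_k L2norm muX (f k) ^+ 2.
Proof. exact: (L2norm_tensor hG hmuG j hPi hirr). Qed.

Lemma tensor_ae f g : (forall k, f k = g k %[ae muX]) -> tensor f = tensor g %[ae mu].
Proof.
move=> fg.
have : {ae muX, forall x, forall k, f k x = g k x}.
  by apply: filter_forall => k; apply: filterS (fg k) => x; exact.
move=> /(ae_fst muG); apply: filterS => p h _.
by apply: eq_bigr => k _; rewrite h.
Qed.

Lemma L2norm_tensor_le f (b : R) : (forall k, L2 muX (f k)) -> 0 <= b ->
  (forall k, L2norm muX (f k) <= b) -> L2norm mu (tensor f) <= b.
Proof.
move=> fL b0 fb; rewrite -(@ler_pXn2r _ 2) ?nnegrE ?L2norm_ge0// ntensor//.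
rewrite ler_pdivrMl ?ltr0n//.
have -> : d%:R * b ^+ 2 = \sum_(k < d) b ^+ 2 by rewrite sumr_const card_ord mulr_natl.
by apply: ler_sum => k _; rewrite lerXn2r ?nnegrE ?L2norm_ge0.
Qed.

Lemma L2norm_coef_le f k : (forall k, L2 muX (f k)) ->
  L2norm muX (f k) <= d%:R * L2norm mu (tensor f).
Proof.
move=> fL; rewrite -(@ler_pXn2r _ 2) ?nnegrE ?mulr_ge0 ?L2norm_ge0//.
rewrite exprMn ntensor// mulrA expr2 mulfK ?pnatr_eq0 -?lt0n//.
rewrite (le_trans (y := \sum_k L2norm muX (f k) ^+ 2))//.
  by rewrite (bigD1 k)//= lerDl sumr_ge0// => *; exact: sqr_ge0.
by rewrite ler_peMl ?ler1n// sumr_ge0// => *; exact: sqr_ge0.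
Qed.

Lemma tensor_inj f g : (forall k, L2 muX (f k)) -> (forall k, L2 muX (g k)) ->
  tensor f = tensor g %[ae mu] -> forall k, f k = g k %[ae muX].
Proof.
move=> fL gL fg k.
have hL k' : L2 muX (fun x => f k' x - g k' x) by exact: L2B.
have z : L2norm mu (tensor (fun k x => f k x - g k x)) = 0.
  apply: ae_eq_L2norm0; first by exact: L2_cmeas (tL2 hL).
  apply: filterS fg => p /(_ I) h _; rewrite /Defs.tensor.
  rewrite (eq_bigr (fun k => f k p.1 * Pi p.2 j k - g k p.1 * Pi p.2 j k)); last first.
    by move=> a _; rewrite mulrBl.
  by rewrite sumrB; apply/eqP; rewrite subr_eq0; apply/eqP.
have : L2norm muX (fun x => f k x - g k x) = 0.
  apply/eqP; rewrite eq_le L2norm_ge0 andbT.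
  by have := L2norm_coef_le k hL; rewrite z mulr0.
move=> /(L2norm0_ae (hL k)); apply: filterS => x h xT.
by apply/eqP; rewrite -subr_eq0; apply/eqP; exact: h.
Qed.

(** A choice of coefficient functions. They are determined almost everywhere,
by [tensor_inj], so that operators defined through them do not depend on the
choice. *)
Definition coefs psi : vec :=
  if pselect (exists2 f : vec, (forall k, L2 muX (f k)) & psi = tensor f %[ae mu]) is left h
  then sval (cid2 h) else fun _ _ => 0.

Lemma coefs_L2 psi k : L2 muX (coefs psi k).
Proof. by rewrite /coefs; case: pselect => [h|_]; [case: cid2|exact: L2_0]. Qed.

Lemma coefsP psi : H psi -> psi = tensor (coefs psi) %[ae mu].
Proof. by move=> [_ h]; rewrite /coefs; case: pselect => // h'; case: cid2. Qed.

Lemma Hpi_tensor f : (forall k, L2 muX (f k)) -> H (tensor f).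
Proof. by move=> fL; split; [exact: tL2|exists f => //; exact: ae_eq_refl]. Qed.

Lemma coefs_unique psi f : (forall k, L2 muX (f k)) -> psi = tensor f %[ae mu] ->
  forall k, coefs psi k = f k %[ae muX].
Proof.
move=> fL pf; have hp : psi = tensor (coefs psi) %[ae mu].
  by rewrite /coefs; case: pselect => [h|[]]; [case: cid2|exists f].
apply: tensor_inj => //; first exact: coefs_L2.
exact: ae_eq_trans (ae_eq_sym hp) pf.
Qed.

Definition op (M : borel X -> 'M[C]_d) (s : R) psi : P -> C :=
  tensor (mshift M s (coefs psi)).

Let msL2 M s f : bounded_mx M -> (forall k, L2 muX (f k)) -> forall k, L2 muX (mshift M s f k).
Proof. by move=> bM fL; apply: mul_shift_L2. Qed.

Lemma op_tensor M s psi f : (forall k, L2 muX (f k)) -> psi = tensor f %[ae mu] ->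
  op M s psi = tensor (mshift M s f) %[ae mu].
Proof.
by move=> fL pf; apply: tensor_ae; apply: mul_shift_ae => //; exact: coefs_unique.
Qed.

Lemma op_bounded M s : bounded_mx M -> bounded_operator mu H (op M s).
Proof.
move=> bM; split.
- by move=> psi _; apply: Hpi_tensor; apply: msL2 => // k; exact: coefs_L2.
- move=> a psi chi Hp Hc.
  have lin f g : tensor (fun k x => a * f k x + g k x) = (fun p => a * tensor f p + tensor g p).
    apply/funext => p; rewrite /Defs.tensor mulr_sumr -big_split /=.
    by apply: eq_bigr => k _; rewrite mulrDl mulrA.
  have L k : L2 muX (fun x => a * coefs psi k x + coefs chi k x).
    by apply: L2D; [apply: L2Z|]; exact: coefs_L2.
  have e : (fun x => a * psi x + chi x) = tensor (fun k x => a * coefs psi k x + coefs chi k x) %[ae mu].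
    rewrite lin; apply: filterS2 (coefsP Hp) (coefsP Hc) => p h1 h2 pT.
    by rewrite h1// h2.
  apply: ae_eq_trans (op_tensor M s L e) _.
  by rewrite mul_shift_lin lin; exact: ae_eq_refl.
- have [mM [B hB]] := bM; exists (`|B| * (d%:R * d%:R)) => psi Hp.
  have cL k := coefs_L2 psi k.
  have hB' x k l : Normc.normc (M x k l) <= `|B| by exact: le_trans (hB x k l) (ler_norm B).
  have -> : L2norm mu psi = L2norm mu (tensor (coefs psi)).
    apply: ae_eq_L2norm; last exact: coefsP.
      by case: Hp => /L2_cmeas.
    exact: L2_cmeas (tL2 cL).
  apply: L2norm_tensor_le => [||k]; first exact: msL2.
    by rewrite !mulr_ge0 ?L2norm_ge0.
  rewrite (le_trans (mul_shift_le mF hFmu s k bM hB' (normr_ge0 B) cL))// -!mulrA ler_wpM2l//.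
  rewrite mulr_natl -[X in _ <= _ *+ X](card_ord d) -sumr_const ler_sum// => l _.
  exact: L2norm_coef_le.
Qed.

(** Translation in [G] acts on the coefficients by the matrices of the
representation. *)
Lemma tensor_translate f s (u : X -> G) (p : P) :
  tensor f (F s p.1, ((p.2 : G) * u p.1)%g) = tensor (mshift (fun x => Pi (u x)) s f) p.
Proof.
rewrite /Defs.tensor /mul_shift /=.
rewrite (eq_bigr (fun k => \sum_l Pi (u p.1) l k * f k (F s p.1) * Pi p.2 j l)); last first.
  move=> k _; rewrite (repM hPi) mxE mulr_sumr; apply: eq_bigr => l _.
  by ring.
rewrite exchange_big /=; apply: eq_bigr => l _.
by rewrite big_distrl.
Qed.

Lemma rep_bounded_mx (u : X -> G) : continuous u -> bounded_mx (fun x : borel X => Pi (u x)).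
Proof.
move=> cu; split; last by exists 1 => x k l; exact: rep_entry.
move=> k l; have [h1 h2] := rep_cmeas hPi k l.
have mu' : measurable_fun setT (u : borel X -> borel G) by exact: continuous_borel.
by split; [exact: (measurableT_comp h1 mu')|exact: (measurableT_comp h2 mu')].
Qed.

Let fc t : continuous (F t). Proof. by move=> x; exact: (flow_continuousr hF). Qed.
Let phic : continuous phi. Proof. exact: cocycle_continuous hphi. Qed.

Lemma group_cocycle_continuous N : continuous (group_cocycle F phi N).
Proof.
elim: N => [|N IH]; first exact: cst_continuousG.
apply: (continuous_mulg (group_mulc hG)) => // x.
by apply: (continuous_comp (f := F N%:R) (g := phi)); [exact: fc|exact: phic].
Qed.

Let mT : measurable_fun setT T /\ preserves mu T.
Proof.
exact: (skew_product_preserves X2 (group_2nd hG) (group_mulc hG) (group_invc hG) hmuG (fc (t := 1)) phic (hFmu 1)).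
Qed.

Let mTinv : measurable_fun setT Tinv /\ preserves mu Tinv.
Proof.
apply: (skew_product_preserves X2 (group_2nd hG) (group_mulc hG) (group_invc hG) hmuG (fc (t := - 1))
  (u := fun x => (phi (F (- 1) x))^-1%g) _ (hFmu (- 1))).
apply: (continuous_invg (group_invc hG)) => x.
by apply: (continuous_comp (f := F (- 1)) (g := phi)); [exact: fc|exact: phic].
Qed.

Lemma iter_koopman (S : P -> P) N psi : iter N (koopman S) psi = psi \o iter N S.
Proof.
elim: N => [//|N IH] /=; rewrite IH /koopman.
by apply/funext => p; rewrite /= -iterSr.
Qed.

Lemma iter_skew_inv N (p : P) :
  iter N Tinv p = (F (- N%:R) p.1, ((p.2 : G) * (group_cocycle F phi N (F (- N%:R) p.1))^-1)%g).
Proof.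
have TK : cancel T Tinv := skewK phi hF.
have inj : injective T := can_inj TK.
have itK k q : iter k T (iter k Tinv q) = q.
  by elim: k q => [//|k IH] q; rewrite iterSr /= (skew_invK phi hF) IH.
have itinj k : injective (iter k T).
  by elim: k => [//|k IH] a b /= /inj/IH.
apply: (itinj N); rewrite itK (iter_skew hF) /= -FD addrN F0 mulgVK.
by case: p.
Qed.

Lemma koopman_tensor N psi f : psi = tensor f %[ae mu] ->
  iter N (koopman T) psi = tensor (mshift (Q N) N%:R f) %[ae mu].
Proof.
move=> pf; rewrite iter_koopman.
have := ae_preserves (measurable_iter mT.1 N) (preserves_iter mT.1 mT.2 N) pf.
apply: filterS => p h pT; rewrite /= h//.
rewrite (iter_skew hF); exact: tensor_translate.
Qed.

Lemma koopman_inv_tensor N psi f : psi = tensor f %[ae mu] ->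
  iter N (koopman Tinv) psi =
  tensor (mshift (fun x => (Q N (F (- N%:R) x))^t*) (- N%:R) f) %[ae mu].
Proof.
move=> pf; rewrite iter_koopman.
have := ae_preserves (measurable_iter mTinv.1 N) (preserves_iter mTinv.1 mTinv.2 N) pf.
apply: filterS => p h pT; rewrite /= h//.
rewrite iter_skew_inv (tensor_translate f (- N%:R) (fun x => (group_cocycle F phi N (F (- N%:R) x))^-1%g)).
suff -> : (fun x : borel X => Pi (group_cocycle F phi N (F (- N%:R) x))^-1%g) =
  (fun x => (Q N (F (- N%:R) x))^t*) by [].
by apply/funext => x; rewrite (repV hPi).
Qed.

Lemma cocycle_bounded_mx N : bounded_mx (Q N : borel X -> 'M[C]_d).
Proof. exact: rep_bounded_mx (@group_cocycle_continuous N). Qed.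

Lemma koopman_L2norm N f : (forall k, L2 muX (f k)) ->
  L2norm mu (tensor (mshift (Q N) N%:R f)) = L2norm mu (tensor f).
Proof.
move=> fL; rewrite -(L2norm_preserves (measurable_iter mT.1 N) (preserves_iter mT.1 mT.2 N) (tL2 fL)).
congr (L2norm mu _); apply/funext => p; rewrite (iter_skew hF); apply/esym.
exact: tensor_translate.
Qed.

Lemma Hpi_koopman N psi : H psi -> H (iter N (koopman T) psi).
Proof.
move=> Hp; have [pL _] := Hp; split.
  by rewrite iter_koopman; exact: (L2_preserves (measurable_iter mT.1 N) (preserves_iter mT.1 mT.2 N)).
exists (mshift (Q N) N%:R (coefs psi)); last exact: koopman_tensor (coefsP Hp).
by apply: msL2; [exact: cocycle_bounded_mx|exact: coefs_L2].
Qed.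

Lemma cocycle_inv_bounded_mx N : bounded_mx (fun x : borel X => (Q N (F (- N%:R) x))^t*).
Proof.
have [h1 [B hB]] := cocycle_bounded_mx N; split; last by exists B => x k l; rewrite !mxE normcJE.
move=> k l; under eq_fun do rewrite !mxE.
exact: cmeasJ (cmeas_preserves (mF (- N%:R)) (h1 l k)).
Qed.

Lemma Hpi_koopman_inv N psi : H psi -> H (iter N (koopman Tinv) psi).
Proof.
move=> Hp; have [pL _] := Hp; split.
  by rewrite iter_koopman; exact: (L2_preserves (measurable_iter mTinv.1 N) (preserves_iter mTinv.1 mTinv.2 N)).
eexists; last exact: koopman_inv_tensor (coefsP Hp).
by apply: msL2; [exact: cocycle_inv_bounded_mx|exact: coefs_L2].
Qed.

Local Notation vgen f h := (forall k, seq_generator (T := borel X) muX F (f k) (h k)).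

Lemma flow_generator_seq (f h : X -> C) : flow_generator muX F f h -> seq_generator (T := borel X) muX F f h.
Proof.
move=> [fL hL fh]; split=> // t t0 tN0.
exact: (cvg_comp _ _ (cvg_seq_dnbhs t0 tN0) fh).
Qed.

Let Qs N := cocycle_smooth_flow hX hF hG hmuG hPi hphi N.

Lemma commutator_bounded_mx N : bounded_mx (fun x : borel X => Complex 0 1 *: Q' N x).
Proof.
split.
  move=> k l; under eq_fun do rewrite mxE; apply: cmeasM; first exact: cmeas_cst.
  exact: (flow_smooth_derivative_cmeas F0 mF (Qs N k l)).
have [B hB] := entrywise_bound (fun k l => flow_smooth_derivative_bounded F0 (Qs N k l)).
by exists B => x k l; rewrite mxE Normc.normcM normc_imag normr1 mul1r.
Qed.

(** The form of the commutator of [A] with the N-th power of the Koopman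
operator, polarised: the two arguments are independent elements of the domain of
[A]. *)
Lemma tensor_commutator N (f h g r : vec) : vgen f h -> vgen g r ->
  inner mu (tensor h) (tensor (mshift (Q N) N%:R g)) -
  inner mu (tensor f) (tensor (mshift (Q N) N%:R r)) =
  inner mu (tensor f) (tensor (mshift (fun x => Complex 0 1 *: Q' N x) N%:R g)).
Proof.
move=> fh gr.
have fL k : L2 muX (f k) by case: (fh k). have hL k : L2 muX (h k) by case: (fh k).
have gL k : L2 muX (g k) by case: (gr k). have rL k : L2 muX (r k) by case: (gr k).
have bQ := cocycle_bounded_mx N; have bQ' := commutator_bounded_mx N.
rewrite !itensor//; try exact: msL2.
rewrite -mulrBr -sumrB; congr (_ * _); apply: eq_bigr => k _.
exact: (generator_commutator F0 FD mF hFmu N%:R (Qs N) fh gr).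
Qed.

Definition comm N := op (fun x => Complex 0 1 *: Q' N x) N%:R.

Lemma comm_is_commutator N :
  is_commutator mu H (A_graph muX muG Pi j F) (iter N (koopman T)) (comm N).
Proof.
split; first exact: op_bounded (commutator_bounded_mx N).
move=> psi Apsi [pL aL [f [h [fh pf ah]]]].
have fh' : vgen f h by move=> k; exact: flow_generator_seq.
have fL k : L2 muX (f k) by case: (fh' k). have hL k : L2 muX (h k) by case: (fh' k).
have bQ := cocycle_bounded_mx N; have bQ' := commutator_bounded_mx N.
have Hp : H psi by split=> //; exists f.
have Ha : H Apsi by split=> //; exists h.
have cm (chi : P -> C) : L2 mu chi -> cmeas chi by exact: L2_cmeas.
have Up := cm _ (Hpi_koopman N Hp).1; have Ua := cm _ (Hpi_koopman N Ha).1.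
have tf := cm _ (tL2 fL); have th := cm _ (tL2 hL).
have mp := cm _ pL; have ma := cm _ aL.
have tQf := cm _ (tL2 (msL2 N%:R bQ fL)); have tQh := cm _ (tL2 (msL2 N%:R bQ hL)).
have tQ'f := cm _ (tL2 (msL2 N%:R bQ' fL)).
have tcf := cm _ (tL2 (msL2 N%:R bQ' (coefs_L2 psi))).
rewrite (ae_eq_inner ma Up th tQf ah (koopman_tensor N pf)).
rewrite (ae_eq_inner mp Ua tf tQh pf (koopman_tensor N ah)).
rewrite (ae_eq_inner mp tcf tf tQ'f pf (op_tensor _ _ fL pf)).
exact: tensor_commutator.
Qed.

Variable Mbar : 'M[C]_d.
Hypothesis hlim : limit_along muX F cG Pi phi Mbar.
Hypothesis hcomm : forall x, Mbar *m Pi (phi x) = Pi (phi x) *m Mbar.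
Local Notation iM := (Complex 0 1 *: Mbar).

Let bcst (M : 'M[C]_d) : bounded_mx (fun _ : borel X => M).
Proof. exact: bounded_mx_cst. Qed.

Definition limit_op := op (fun=> iM) 0.

(** Multiplication by this matrix is 1/N times the commutator with the N-th
power of the Koopman operator, composed with the inverse of that power. *)
Definition average N (x : borel X) : 'M[C]_d :=
  Complex 0 1 *: (N%:R^-1 *: (Q' N x *m (Q N x)^t*)).

Lemma average_cmeas N k l : cmeas (fun x => average N x k l).
Proof.
rewrite (_ : (fun x => _) = (fun x => Complex 0 1 * (N%:R^-1 * \sum_a (Q' N x k a * (Q N x l a)^*%C)))); last first.
  apply/funext => x; rewrite /average !mxE; congr (_ * (_ * _)); apply: eq_bigr => a _.
  by rewrite !mxE.
apply: cmeasM; first exact: cmeas_cst.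
apply: cmeasM; first exact: cmeas_cst.
apply: cmeas_sum => a _; apply: cmeasM; first exact: (flow_smooth_derivative_cmeas F0 mF (Qs N k a)).
by apply: cmeasJ; case: (Qs N l a).
Qed.

Lemma average_bound : exists2 B : R, 0 <= B & forall N x k l, Normc.normc (average N x k l) <= B.
Proof.
have [B B0 hB] := cocycle_average_bound hX hF hG hmuG hPi hphi.
exists B => // N x k l; rewrite mxE Normc.normcM normc_imag normr1 mul1r; exact: hB.
Qed.

Lemma average_bounded_mx N : bounded_mx (average N).
Proof.
have [B _ hB] := average_bound; split; first exact: average_cmeas.
by exists B => x k l; exact: hB.
Qed.

Lemma average_diff_bounded_mx N : bounded_mx (fun x => average N x - iM).
Proof.
have [B _ hB] := average_bound; have [_ [B' hB']] := bcst iM.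
split.
  move=> k l; rewrite (_ : (fun x => _) = (fun x => average N x k l - iM k l)); last first.
    by apply/funext => x; rewrite [LHS]mxE [X in _ + X = _]mxE.
  by apply: cmeasB; [exact: average_cmeas|exact: cmeas_cst].
exists (B + B') => x k l; rewrite [(_ - iM) k l]mxE [X in _ + X]mxE.
by rewrite (le_trans (normcD _ _))// normcNE lerD//; exact: (hB' x).
Qed.

Lemma average_cvg f : (forall k, L2 muX (f k)) ->
  L2norm mu (tensor (mshift (fun x => average N x - iM) 0 f)) @[N --> \oo] --> (0 : R).
Proof.
move=> fL; have [B B0 hB] := average_bound.
pose c N k l x := (average N x - iM) k l.
pose q N := \sum_k \sum_l L2norm muX (fun x => c N k l x * f l x).
have cE N k l x : c N k l x = average N x k l - iM k l.
  by rewrite /c [LHS]mxE [X in _ + X = _]mxE.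
have bd N := average_diff_bounded_mx N.
have [_ [B' hB']] := bcst iM.
have cb N k l x : Normc.normc (c N k l x) <= B + B'.
  by rewrite cE (le_trans (normcD _ _))// normcNE lerD//; exact: (hB' x).
have cL N k l : L2 muX (fun x => c N k l x * f l x).
  by apply: (@L2M _ _ _ _ _ _ (B + B')) => //; exact: (bd N).1.
apply: (@squeeze_cvgr _ _ _ _ (cst 0) q); last 2 first.
- exact: cvg_cst.
- have h : q N @[N --> \oo] --> \sum_(k < d) \sum_(l < d) (0 : R).
    apply: cvg_sum_seq => k; apply: cvg_sum_seq => l.
    apply: (@L2_dominated _ (borel X) R muX (fun N => c N k l) (f l) (B + B')) => //.
      by move=> N; exact: (bd N).1.
    have hlim' : {ae muX, forall x : borel X, forall k l,
        Normc.normc ((N%:R^-1 *: (Q' N x *m (Q N x)^t*)) k l - Mbar k l) @[N --> \oo] --> (0 : R)} := hlim.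
    apply: filterS hlim' => x hx; have := hx k l; apply: cvg_trans; apply: near_eq_cvg; apply: filterE => N.
    have aE : average N x k l = Complex 0 1 * (N%:R^-1 *: (Q' N x *m (Q N x)^t*)) k l by rewrite /average mxE.
    have iE : iM k l = Complex 0 1 * Mbar k l by rewrite mxE.
    by rewrite cE aE iE -mulrBr Normc.normcM normc_imag normr1 mul1r.
  have z : \sum_(k < d) \sum_(l < d) (0 : R) = 0 by rewrite big1// => k _; rewrite big1.
  by rewrite z in h.
apply: filterE => N; rewrite L2norm_ge0 /=.
apply: L2norm_tensor_le; first by apply: msL2; [exact: bd|].
  by apply: sumr_ge0 => k _; apply: sumr_ge0 => l _; exact: L2norm_ge0.
move=> k; rewrite /q (bigD1 k)//= ler_wpDr//.
  by apply: sumr_ge0 => a _; apply: sumr_ge0 => l _; exact: L2norm_ge0.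
have -> : mshift (fun x => average N x - iM) 0 f k = (fun x => \sum_l c N k l x * f l x).
  by apply/funext => x; rewrite /mul_shift; apply: eq_bigr => l _; rewrite F0.
exact: L2norm_sum.
Qed.

Lemma mshift0_eq (M M' : borel X -> 'M[C]_d) s t f : (forall x, M x = M' x) -> s = t ->
  mshift M s f = mshift M' t f.
Proof. by move=> MM ->; congr (mshift _ _ _); apply/funext. Qed.

Lemma average_strong_limit :
  strong_limit mu H (fun N psi p => N%:R^-1 * comm N (iter N (koopman Tinv) psi) p) limit_op.
Proof.
split; first by apply: op_bounded; exact: bounded_mx_cst.
move=> psi Hp; pose f := coefs psi; have fL k : L2 muX (f k) by exact: coefs_L2.
have := average_cvg fL; apply: cvg_trans; apply: near_eq_cvg; apply: filterE => N.
have HpN := Hpi_koopman_inv N Hp.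
have gL := msL2 (- N%:R) (cocycle_inv_bounded_mx N) fL.
have e := op_tensor (fun x => Complex 0 1 *: Q' N x) N%:R gL (koopman_inv_tensor N (coefsP Hp)).
apply/esym/ae_eq_L2norm.
- apply: cmeasB.
    apply: cmeasM; first exact: cmeas_cst.
    by apply/L2_cmeas/tL2/msL2; [exact: commutator_bounded_mx|exact: coefs_L2].
  by apply/L2_cmeas/tL2/msL2 => //; exact: bounded_mx_cst.
- by apply/L2_cmeas/tL2/msL2 => //; exact: average_diff_bounded_mx.
- apply: filterS e => p h pT; rewrite /comm h// mul_shift_comp//.
  rewrite (mshift0_eq (M' := fun x => (Complex 0 1 *: Q' N x) *m (Q N x)^t*) (t := 0)); last 2 first.
  + by move=> x; rewrite -FD addNr F0.
  + by rewrite addNr.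
  rewrite /limit_op /op -/f /Defs.tensor mulr_sumr -sumrB; apply: eq_bigr => k _.
  rewrite mulrA -mulrBl; congr (_ * _); rewrite /mul_shift mulr_sumr -sumrB; apply: eq_bigr => l _.
  rewrite mulrA -mulrBl; congr (_ * _).
  rewrite [(average _ _ - _) _ _]mxE [(- iM) k l]mxE; congr (_ - _).
  by rewrite /average -scalemxAl [RHS]mxE [in RHS]mxE [in LHS]mxE mulrCA.
Qed.

Lemma limit_op_matrix : is_matrix_multiplication muX muG Pi j iM limit_op.
Proof.
move=> psi f pL fL pf; apply: ae_eq_trans (op_tensor _ _ fL pf) _.
suff -> : mshift (fun=> iM) 0 f = (fun k x => \sum_(l < d) iM k l * f l x) by exact: ae_eq_refl.
by apply/funext => k; apply/funext => x; rewrite /mul_shift; apply: eq_bigr => l _; rewrite F0.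
Qed.

Lemma iM_hermitian : iM^t* = iM.
Proof.
have h := limit_antihermitian hX hF hG hmuG hPi hphi hlim.
apply/matrixP => k l; have := congr1 (fun M : 'M[C]_d => M k l) h.
rewrite [LHS]mxE [X in X = _ -> _]/= [X in Num.conj X]mxE [RHS]mxE => e.
rewrite [LHS]mxE [X in Num.conj X]mxE [X in Num.conj X]mxE [RHS]mxE.
have -> : Num.conj (Complex 0 1 * Mbar l k) = (Complex 0 1)^*%C * (Num.conj (Mbar l k)) by rewrite -conjcM.
rewrite e; have -> : (Complex 0 1)^*%C = - Complex 0 1 :> C by apply: complexP; rewrite /= ?oppr0.
by rewrite mulrNN.
Qed.

Lemma average_hermitian N x : (average N x)^t* = average N x.
Proof.
have h := cocycle_derivative_antihermitian hX hF hG hmuG hPi hphi N x.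
apply/matrixP => k l; have := congr1 (fun M : 'M[C]_d => M k l) h.
rewrite [LHS]mxE [X in X = _ -> _]/= [X in Num.conj X]mxE [RHS]mxE => e.
have SE a b : average N x a b = Complex 0 1 * (N%:R^-1 * (Q' N x *m (Q N x)^t*) a b).
  by rewrite /average [LHS]mxE [X in _ * X = _]mxE.
rewrite [LHS]mxE [X in Num.conj X]mxE !SE.
have -> : Num.conj (Complex 0 1 * (N%:R^-1 * (Q' N x *m (Q N x)^t*) l k)) =
   (Complex 0 1)^*%C * ((N%:R^-1)^*%C * Num.conj ((Q' N x *m (Q N x)^t*) l k)) by rewrite -!conjcM.
rewrite e; have -> : (Complex 0 1)^*%C = - Complex 0 1 :> C by apply: complexP; rewrite /= ?oppr0.
have -> : (N%:R^-1)^*%C = N%:R^-1 :> C by rewrite natCV; apply: complexP; rewrite /= ?oppr0.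
by rewrite mulNr !mulrN opprK.
Qed.

(** The inner product of an element of the range of the limit operator with the
N-th image of another element. *)
Definition pairing N f g := inner mu (tensor (mshift (fun=> iM) 0 f)) (tensor (mshift (Q N) N%:R g)).

Let nsize f := size_vec muX f.

Let tensor_le_size f : (forall k, L2 muX (f k)) -> L2norm mu (tensor f) <= nsize f.
Proof.
move=> fL; apply: L2norm_tensor_le => //; first exact: size_vec_ge0.
by move=> k; exact: L2norm_le_size.
Qed.

Lemma pairing_bound : exists2 K : R, 0 <= K & forall N f g, (forall k, L2 muX (f k)) ->
  (forall k, L2 muX (g k)) -> Normc.normc (pairing N f g) <= K * nsize f * nsize g.
Proof.
have bM := bcst iM; have [_ [B hB]] := bM.
have hB' (x : borel X) k l : Normc.normc (iM k l) <= `|B| by exact: le_trans (hB x k l) (ler_norm B).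
exists `|B| => // N f g fL gL; have bQ := cocycle_bounded_mx N.
rewrite (le_trans (cauchy_schwarz (tL2 (msL2 0 bM fL)) (tL2 (msL2 N%:R bQ gL))))//.
rewrite koopman_L2norm// ler_pM ?L2norm_ge0//; last exact: tensor_le_size.
apply: L2norm_tensor_le => [||k]; first exact: msL2.
  by rewrite mulr_ge0//; exact: size_vec_ge0.
exact: (mul_shift_le mF hFmu 0 k bM hB').
Qed.

Lemma tensor_lin1 f g : tensor (fun k x => 1 * f k x + g k x) = (fun p => tensor f p + tensor g p).
Proof.
apply/funext => p; rewrite /Defs.tensor -big_split /=.
by apply: eq_bigr => k _; rewrite mul1r mulrDl.
Qed.

Lemma mshift_lin1 M s f g : tensor (mshift M s (fun k x => 1 * f k x + g k x)) =
  (fun p => tensor (mshift M s f) p + tensor (mshift M s g) p).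
Proof. by rewrite mul_shift_lin tensor_lin1. Qed.

Lemma pairing_splitl N f f' g : (forall k, L2 muX (f k)) -> (forall k, L2 muX (f' k)) ->
  (forall k, L2 muX (g k)) ->
  pairing N f g = pairing N (fun k x => f k x - f' k x) g + pairing N f' g.
Proof.
move=> fL fL' gL; have bM := bcst iM; have bQ := cocycle_bounded_mx N.
rewrite /pairing -innerDl; last 3 first.
- by apply/tL2/msL2.
- by apply/tL2/msL2 => // k; exact: L2B.
- by apply/tL2/msL2.
rewrite -mshift_lin1; congr (inner mu (tensor (mshift _ _ _)) _).
by apply/funext => k; apply/funext => x; rewrite mul1r subrK.
Qed.

Lemma pairing_splitr N f g g' : (forall k, L2 muX (f k)) -> (forall k, L2 muX (g k)) ->
  (forall k, L2 muX (g' k)) ->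
  pairing N f g = pairing N f (fun k x => g k x - g' k x) + pairing N f g'.
Proof.
move=> fL gL gL'; have bM := bcst iM; have bQ := cocycle_bounded_mx N.
rewrite /pairing -innerDr; last 3 first.
- by apply/tL2/msL2.
- by apply/tL2/msL2 => // k; exact: L2B.
- by apply/tL2/msL2.
rewrite -mshift_lin1; congr (inner mu _ (tensor (mshift _ _ _))).
by apply/funext => k; apply/funext => x; rewrite mul1r subrK.
Qed.

(** Up to an error that tends to zero, the pairing is an average of commutators,
and these are bounded by moving the generator to either side. *)
Lemma pairing_cvg_smooth (f f' g g' : vec) :
  (forall k, flow_smooth (T := borel X) F (f k) (f' k)) ->
  (forall k, flow_smooth (T := borel X) F (g k) (g' k)) ->
  Normc.normc (pairing N f g) @[N --> \oo] --> (0 : R).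
Proof.
move=> fs gs.
pose h : vec := fun k x => Complex 0 1 * f' k x; pose r : vec := fun k x => Complex 0 1 * g' k x.
have fh : vgen f h by move=> k; exact: (flow_smooth_generator muX F0 mF (fs k)).
have gr : vgen g r by move=> k; exact: (flow_smooth_generator muX F0 mF (gs k)).
have fL k : L2 muX (f k) by case: (fh k). have hL k : L2 muX (h k) by case: (fh k).
have gL k : L2 muX (g k) by case: (gr k). have rL k : L2 muX (r k) by case: (gr k).
pose K := nsize h * nsize g + nsize f * nsize r.
have avgE N : inner mu (tensor (mshift (average N) 0 f)) (tensor (mshift (Q N) N%:R g)) =
    N%:R^-1 * (inner mu (tensor h) (tensor (mshift (Q N) N%:R g)) -
               inner mu (tensor f) (tensor (mshift (Q N) N%:R r))).
  have bQ := cocycle_bounded_mx N; have bQ' := commutator_bounded_mx N.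
  have ba := average_bounded_mx N.
  rewrite (tensor_commutator N fh gr) !itensor//; try exact: msL2.
  rewrite mulrCA; congr (_ * _); rewrite (inner_mul_adjoint F0 mF hFmu)//; last exact: msL2.
  rewrite mulr_sumr; apply: eq_bigr => k _; rewrite mul_shift_comp//.
  rewrite -innerZr//; last exact: msL2.
  congr (inner muX _ _); apply/funext => x; rewrite /mul_shift mulr_sumr; apply: eq_bigr => l _.
  rewrite average_hermitian addr0 F0 mulrA; congr (_ * _).
  rewrite /average -!scalemxAl -mulmxA -[(Q N x)^t* *m _]/((Pi _)^t* *m Pi _) (repUV hPi) mulmx1.
  by rewrite [LHS]mxE [X in _ * X = _]mxE [X in _ = _ * X]mxE mulrCA.
apply: (@squeeze_cvgr _ _ _ _ (cst 0) (fun N =>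
  L2norm mu (tensor (mshift (fun x => average N x - iM) 0 f)) * nsize g + N%:R^-1 * K)); last 2 first.
- exact: cvg_cst.
- have h1 : L2norm mu (tensor (mshift (fun x => average N x - iM) 0 f)) * nsize g @[N --> \oo] --> (0 : R).
    by rewrite -[X in _ --> X](mul0r (nsize g)); apply: cvgM; [exact: average_cvg|exact: cvg_cst].
  have h2 : (N%:R^-1 * K : R) @[N --> \oo] --> (0 : R).
    rewrite -[X in _ --> X](mul0r K); apply: cvgM; last exact: cvg_cst.
    by rewrite -(cvg_shiftn 1); under eq_fun do rewrite addn1; exact: cvg_step.
  by rewrite -[X in _ --> X](addr0 0); apply: cvgD.
apply: filterE => N; rewrite /cst normc_ge0 andTb.
have bQ := cocycle_bounded_mx N; have ba := average_bounded_mx N.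
have bM := bcst iM; have bd := average_diff_bounded_mx N.
have -> : pairing N f g =
   inner mu (tensor (mshift (average N) 0 f)) (tensor (mshift (Q N) N%:R g)) -
   inner mu (tensor (mshift (fun x => average N x - iM) 0 f)) (tensor (mshift (Q N) N%:R g)).
  rewrite -innerBl; last 3 first.
  - by apply/tL2/msL2.
  - by apply/tL2/msL2.
  - by apply/tL2/msL2.
  congr (inner mu _ _); apply/funext => p; rewrite /Defs.tensor -sumrB; apply: eq_bigr => k _.
  rewrite -mulrBl; congr (_ * _); rewrite /mul_shift -sumrB; apply: eq_bigr => l _.
  by rewrite -mulrBl [(average _ _ - _) _ _]mxE [X in _ - (_ + X)]mxE opprB addrC subrK.
rewrite (le_trans (normcD _ _))// normcNE addrC; apply: lerD.
  rewrite (le_trans (cauchy_schwarz (tL2 (msL2 0 bd fL)) (tL2 (msL2 N%:R bQ gL))))//.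
  by rewrite koopman_L2norm// ler_wpM2l ?L2norm_ge0//; exact: tensor_le_size.
rewrite avgE Normc.normcM natCV normc_real ger0_norm// ler_wpM2l//.
rewrite (le_trans (normcD _ _))// normcNE; apply: lerD.
  rewrite (le_trans (cauchy_schwarz (tL2 hL) (tL2 (msL2 N%:R bQ gL))))//.
  by rewrite koopman_L2norm// ler_pM ?L2norm_ge0//; exact: tensor_le_size.
rewrite (le_trans (cauchy_schwarz (tL2 fL) (tL2 (msL2 N%:R bQ rL))))//.
by rewrite koopman_L2norm// ler_pM ?L2norm_ge0//; exact: tensor_le_size.
Qed.

Lemma smooth_vector_dense f (e : R) : (forall k, L2 muX (f k)) -> 0 < e ->
  exists g g' : vec, (forall k, flow_smooth (T := borel X) F (g k) (g' k)) /\
    nsize (fun k x => f k x - g k x) <= e.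
Proof.
move=> fL e0; have ed : 0 < e / d%:R by rewrite divr_gt0// ltr0n.
have H1 k : exists gg : (X -> C) * (X -> C), flow_smooth (T := borel X) F gg.1 gg.2 /\
    L2norm muX (fun x => f k x - gg.1 x) < e / d%:R.
  have [_ /(_ _ ed)[u [u' us] hu]] := L2_approximable hX hF (fL k).
  by exists (u, u').
exists (fun k => (sval (cid (H1 k))).1), (fun k => (sval (cid (H1 k))).2); split.
  by move=> k; case: (svalP (cid (H1 k))).
have eS : e = \sum_(k < d) e / d%:R.
  by rewrite sumr_const card_ord -[RHS]mulr_natr divfK// pnatr_eq0 -lt0n.
rewrite [X in _ <= X]eS.
apply: ler_sum => k _; apply: ltW.
by case: (svalP (cid (H1 k))).
Qed.

Lemma cvg0_approx (b : nat -> R) : (forall N, 0 <= b N) ->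
  (forall e, 0 < e -> exists2 c : nat -> R, c N @[N --> \oo] --> (0 : R) & forall N, b N <= e + c N) ->
  b N @[N --> \oo] --> (0 : R).
Proof.
move=> b0 h; apply/cvgrPdist_le => e e0; have e2 : 0 < e / 2 by rewrite divr_gt0.
have [c /cvgrPdist_le/(_ _ e2) c0 bc] := h _ e2.
apply: filterS c0 => N cN; rewrite sub0r normrN ger0_norm//.
rewrite (le_trans (bc N))// [leRHS]splitr lerD2l.
by move: cN; rewrite sub0r normrN; apply: le_trans; exact: ler_norm.
Qed.

(** The pairings are bounded uniformly in N by the sizes of their arguments, so
it is enough to let the arguments range over a dense set. *)
Lemma pairing_cvg f g : (forall k, L2 muX (f k)) -> (forall k, L2 muX (g k)) ->
  Normc.normc (pairing N f g) @[N --> \oo] --> (0 : R).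
Proof.
have [K K0 hK] := pairing_bound.
have smooth_g u (v v' : vec) : (forall k, L2 muX (u k)) ->
    (forall k, flow_smooth (T := borel X) F (v k) (v' k)) ->
    Normc.normc (pairing N u v) @[N --> \oo] --> (0 : R).
  move=> uL vs; have vL k : L2 muX (v k) by exact: (flow_smooth_L2 muX (vs k)).
  apply: cvg0_approx => [N|e e0]; first exact: normc_ge0.
  have K1 : 0 < K * nsize v + 1 by rewrite ltr_wpDl// mulr_ge0//; exact: size_vec_ge0.
  have [w [w' [ws hw]]] := smooth_vector_dense uL (divr_gt0 e0 K1).
  have wL k : L2 muX (w k) by exact: (flow_smooth_L2 muX (ws k)).
  exists (fun N => Normc.normc (pairing N w v)); first exact: pairing_cvg_smooth ws vs.
  move=> N; rewrite (pairing_splitl N uL wL vL) (le_trans (normcD _ _))// lerD2r.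
  have uwL k : L2 muX (fun x => u k x - w k x) by exact: L2B.
  rewrite (le_trans (hK N _ _ uwL vL))// mulrAC.
  rewrite (le_trans (ler_wpM2l _ hw))//; first by rewrite mulr_ge0//; exact: size_vec_ge0.
  by rewrite mulrCA ler_piMr ?(ltW e0)// ler_pdivrMr// mul1r lerDl.
move=> fL gL; apply: cvg0_approx => [N|e e0]; first exact: normc_ge0.
have K1 : 0 < K * nsize f + 1 by rewrite ltr_wpDl// mulr_ge0//; exact: size_vec_ge0.
have [w [w' [ws hw]]] := smooth_vector_dense gL (divr_gt0 e0 K1).
have wL k : L2 muX (w k) by exact: (flow_smooth_L2 muX (ws k)).
exists (fun N => Normc.normc (pairing N f w)); first exact: smooth_g fL ws.
move=> N; rewrite (pairing_splitr N fL gL wL) (le_trans (normcD _ _))// lerD2r.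
have gwL k : L2 muX (fun x => g k x - w k x) by exact: L2B.
rewrite (le_trans (hK N _ _ fL gwL))//.
rewrite (le_trans (ler_wpM2l _ hw))//; first by rewrite mulr_ge0//; exact: size_vec_ge0.
by rewrite mulrCA ler_piMr ?(ltW e0)// ler_pdivrMr// mul1r lerDl.
Qed.

(** In finite dimension the orthogonal complement of the kernel of a hermitian
matrix is its range: pair the given vector with the image of the projection
[1 - J *m iM], where [J] is a generalised inverse of [iM]. *)
Lemma ker_orth_range psi : ker_orth mu H limit_op psi ->
  exists2 f : vec, (forall k, L2 muX (f k)) & psi = tensor (mshift (fun=> iM) 0 f) %[ae mu].
Proof.
move=> [Hp orth]; pose J := pinvmx iM.
have JE : iM *m J *m iM = iM by exact: mulmxKpV.
pose Pr : 'M[C]_d := 1%:M - J *m iM.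
have MP : iM *m Pr = 0 by rewrite mulmxBr mulmx1 mulmxA JE subrr.
pose f0 := coefs psi; have f0L k : L2 muX (f0 k) by exact: coefs_L2.
(* the pairing of [psi] with the image of [w] under [Pr] is the squared norm of
   [w], because [w] is the image of [psi] under the adjoint of [Pr] *)
pose w := mshift (fun=> Pr^t*) 0 f0.
have bc := bcst.
have wL k : L2 muX (w k) by apply: msL2 => //; exact: bc.
pose g := mshift (fun=> Pr) 0 w; have gL k : L2 muX (g k) by exact: (msL2 0 (bc Pr) wL).
have Dg : limit_op (tensor g) = cst 0 %[ae mu].
  apply: ae_eq_trans (op_tensor _ _ gL (ae_eq_refl _ _ _)) _.
  rewrite /g mul_shift_comp// MP.
  apply: aeW => p _; rewrite /Defs.tensor /cst big1// => k _.
  by rewrite /mul_shift big1 ?mul0r// => l _; rewrite mxE mul0r.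
have pL : L2 mu psi by case: Hp.
have := orth _ (Hpi_tensor gL) Dg.
rewrite (ae_eq_inner (L2_cmeas (tL2 gL)) (L2_cmeas pL) (L2_cmeas (tL2 gL)) (L2_cmeas (tL2 f0L))
  (ae_eq_refl _ _ _) (coefsP Hp)).
rewrite itensor// (inner_mul_adjoint F0 mF hFmu (bc Pr) wL f0L) -/w -itensor// inner_self => /(congr1 (@complex.Re R)) /= w0.
have w0' : L2norm mu (tensor w) = 0 by apply/eqP; rewrite -sqrf_eq0 w0.
have wae k : w k = cst 0 %[ae muX].
  apply: L2norm0_ae => //; apply/eqP; rewrite eq_le L2norm_ge0 andbT.
  by have := L2norm_coef_le k wL; rewrite w0' mulr0.
exists (mshift (fun=> J^t*) 0 f0); first by apply: msL2 => //; exact: bc.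
apply: ae_eq_trans (coefsP Hp) _; apply: tensor_ae => k.
apply: filterS (wae k) => x wx xT; have {}wx := wx xT.
rewrite mul_shift_comp// addr0.
have PrJ : Pr^t* = 1%:M - iM *m J^t*.
  by rewrite /Pr linearB /= map_mxB trmx1 map_mx1 trmx_mul map_mxM /= iM_hermitian.
move: wx; rewrite /w /mul_shift PrJ /cst => wx.
apply/eqP; rewrite -subr_eq0; apply/eqP; rewrite -[RHS]wx.
rewrite [in RHS](eq_bigr (fun l => (1%:M : 'M[C]_d) k l * f0 l (F 0 x) - (iM *m J^t*) k l * f0 l (F 0 x))); last first.
  move=> l _; rewrite -mulrBl; congr (_ * _).
  by rewrite [LHS]mxE [X in _ + X = _]mxE.
rewrite sumrB; congr (_ - _).
rewrite (bigD1 k)//= mxE eqxx mul1r big1 ?addr0 ?F0// => l lk.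
by rewrite mxE eq_sym (negbTE lk) mul0r.
Qed.

Lemma ker_orth_mixing psi chi : ker_orth mu H limit_op psi -> H chi ->
  (inner mu psi (iter N (koopman T) chi) : C^o) @[N --> \oo] --> (0 : C^o).
Proof.
move=> hp Hc; have [f fL pf] := ker_orth_range hp; apply/cvgC_normc.
have gL k := coefs_L2 chi k.
have := pairing_cvg fL gL; apply: cvg_trans; apply: near_eq_cvg; apply: filterE => N.
rewrite subr0 /pairing; congr Normc.normc.
have bM := bcst iM; have bQ := cocycle_bounded_mx N.
have [[pL _] _] := hp.
apply/esym/ae_eq_inner => //.
- exact: L2_cmeas pL.
- exact: L2_cmeas (Hpi_koopman N Hc).1.
- by apply/L2_cmeas/tL2/msL2.
- by apply/L2_cmeas/tL2/msL2.
- exact: koopman_tensor (coefsP Hc).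
Qed.

(** The limit matrix commutes with the matrices [Pi (phi x)]. *)
Lemma limit_op_koopman psi : H psi ->
  limit_op (koopman T psi) = koopman T (limit_op psi) %[ae mu].
Proof.
move=> Hp; pose f := coefs psi; have fL k : L2 muX (f k) by exact: coefs_L2.
have bM := bcst iM; have bQ := cocycle_bounded_mx 1.
have e1 := koopman_tensor 1 (coefsP Hp).
have QL := msL2 1%:R bQ fL.
have e2 := op_tensor (fun=> iM) 0 QL e1.
have e3 := koopman_tensor 1 (op_tensor (fun=> iM) 0 fL (coefsP Hp)).
apply: ae_eq_trans e2 _; apply: ae_eq_trans _ (ae_eq_sym e3).
rewrite !mul_shift_comp// (mshift0_eq (M' := fun x => Q 1 x *m iM) (t := 0 + 1%:R)).
- exact: ae_eq_refl.
- move=> x; rewrite F0 /cocycle /= mul1g F0 -scalemxAl -scalemxAr.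
  by rewrite hcomm.
- by rewrite addrC.
Qed.

Lemma koopman_adjoint psi chi : L2 mu psi -> L2 mu chi ->
  inner mu psi (koopman T chi) = inner mu (koopman Tinv psi) chi.
Proof.
move=> pL cL; have iL : L2 mu (koopman Tinv psi) by exact: (L2_preserves mTinv.1 mTinv.2 pL).
rewrite -(inner_preserves mT.1 mT.2 iL cL); congr (inner mu _ _).
by apply/funext => p; rewrite /koopman /= (skewK phi hF).
Qed.

Lemma koopman_inv_adjoint psi chi : L2 mu psi -> L2 mu chi ->
  inner mu psi (koopman Tinv chi) = inner mu (koopman T psi) chi.
Proof.
move=> pL cL; have iL : L2 mu (koopman Tinv chi) by exact: (L2_preserves mTinv.1 mTinv.2 cL).
rewrite -(inner_preserves mT.1 mT.2 pL iL); congr (inner mu _ _).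
by apply/funext => p; rewrite /koopman /= (skewK phi hF).
Qed.

Lemma ker_orth_invariant psi : ker_orth mu H limit_op psi ->
  ker_orth mu H limit_op (koopman T psi) /\ ker_orth mu H limit_op (koopman Tinv psi).
Proof.
move=> [Hp orth]; have [pL _] := Hp; split; split.
- exact: (Hpi_koopman 1 Hp).
- move=> g Hg Dg; have [gL _] := Hg; rewrite koopman_adjoint//.
  have Hi := Hpi_koopman_inv 1 Hg; apply: orth => //.
  have e := limit_op_koopman Hi.
  have gE : koopman T (koopman Tinv g) = g.
    by apply/funext => p; rewrite /koopman /= (skewK phi hF).
  rewrite /= gE in e.
  have e' : koopman T (limit_op (koopman Tinv g)) = cst 0 %[ae mu].
    exact: ae_eq_trans (ae_eq_sym e) Dg.
  have := ae_preserves mTinv.1 mTinv.2 e'; apply: filterS => p h pT.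
  by have := h I; rewrite /koopman /= (skew_invK phi hF).
- exact: (Hpi_koopman_inv 1 Hp).
- move=> g Hg Dg; have [gL _] := Hg; rewrite koopman_inv_adjoint//.
  apply: orth; first exact: (Hpi_koopman 1 Hg).
  apply: ae_eq_trans (limit_op_koopman Hg) _.
  have := ae_preserves mT.1 mT.2 Dg; apply: filterS => p h pT.
  exact: h.
Qed.

(** For an eigenfunction the inner products with the images have constant
modulus, the squared norm, but they tend to zero. *)
Lemma ker_orth_no_eigenvalue : no_eigenvalue mu (ker_orth mu H limit_op) (koopman T).
Proof.
move=> z psi hp ez; have [Hp _] := hp; have [pL _] := Hp.
apply: (L2norm0_ae pL); set s := L2norm mu psi.
have [//|s0] := eqVneq s 0.
have UL N : L2 mu (iter N (koopman T) psi) by case: (Hpi_koopman N Hp).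
have eN N : iter N (koopman T) psi = (fun p => z ^+ N * psi p) %[ae mu].
  elim: N => [|N IH]; first by apply: aeW => p _; rewrite expr0 mul1r.
  have e1 := ae_preserves mT.1 mT.2 IH.
  rewrite [iter N.+1 _ _]/=; apply: filterS2 e1 ez => p h1 h2 pT.
  have h2' : psi (T p) = z * psi p := h2 pT.
  have h1' : iter N (koopman T) psi (T p) = z ^+ N * psi (T p) by exact: h1.
  by rewrite [LHS]h1' h2' exprSr mulrA.
have zs N : inner mu psi (iter N (koopman T) psi) = z ^+ N * Complex (s ^+ 2) 0.
  rewrite (ae_eq_inner (L2_cmeas pL) (L2_cmeas (UL N)) (L2_cmeas pL) _ (ae_eq_refl _ _ _) (eN N)); last first.
    exact: L2_cmeas (L2Z _ pL).
  by rewrite innerZr// inner_self.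
have z1 : Normc.normc z = 1.
  have : L2norm mu (koopman T psi) = Normc.normc z * s.
    rewrite -(L2normZ z pL); apply: ae_eq_L2norm => //; first exact: L2_cmeas (UL 1).
    exact: L2_cmeas (L2Z z pL).
  rewrite /koopman (L2norm_preserves mT.1 mT.2 pL) -/s => /(congr1 (fun t => t / s)).
  by rewrite mulfK// divff.
have /cvgC_normc := ker_orth_mixing hp Hp.
have -> : (fun N => Normc.normc (inner mu psi (iter N (koopman T) psi) - 0)) = cst (s ^+ 2).
  apply/funext => N; rewrite subr0 zs Normc.normcM normc_expn z1 expr1n mul1r normc_real.
  by rewrite ger0_norm// sqr_ge0.
move=> h; have e : s ^+ 2 = 0.
  by rewrite -[RHS](cvg_lim _ h)// lim_cst.
by move/eqP: e; rewrite sqrf_eq0 => /eqP.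
Qed.

End Isotypic.

Theorem corollary3p18
  (R : realType)
  (n : nat) (X : ptopologicalType) (cX : X -> chart 'rV[R]_n X)
  (hX : compact_manifold cX)
  (muX : probability (borel X) R)
  (F : R -> X -> X) (hF : C1_flow cX F)
  (hFmu : forall t, preserves (T := borel X) muX (F t))
  (m : nat) (G : ptopologicalGroupType) (cG : G -> chart 'rV[R]_m G)
  (hG : compact_lie_group cG)
  (muG : probability (borel G) R) (hmuG : haar muG)
  (d : nat) (Pi : G -> 'M[R[i]]_d)
  (hPi : unitary_rep Pi) (hPi_irr : irreducible_rep Pi) (j : 'I_d)
  (phi : X -> G) (hphi : Ck_map 1 cX cG phi)
  (Mstar : 'rV[R]_m)
  (hcase :
    [/\ uniquely_ergodic (T := borel X) muX (F 1),
        (forall x, is_diag_mx (Pi (phi x))) &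
        Mstar = Mstar_diag F phi cG muX]
    \/ (uniquely_ergodic (muX \x muG)%E (skew_map F phi) /\
        Mstar = Mstar_skew F phi cG muX muG)) :
  let mu := (muX \x muG)%E in
  let H := Hpi muX muG Pi j in
  let U := koopman (C := R[i]) (skew_map F phi) in
  let Uinv := koopman (C := R[i]) (skew_inv F phi) in
  exists (comm : nat -> (borel X * borel G -> R[i]) -> (borel X * borel G -> R[i]))
         (D : (borel X * borel G -> R[i]) -> (borel X * borel G -> R[i])),
    [/\ forall N, is_commutator mu H (A_graph muX muG Pi j F) (iter N U) (comm N),
        strong_limit mu H
          (fun N psi p => N%:R^-1 * comm N (iter N Uinv psi) p) D,
        is_matrix_multiplication muX muG Pi j
          (Complex 0 1 *: drep cG Pi Mstar) D,
        (forall f psi, ker_orth mu H D f -> H psi ->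
           (inner mu f (iter N U psi) : R[i]^o) @[N --> \oo] --> (0 : R[i]^o)) &
        (forall psi, ker_orth mu H D psi ->
           ker_orth mu H D (U psi) /\ ker_orth mu H D (Uinv psi)) /\
        no_eigenvalue mu (ker_orth mu H D) U].
Proof.
move=> mu H U Uinv.
have [Mbar MbarE [hl hc]] : exists2 Mbar, Mbar = drep cG Pi Mstar &
    limit_along muX F cG Pi phi Mbar /\ forall x, Mbar *m Pi (phi x) = Pi (phi x) *m Mbar.
  exists (drep cG Pi Mstar) => //; case: hcase => [[ue hd ->]|[ue ->]].
    exact: (diagonal_limit hX hF hFmu hG hmuG hPi hphi ue hd).
  exact: (skew_limit hX hF hFmu hG hmuG hPi hphi ue).
exists (comm muX F cG muG Pi j phi), (limit_op muX F muG Pi j Mbar); split.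
- by move=> N; apply: comm_is_commutator; eassumption.
- by apply: average_strong_limit; eassumption.
- by rewrite -MbarE; apply: limit_op_matrix; eassumption.
- by move=> f psi hf hpsi; apply: ker_orth_mixing; eassumption.
- split; last by apply: ker_orth_no_eigenvalue; eassumption.
  by move=> psi hpsi; apply: ker_orth_invariant; eassumption.
Qed.
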